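(* Let $(a,b)\subset\mathbb{R}$ be a finite interval, $n\in\mathbb{N}\cup\{0\}$, $m,r,l\in\mathbb{N}$, and $1\le p\le\infty$. Let $A_0,\dots,A_{r-1}\in (W_p^n)^{m\times m}$ be arbitrary, put $$Ly:=y^{(r)}+\sum_{j=1}^r A_{r-j}\,y^{(r-j)},\qquad y\in (W_p^{n+r})^m,$$ and let $B\colon (W_p^{n+r})^m\to\mathbb{C}^l$ be an arbitrary continuous linear operator. Then the bounded linear operator $$(L,B)\colon (W_p^{n+r})^m\to (W_p^n)^m\times\mathbb{C}^l,\qquad y\mapsto (Ly,By),$$ is Fredholm with index $rm-l$.
   Context: Sobolev spaces: for an integer $k\ge 1$, $W_p^{k}=W_p^{k}([a,b];\mathbb{C})$ is the set of $y\in C^{k-1}([a,b];\mathbb{C})$ such that $y^{(k-1)}$ is absolutely continuous on $[a,b]$ and $y^{(k)}\in L_p[a,b]$; $W_p^0:=L_p([a,b];\mathbb{C})$. It is a Banach space with norm $\|y\|_{k,p}=\sum_{i=0}^{k}\|y^{(i)}\|_p$, where $\|\cdot\|_p$ is the $L_p$-norm. $(W_p^{k})^m$ and $(W_p^{k})^{m\times m}$ denote the spaces of $\mathbb{C}^m$-valued (columns) and $\mathbb{C}^{m\times m}$-valued functions with all entries in $W_p^k$, normed by the sum of the norms of the entries. A bounded linear operator $T\colon E_1\to E_2$ between Banach spaces is called Fredholm if its kernel and its co-kernel $E_2/T(E_1)$ are finite-dimensional; its index is $\operatorname{ind}T:=\dim\ker T-\dim (E_2/T(E_1))$. *)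

(* Defs.v *)
From HB Require Import structures.
From mathcomp Require Import all_boot all_order all_algebra ring_quotient complex.
From mathcomp Require Import all_classical all_reals all_analysis.
From mathcomp Require Import ring lra.
From mathcomp Require Import measurable_realfun ess_sup_inf.
Set Implicit Arguments. Unset Strict Implicit. Unset Printing Implicit Defensive.
Import Order.TTheory GRing.Theory Num.Theory Normc.
Import numFieldNormedType.Exports.
Local Open Scope classical_set_scope.
Local Open Scope complex_scope.
Local Open Scope ring_scope.

(* R[i] with the topology and norm of its modulus. *)
HB.instance Definition _ (R : realType) := NormedModule.copy R[i] R[i]^o.

Section Lnorm_mono.
Context d (T : measurableType d) (R : realType).
Variables (mu : {measure set T -> \bar R}) (p : \bar R).
Hypothesis p1 : (1 <= p)%E.

Lemma le_Lnorm (f g : T -> R) :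
  measurable_fun setT f -> measurable_fun setT g ->
  {ae mu, forall x, `|f x| <= `|g x|} ->
  ('N[mu]_p[EFin \o f] <= 'N[mu]_p[EFin \o g])%E.
Proof.
move=> mf mg fg; rewrite unlock; case: p p1 => [r| |] r1; last by [].
  have r0 : 0 <= r by rewrite (le_trans ler01).
  have mabs (h : T -> R) : measurable_fun setT h ->
      measurable_fun setT (fun x => (`|(h x)%:E| `^ r)%E).
    move=> mh; apply/measurable_EFinP.
    apply: (@measurableT_comp _ _ _ _ _ _ (@powR R ^~ r)) => //.
    exact: measurableT_comp.
  have i0 (h : T -> R) :
      (\int[mu]_x (`|(h x)%:E| `^ r) \in `[0, +oo])%E.
    by rewrite in_itv/= leey andbT integral_ge0// => x _; exact: poweR_ge0.
  have r'0 : 0 <= r^-1 by rewrite invr_ge0.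
  apply: (gt0_ler_poweR r'0); [exact: i0|exact: i0|].
  apply: ae_ge0_le_integral => //; [|exact: mabs| |exact: mabs|].
  - by move=> x _; exact: poweR_ge0.
  - by move=> x _; exact: poweR_ge0.
  - apply: filterS fg => x fgx _.
    by apply: gt0_ler_poweR => //; rewrite in_itv/= lee_fin normr_ge0 leey.
case: ifPn => // _; apply: le_ess_sup.
by apply: filterS fg => x fgx /=; rewrite lee_fin.
Qed.

End Lnorm_mono.

Section ae.
Context {R : realType}.
Notation mu := (@lebesgue_measure R).
Implicit Types P Q S : R -> Prop.

Lemma aeS P Q : (forall t, P t -> Q t) ->
  {ae mu, forall t, P t} -> {ae mu, forall t, Q t}.
Proof. by move=> PQ; apply: filterS => //; exact: (ae_filter_ringOfSetsType mu). Qed.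

Lemma aeS2 P Q S : (forall t, P t -> Q t -> S t) ->
  {ae mu, forall t, P t} -> {ae mu, forall t, Q t} -> {ae mu, forall t, S t}.
Proof. by move=> PQ; apply: filterS2 => //; exact: (ae_filter_ringOfSetsType mu). Qed.

Lemma aeW P : (forall t, P t) -> {ae mu, forall t, P t}.
Proof. by move=> h; apply: nearW => //; exact: (ae_filter_ringOfSetsType mu). Qed.

End ae.

Section Lp.
Context {R : realType} (a b : R) (p : \bar R).
Notation mu := (@lebesgue_measure R).
Implicit Types f g : R -> R[i].

(* The modulus is extended by 0 outside [a, b]; p = +oo is the essential supremum. *)
Definition Lp_norm f : \bar R :=
  'N[mu]_p[EFin \o (fun t => normc (f t) : R) \_ `[a, b]].

(* Measurable means Borel; this loses nothing once functions are identified
   almost everywhere, since a Lebesgue measurable function is almost everywhere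
   equal to a Borel one. *)
Definition in_Lp f : Prop :=
  [/\ measurable_fun `[a, b] (fun t => complex.Re (f t)),
      measurable_fun `[a, b] (fun t => complex.Im (f t)) & (Lp_norm f < +oo)%E].

Let mD : measurable (`[a, b]%classic : set (measurableTypeR R)).
Proof. exact: measurable_itv. Qed.

Definition cmeas f := measurable_fun `[a, b] (fun t => complex.Re (f t)) /\
                      measurable_fun `[a, b] (fun t => complex.Im (f t)).

Lemma normc_sqrtE (z : R[i]) : normc z = Num.sqrt (complex.Re z ^+ 2 + complex.Im z ^+ 2).
Proof. by case: z. Qed.

Lemma measurable_normc f : cmeas f ->
  measurable_fun setT ((fun t => normc (f t) : R) \_ `[a, b]).
Proof.
move=> [mr mi]; apply: (measurable_restrictT _ mD).1.
apply: (eq_measurable_fun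
    (Num.sqrt \o (fun t => complex.Re (f t) ^+ 2 + complex.Im (f t) ^+ 2))).
  by move=> t _ /=; rewrite normc_sqrtE.
apply: (@measurableT_comp _ _ _ _ _ _ (@Num.sqrt R)).
  by apply: continuous_measurable_fun; exact: sqrt_continuous.
by apply: measurable_funD; apply: measurable_funX.
Qed.

Hypothesis p1 : (1 <= p)%E.

Lemma normc_ge0 (z : R[i]) : 0 <= normc z.
Proof. by rewrite normc_sqrtE sqrtr_ge0. Qed.

Lemma le_Lp_norm f g : cmeas f -> cmeas g ->
  {ae mu, forall t, t \in `[a, b] -> normc (f t) <= normc (g t)} ->
  (Lp_norm f <= Lp_norm g)%E.
Proof.
move=> mf mg fg; apply: le_Lnorm => //; try exact: measurable_normc.
apply: aeS fg => t fg; rewrite /patch; case: ifPn => [|_]//.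
by rewrite inE => /fg /=; rewrite !ger0_norm// normc_ge0.
Qed.

Lemma eq_ae_Lp_norm f g : cmeas f -> cmeas g ->
  {ae mu, forall t, t \in `[a, b] -> f t = g t} -> Lp_norm f = Lp_norm g.
Proof.
move=> mf mg fg; apply/eqP; rewrite eq_le.
by apply/andP; split; apply: le_Lp_norm => //; apply: aeS fg => t fg /fg ->.
Qed.

Lemma cmeasD f g : cmeas f -> cmeas g -> cmeas (f \+ g).
Proof.
move=> [fr fi] [gr gi]; split.
  apply: (eq_measurable_fun (fun t => complex.Re (f t) + complex.Re (g t))).
    by move=> t _ /=; case: (f t) (g t) => [? ?] [? ?].
  exact: measurable_funD.
apply: (eq_measurable_fun (fun t => complex.Im (f t) + complex.Im (g t))).
  by move=> t _ /=; case: (f t) (g t) => [? ?] [? ?].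
exact: measurable_funD.
Qed.

Lemma cmeasM f g : cmeas f -> cmeas g -> cmeas (f \* g).
Proof.
move=> [fr fi] [gr gi]; split.
  apply: (eq_measurable_fun (fun t => complex.Re (f t) * complex.Re (g t) -
    complex.Im (f t) * complex.Im (g t))).
    by move=> t _ /=; case: (f t) (g t) => [? ?] [? ?].
  by apply: measurable_funB; exact: measurable_funM.
apply: (eq_measurable_fun (fun t => complex.Re (f t) * complex.Im (g t) +
    complex.Im (f t) * complex.Re (g t))).
  by move=> t _ /=; case: (f t) (g t) => [? ?] [? ?].
by apply: measurable_funD; exact: measurable_funM.
Qed.

Lemma cmeas_cst (c : R[i]) : cmeas (cst c).
Proof. by split; exact: measurable_cst. Qed.

Lemma Lp_normD f g : cmeas f -> cmeas g ->
  (Lp_norm (f \+ g)%R <= Lp_norm f + Lp_norm g)%E.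
Proof.
move=> mf mg; have mfg := cmeasD mf mg.
pose F h := (fun t => normc (h t) : R) \_ `[a, b].
apply: (@le_trans _ _ ('N[mu]_p[EFin \o (F f \+ F g)%R])%E); last first.
  by apply: eminkowski => //; exact: measurable_normc.
apply: le_Lnorm => //; first exact: measurable_normc.
  by apply: measurable_funD; exact: measurable_normc.
apply: nearW => t /=; rewrite /F /patch; case: ifPn => _ /=; last by rewrite addr0.
by rewrite !ger0_norm ?normc_ge0 ?addr_ge0 ?normc_ge0//; exact: le_normcD.
Qed.

Lemma Lp_normZ (c : R[i]) f : in_Lp f ->
  (Lp_norm (c \*: f) = (normc c)%:E * Lp_norm f)%E.
Proof.
move=> [fr fi fN].
pose F := (fun t => normc (f t) : R) \_ `[a, b].
have FL : F \in Lfun mu p.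
  apply/andP; split; rewrite inE/=; last exact: fN.
  by apply: measurable_normc; split.
have := @LnormZ _ _ _ mu p p1 (Lfun_Sub p1 FL) (normc c).
rewrite (ger0_norm (normc_ge0 c)) => <-.
congr (Lnorm _ _ _); apply/funext => t /=; congr (_%:E).
rewrite /patch /F /patch; case: ifPn => _ /=; last by rewrite scaler0.
exact: normcM.
Qed.

Lemma Lp_norm_eq0 f : cmeas f -> Lp_norm f = 0%E ->
  {ae mu, forall t, t \in `[a, b] -> f t = 0}.
Proof.
move=> mf Nf.
have p0 : (0 < p)%E by rewrite (lt_le_trans _ p1).
have mF : measurable_fun setT (EFin \o ((fun t => normc (f t) : R) \_ `[a, b])).
  by apply/measurable_EFinP; exact: measurable_normc.
have := @Lnorm_eq0_eq0 _ _ _ mu _ _ mF p0 Nf; apply: aeS => t /= /(_ I) + abt.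
rewrite /patch mem_set//= => -[] /eq0_normc; exact.
Qed.

Lemma bounded_Lp f (M : R) : cmeas f ->
  (forall t, t \in `[a, b] -> normc (f t) <= M) -> in_Lp f.
Proof.
move=> mf fM; have [fr fi] := mf; split => //.
pose M' := Num.max 0 M.
have M0 : 0 <= M' by rewrite le_max lexx.
have mc : measurable_fun setT (cst M' \_ `[a, b] : R -> R).
  by apply: (measurable_restrictT _ mD).1; exact: measurable_cst.
apply: (@le_lt_trans _ _ ('N[mu]_p[EFin \o (cst M' \_ `[a, b] : R -> R)])%E).
  apply: le_Lnorm => //; first exact: measurable_normc.
  apply: nearW => t; rewrite /patch; case: ifPn => //.
  rewrite inE => /fM /= {}fM; rewrite !ger0_norm// ?normc_ge0//.
  by rewrite le_max fM orbT.
rewrite unlock; case: p p1 => [r| |] r1; [|clear r1|by []]; last first.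
  case: ifPn => // _; apply: le_lt_trans (ltry M').
  apply/ess_supP/nearW => t; rewrite /= lee_fin /patch.
  by case: ifPn => _; rewrite ger0_norm.
have r0 : 0 < r by rewrite (lt_le_trans ltr01).
apply: poweR_lty.
rewrite [ltLHS](_ : _ = \int[mu]_(x in `[a, b]) (M' `^ r)%:E)%E.
  rewrite integral_cst// lte_mul_pinfty// ?lee_fin ?powR_ge0//.
  rewrite [ltLHS](@lebesgue_measure_itv R `[a, b])/=; case: ifPn => // _; exact: ltry.
rewrite [RHS]integral_mkcond; apply: eq_integral => t _ /=.
rewrite /patch; case: ifPn => _ /=; first by rewrite ger0_norm.
by rewrite normr0 powR0// gt_eqF.
Qed.

Lemma in_LpD f g : in_Lp f -> in_Lp g -> in_Lp (f \+ g).
Proof.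
move=> [fr fi fN] [gr gi gN].
have [? ?] := cmeasD (conj fr fi) (conj gr gi); split => //.
by rewrite (le_lt_trans (Lp_normD _ _))// lte_add_pinfty.
Qed.

Lemma in_LpZ (c : R[i]) f : in_Lp f -> in_Lp (c \*: f).
Proof.
move=> Lf; have [fr fi fN] := Lf.
have [? ?] := cmeasM (cmeas_cst c) (conj fr fi); split => //.
by rewrite Lp_normZ// lte_mul_pinfty// lee_fin normc_ge0.
Qed.

Lemma in_LpM f g (M : R) : in_Lp f -> cmeas g ->
  (forall t, t \in `[a, b] -> normc (g t) <= M) -> in_Lp (f \* g).
Proof.
move=> Lf mg gM; have [fr fi fN] := Lf.
have mfg := cmeasM (conj fr fi) mg.
have [? ? Mf] := in_LpZ M%:C Lf.
have [? ?] := mfg; split => //.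
apply: le_lt_trans Mf; apply: le_Lp_norm => //.
apply: nearW => t abt.
have M0 : 0 <= M by rewrite (le_trans _ (gM t abt))// normc_ge0.
rewrite [leRHS]normcM [leLHS]normcM mulrC ler_wpM2r ?normc_ge0//.
rewrite [leRHS]normc_sqrtE/= expr0n/= addr0 sqrtr_sqr ger0_norm//.
exact: gM.
Qed.

End Lp.

Section deriv.
Context {R : realType} (a b : R).
Notation mu := (@lebesgue_measure R).
Implicit Types (f g : R -> R[i]) (t s : R).

(* Functions are defined on R but only their values on [a, b] matter: the
   difference quotient is restricted to [a, b], hence one-sided at a and b. *)
Definition is_deriv f t (l : R[i]) : Prop :=
  ((f s - f t) / (s - t)%:C @[s --> within `[a, b] (dnbhs t)] --> l).

(* Meaningful only at the points where the limit exists. *)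
Definition deriv_fun f : R -> R[i] :=
  fun t => lim ((f s - f t) / (s - t)%:C @[s --> within `[a, b] (dnbhs t)]).

Definition is_deriv_fun f g : Prop := forall t, t \in `[a, b] -> is_deriv f t (g t).

Definition is_Cn (k : nat) f : Prop :=
  (forall i t, (i < k)%N -> t \in `[a, b] ->
    exists l, is_deriv (iter i deriv_fun f) t l) /\
  {within `[a, b], continuous (iter k deriv_fun f)}.

Definition abs_continuous f : Prop :=
  forall e : R, 0 < e -> exists2 d : R, 0 < d &
  forall (n : nat) (u v : 'I_n -> R),
    (forall i, a <= u i /\ u i <= v i /\ v i <= b) ->
    trivIset setT (fun i => `]u i, v i[%classic) ->
    \sum_i (v i - u i) < d ->
    \sum_i normc (f (v i) - f (u i)) < e.

Hypothesis ab : a < b.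

Lemma within_dnbhs_proper t : t \in `[a, b] ->
  ProperFilter (within `[a, b] (dnbhs t)).
Proof.
rewrite in_itv/= => /andP[at_ tb].
split; last exact: within_filter.
rewrite /within/= => -[e/= e0 he].
have [tltb|] := ltP t b.
  pose s := Num.min b (t + e / 2).
  have ts : t < s by rewrite lt_min tltb ltrDl divr_gt0.
  apply: (he s) => /=.
  - rewrite ltr0_norm ?subr_lt0// opprB ltrBlDl gt_min; apply/orP; right.
    by rewrite ltrD2l ltr_pdivrMr// mulr_natr mulr2n ltrDl.
  - by rewrite gt_eqF.
  - by rewrite in_itv/= (le_trans at_ (ltW ts)) ge_min lexx.
move=> bt; have tbE : t = b by apply/eqP; rewrite eq_le tb bt.
pose s := Num.max a (t - e / 2).
have ts : s < t by rewrite gt_max tbE ab ltrBlDr ltrDl divr_gt0.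
apply: (he s) => /=.
- rewrite gtr0_norm ?subr_gt0// ltrBlDr -ltrBlDl lt_max; apply/orP; right.
  by rewrite ltrD2l ltrN2 ltr_pdivrMr// mulr_natr mulr2n ltrDl.
- by rewrite lt_eqF.
- by rewrite in_itv/= le_max lexx (le_trans (ltW ts) tb).
Qed.

Lemma is_deriv_unique f t l l' : t \in `[a, b] ->
  is_deriv f t l -> is_deriv f t l' -> l = l'.
Proof.
move=> tab h h'; have PF := within_dnbhs_proper tab.
by apply: (cvg_unique _ h h'); exact: norm_hausdorff.
Qed.

Lemma deriv_funE f t l : t \in `[a, b] -> is_deriv f t l -> deriv_fun f t = l.
Proof.
move=> tab h; have PF := within_dnbhs_proper tab.
by apply/cvg_lim => //; exact: norm_hausdorff.
Qed.

Lemma deriv_funP f t : t \in `[a, b] -> (exists l, is_deriv f t l) ->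
  is_deriv f t (deriv_fun f t).
Proof. by move=> tab [l fl]; rewrite (deriv_funE tab fl). Qed.

Lemma eq_is_deriv f g t l : t \in `[a, b] -> {in `[a, b], f =1 g} ->
  is_deriv f t l -> is_deriv g t l.
Proof.
move=> tab fg; apply: cvg_trans; apply: near_eq_cvg.
rewrite near_withinE; apply: nearW => s sab.
by rewrite !fg.
Qed.

Lemma eq_deriv_fun f g : {in `[a, b], f =1 g} ->
  {in `[a, b], deriv_fun f =1 deriv_fun g}.
Proof.
move=> fg t tab; rewrite /deriv_fun.
suff -> : ((f s - f t) / (s - t)%:C @[s --> within `[a, b] (dnbhs t)]) =
   ((g s - g t) / (s - t)%:C @[s --> within `[a, b] (dnbhs t)]) by [].
apply/seteqP; split => A; apply: near_eq_cvg; rewrite near_withinE;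
  by apply: nearW => s sab; rewrite !fg.
Qed.

Lemma eq_fun_cvg (F : set_system R) (u v : R -> R[i]) (l : R[i]) :
  u =1 v -> u @ F --> l -> v @ F --> l.
Proof. by move=> /funext ->. Qed.

Lemma is_deriv_lin c f g t l l' :
  is_deriv f t l -> is_deriv g t l' ->
  is_deriv (c \*: f \+ g) t (c * l + l').
Proof.
move=> fl gl.
have FF : Filter (within `[a, b] (dnbhs t)) by exact: within_filter.
have h1 := @cvgM R[i] R _ FF _ _ _ _ (@cvg_cst R[i] c R _ FF) fl.
have h2 := @cvgD R[i] R[i] R _ FF _ _ _ _ h1 gl.
apply: eq_fun_cvg h2 => s.
change (c * ((f s - f t) / (s - t)%:C) + (g s - g t) / (s - t)%:C =
  (c * f s + g s - (c * f t + g t)) / (s - t)%:C).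
by rewrite opprD addrACA -mulrBr [RHS]mulrDl -mulrA.
Qed.

Lemma is_deriv_cvg f t l : is_deriv f t l ->
  f s @[s --> within `[a, b] (dnbhs t)] --> f t.
Proof.
move=> fl.
have FF : Filter (within `[a, b] (dnbhs t)) by exact: within_filter.
have st : ((s - t)%:C : R[i]) @[s --> within `[a, b] (dnbhs t)] --> (0 : R[i]).
  apply/(@cvgrPdist_lt R[i] R[i] R _ FF) => e e0.
  have eR : e = (complex.Re e)%:C by rewrite RRe_real// gtr0_real.
  rewrite near_withinE; apply: nbhs_dnbhs.
  exists (complex.Re e) => /=; first by rewrite -(ltcR 0) -eR.
  move=> s /= h _; rewrite sub0r normrN normc_def /= expr0n/= addr0 sqrtr_sqr.
  by rewrite eR ltcR distrC.
have h1 := @cvgM R[i] R _ FF _ _ _ _ fl st.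
have h2 := @cvgD R[i] R[i] R _ FF _ _ _ _ h1 (@cvg_cst R[i] (f t) R _ FF).
move: h2; rewrite mulr0 add0r; apply: cvg_trans; apply: near_eq_cvg.
rewrite near_withinE; near=> s => sab.
change ((f s - f t) / (s - t)%:C * (s - t)%:C + f t = f s).
rewrite mulfVK ?subrK//.
rewrite (inj_eq (@complexI R) _ 0) subr_eq0.
by near: s; exact: nbhs_dnbhs_neq.
Unshelve. all: by end_near. Qed.

Lemma is_deriv_within f t l : is_deriv f t l ->
  f s @[s --> within `[a, b] (nbhs t)] --> f t.
Proof.
move=> /is_deriv_cvg h A At; have := h A At.
rewrite /within/= => -[e/= e0 he]; exists e => //= s se sab.
have [->|st] := eqVneq s t; first exact: nbhs_singleton.
exact: he.
Qed.

Lemma is_derivM f g t l l' :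
  is_deriv f t l -> is_deriv g t l' ->
  is_deriv (f \* g) t (l * g t + f t * l').
Proof.
move=> fl gl.
have FF : Filter (within `[a, b] (dnbhs t)) by exact: within_filter.
have h1 := @cvgM R[i] R _ FF _ _ _ _ fl (is_deriv_cvg gl).
have h2 := @cvgM R[i] R _ FF _ _ _ _ (@cvg_cst R[i] (f t) R _ FF) gl.
have h3 := @cvgD R[i] R[i] R _ FF _ _ _ _ h1 h2.
apply: eq_fun_cvg h3 => s; 
change ((f s - f t) / (s - t)%:C * g s + f t * ((g s - g t) / (s - t)%:C) =
  (f s * g s - f t * g t) / (s - t)%:C).
rewrite mulrAC mulrA -mulrDl; congr (_ / _).
by rewrite mulrBl mulrBr addrA subrK.
Qed.

Lemma is_deriv_fun_cont f g : is_deriv_fun f g -> {within `[a, b], continuous f}.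
Proof.
move=> fg; apply/subspace_continuousP => t tab.
by apply: (@is_deriv_within _ _ (g t)); exact: fg.
Qed.

Lemma abs_Re_le (z : R[i]) : `|complex.Re z| <= normc z.
Proof.
by rewrite normc_sqrtE -sqrtr_sqr ler_sqrt ?addr_ge0 ?sqr_ge0// lerDl sqr_ge0.
Qed.

Lemma abs_Im_le (z : R[i]) : `|complex.Im z| <= normc z.
Proof.
by rewrite normc_sqrtE -sqrtr_sqr ler_sqrt ?addr_ge0 ?sqr_ge0// lerDr sqr_ge0.
Qed.

Lemma normc_le (z : R[i]) : normc z <= `|complex.Re z| + `|complex.Im z|.
Proof.
rewrite normc_sqrtE -[leRHS]ger0_norm ?addr_ge0// -sqrtr_sqr ler_sqrt ?sqr_ge0//.
rewrite sqrrD !real_normK ?num_real// lerD2r lerDl.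
by rewrite mulrn_wge0// mulr_ge0.
Qed.

Lemma lip_continuous (h : R[i] -> R) :
  (forall z w, `|h z - h w| <= normc (z - w)) -> continuous h.
Proof.
move=> hL z A /nbhs_ballP[e /= e0 eA]; apply/nbhs_ballP; exists e%:C => /=.
  by rewrite ltcR.
move=> w; rewrite -ball_normE/= normc_def ltcR => zw; apply: eA.
by rewrite -ball_normE/= (le_lt_trans (hL _ _))// normc_sqrtE.
Qed.

Lemma ReB (z w : R[i]) : complex.Re (z - w) = complex.Re z - complex.Re w.
Proof. by case: z w => ? ? [? ?]. Qed.

Lemma ImB (z w : R[i]) : complex.Im (z - w) = complex.Im z - complex.Im w.
Proof. by case: z w => ? ? [? ?]. Qed.

Lemma Re_divR (z : R[i]) (c : R) : complex.Re (z / c%:C) = complex.Re z / c.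
Proof. by rewrite -fmorphV; case: z => ? ? /=; rewrite mulr0 subr0. Qed.

Lemma Im_divR (z : R[i]) (c : R) : complex.Im (z / c%:C) = complex.Im z / c.
Proof. by rewrite -fmorphV; case: z => ? ? /=; rewrite mulr0 add0r. Qed.

Lemma Re_continuous : continuous (fun z : R[i] => complex.Re z).
Proof. by apply: lip_continuous => z w; rewrite -ReB abs_Re_le. Qed.

Lemma Im_continuous : continuous (fun z : R[i] => complex.Im z).
Proof. by apply: lip_continuous => z w; rewrite -ImB abs_Im_le. Qed.

Lemma normc_continuous : continuous (fun z : R[i] => normc z).
Proof.
apply: lip_continuous => z w; rewrite ler_norml lerNl opprB !lerBlDr.
apply/andP; split.
  by rewrite -(normcN (z - w)) opprB (le_trans _ (le_normcD _ _))// subrK.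
by rewrite (le_trans _ (le_normcD _ _))// subrK.
Qed.

Lemma within_comp f (h : R[i] -> R) : continuous h ->
  {within `[a, b], continuous f} ->
  {within `[a, b], continuous (fun t => h (f t))}.
Proof. by move=> ch cf t; apply: continuous_comp; [exact: cf|exact: ch]. Qed.

Lemma cont_cmeas f : {within `[a, b], continuous f} -> cmeas a b f.
Proof.
move=> cf; split; apply: subspace_continuous_measurable_fun => //.
  exact: (within_comp Re_continuous cf).
exact: (within_comp Im_continuous cf).
Qed.

Lemma cont_bounded f : {within `[a, b], continuous f} ->
  exists2 M, 0 <= M & forall t, t \in `[a, b] -> normc (f t) <= M.
Proof.
move=> cf; have [c _ cM] := EVT_max (ltW ab) (within_comp normc_continuous cf).
by exists (normc (f c)) => //; exact: normc_ge0.
Qed.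

Lemma cont_Lp p f : (1 <= p)%E -> {within `[a, b], continuous f} ->
  in_Lp a b p f.
Proof.
move=> p1 cf; have [M _ fM] := cont_bounded cf.
exact: (bounded_Lp p1 (cont_cmeas cf) fM).
Qed.

Lemma contD f g : {within `[a, b], continuous f} ->
  {within `[a, b], continuous g} -> {within `[a, b], continuous (f \+ g)}.
Proof.
move=> cf cg t.
exact: (@cvgD R[i] R[i] _ _ _ _ _ _ _ (cf t) (cg t)).
Qed.

Lemma contM f g : {within `[a, b], continuous f} ->
  {within `[a, b], continuous g} -> {within `[a, b], continuous (f \* g)}.
Proof.
move=> cf cg t.
exact: (@cvgM R[i] _ _ _ _ _ _ _ (cf t) (cg t)).
Qed.

Lemma cont_cst (c : R[i]) : {within `[a, b], continuous (cst c : R -> R[i])}.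
Proof. by move=> t; exact: (@cvg_cst R[i]). Qed.

Lemma eq_cont f g : {in `[a, b], f =1 g} ->
  {within `[a, b], continuous f} -> {within `[a, b], continuous g}.
Proof.
move=> fg; apply: subspace_eq_continuous => t.
by rewrite inE => tab; exact: fg.
Qed.

Lemma eq_AC f g : {in `[a, b], f =1 g} -> abs_continuous f -> abs_continuous g.
Proof.
move=> fg fAC e /fAC[d d0 dP]; exists d => // n u v uv tuv suv.
rewrite (eq_bigr (fun i => normc (f (v i) - f (u i)))); first exact: dP.
move=> i _; have [? [? ?]] := uv i.
by rewrite !fg// in_itv/=; apply/andP; split => //; lra.
Qed.

Lemma AC_dom f g h M : 0 <= M ->
  (forall u v, u \in `[a, b] -> v \in `[a, b] ->
    normc (h v - h u) <= M * (normc (f v - f u) + normc (g v - g u))) ->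
  abs_continuous f -> abs_continuous g -> abs_continuous h.
Proof.
move=> M0 hM fAC gAC e e0.
have e1 : 0 < e / 2 / (M + 1) by rewrite !divr_gt0// ltr_wpDl.
have [d1 d10 d1P] := fAC _ e1; have [d2 d20 d2P] := gAC _ e1.
exists (Num.min d1 d2); first by rewrite lt_min d10.
move=> n u v uv tuv; rewrite lt_min => /andP[s1 s2].
apply: (@le_lt_trans _ _ (M * (\sum_i normc (f (v i) - f (u i)) +
                              \sum_i normc (g (v i) - g (u i))))).
  rewrite -big_split/= mulr_sumr; apply: ler_sum => i _.
  have [? [? ?]] := uv i.
  by apply: hM; rewrite in_itv/=; apply/andP; split => //; lra.
have {}d1P := d1P n u v uv tuv s1.
have {}d2P := d2P n u v uv tuv s2.
apply: (@le_lt_trans _ _ (M * (e / (M + 1)))).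
  apply: ler_wpM2l => //; rewrite ltW//.
  have -> : e / (M + 1) = e / 2 / (M + 1) + e / 2 / (M + 1).
    by rewrite -mulrDl -splitr.
  exact: ltrD.
rewrite mulrCA gtr_pMr// ltr_pdivrMr ?mul1r ?ltrDl// ltr_wpDl//.
Qed.

Lemma AC_lip h M : 0 <= M ->
  (forall u v, u \in `[a, b] -> v \in `[a, b] -> u <= v ->
    normc (h v - h u) <= M * (v - u)) -> abs_continuous h.
Proof.
move=> M0 hM e e0; exists (e / (M + 1)); first by rewrite divr_gt0// ltr_wpDl.
move=> n u v uv _ s1.
apply: (@le_lt_trans _ _ (M * (e / (M + 1)))).
  apply: (@le_trans _ _ (M * \sum_i (v i - u i))); last first.
    by rewrite ler_wpM2l// ltW.
  rewrite mulr_sumr; apply: ler_sum => i _; have [? [? ?]] := uv i.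
  by apply: hM => //; rewrite in_itv/=; apply/andP; split => //; lra.
rewrite mulrCA gtr_pMr// ltr_pdivrMr ?mul1r ?ltrDl// ltr_wpDl//.
Qed.

Lemma AC_lin c f g : abs_continuous f -> abs_continuous g ->
  abs_continuous (c \*: f \+ g).
Proof.
apply: (@AC_dom _ _ _ (normc c + 1)); first by rewrite addr_ge0// normc_ge0.
move=> u v _ _ /=.
rewrite opprD addrACA -scalerBr (le_trans (le_normcD _ _))// [normc (c *: _)]normcM.
have := normc_ge0 c; have := normc_ge0 (f v - f u); have := normc_ge0 (g v - g u).
nra.
Qed.

Lemma AC_continuous f : abs_continuous f -> {within `[a, b], continuous f}.
Proof.
move=> fAC; apply/subspace_continuousP => t tab.
have FF : Filter (within `[a, b] (nbhs t)) by exact: within_filter.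
apply/(@cvgrPdist_lt R[i] R[i] R _ FF) => e e0.
have eR : e = (complex.Re e)%:C by rewrite RRe_real// gtr0_real.
have e0' : 0 < complex.Re e by rewrite -(ltcR 0) -eR.
have [d d0 dP] := fAC _ e0'.
rewrite near_withinE; exists d => // s /= std sab.
rewrite normc_def eR ltcR -normc_sqrtE.
have key u v : u \in `[a, b] -> v \in `[a, b] -> u <= v -> v - u < d ->
    normc (f v - f u) < complex.Re e.
  rewrite !in_itv/= => /andP[? ?] /andP[? ?] uv uvd.
  have := dP 1%N (fun=> u) (fun=> v).
  rewrite !big_ord1; apply => //.
  by move=> i j _ _ _; rewrite !ord1.
have [st|/ltW ts] := leP s t.
  by apply: key => //; rewrite ger0_norm in std; lra.
rewrite -normcN opprB; apply: key => //.
by rewrite ler0_norm in std; lra.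
Qed.

Lemma AC_M f g : abs_continuous f -> abs_continuous g -> abs_continuous (f \* g).
Proof.
move=> fAC gAC.
have [M M0 fM] := cont_bounded (AC_continuous fAC).
have [N N0 gN] := cont_bounded (AC_continuous gAC).
apply: (@AC_dom f g _ (M + N)) => //; first exact: addr_ge0.
move=> u v uab vab /=.
have -> : f v * g v - f u * g u = (f v - f u) * g v + f u * (g v - g u).
  by rewrite mulrBl mulrBr addrA subrK.
rewrite (le_trans (le_normcD _ _))// !normcM.
have := gN v vab; have := fM u uab.
have := normc_ge0 (f v - f u); have := normc_ge0 (g v - g u).
have := normc_ge0 (g v); have := normc_ge0 (f u).
nra.
Qed.

Lemma is_deriv_part (h : R[i] -> R) f t l : continuous h ->
  (forall z w, h (z - w) = h z - h w) ->
  (forall z (c : R), h (z / c%:C) = h z / c) ->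
  t \in `]a, b[ -> is_deriv f t l ->
  is_derive t 1 (fun s => h (f s)) (h l).
Proof.
move=> ch hB hZ tab fl.
suff cv : (s^-1 *: (((fun s => h (f s)) \o shift t) (s *: 1) - h (f t))) @[s --> 0^'] --> h l.
  apply: DeriveDef; first by apply/cvg_ex; exists (h l).
  exact/cvg_lim.
have c1 : h ((f s - f t) / (s - t)%:C) @[s --> within `[a, b] (dnbhs t)] --> h l.
  by apply: (cvg_comp _ _ fl); exact: ch.
move=> A /c1; rewrite /fmap/= /within/= => -[e /= e0 he].
move: tab; rewrite in_itv/= => /andP[at_ tb].
pose e' := Num.min e (Num.min (t - a) (b - t)).
have e'0 : 0 < e' by rewrite !lt_min e0 !subr_gt0 at_ tb.
exists e' => // s /=; rewrite sub0r normrN !lt_min => /and3P[se sa sb] s0.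
have := he (s + t); rewrite /= opprD addrCA subrr addr0 normrN => /(_ se).
have -> : (s + t != t) by rewrite -subr_eq0 addrK.
move=> /(_ isT); rewrite addrK hZ hB mulrC.
rewrite /GRing.scale/= mulr1; apply.
rewrite in_itv/=; move: sa sb; rewrite !ltr_norml => /andP[? ?] /andP[? ?].
apply/andP; split; lra.
Qed.

Lemma C1_AC f g : is_deriv_fun f g -> {within `[a, b], continuous g} ->
  abs_continuous f.
Proof.
move=> fg cg; have [M M0 gM] := cont_bounded cg.
have cf := is_deriv_fun_cont fg.
apply: (@AC_lip _ (M + M)); first exact: addr_ge0.
have key (h : R[i] -> R) u v : continuous h ->
  (forall z w, h (z - w) = h z - h w) ->
  (forall z (c : R), h (z / c%:C) = h z / c) -> (forall z, `|h z| <= normc z) ->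
  u \in `[a, b] -> v \in `[a, b] -> u <= v -> `|h (f v - f u)| <= M * (v - u).
  move=> ch hB hZ hN; rewrite !in_itv/= => /andP[au ub] /andP[av vb] uv.
  have sub : `[u, v] `<=` `[a, b].
    by apply: subset_itv; rewrite bnd_simp.
  have dh x : x \in `]u, v[ ->
      is_derive x 1 (fun s => h (f s)) (h (g x)).
    rewrite in_itv/= => /andP[? ?]; apply: is_deriv_part => //.
      by rewrite in_itv/=; apply/andP; split; lra.
    by apply: fg; rewrite in_itv/=; apply/andP; split; lra.
  have chf : {within `[u, v], continuous (fun s => h (f s))}.
    exact: continuous_subspaceW sub (within_comp ch cf).
  have [c cuv] := MVT_segment uv dh chf.
  rewrite hB => ->; rewrite normrM (ger0_norm (_ : 0 <= v - u)) ?subr_ge0//.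
  rewrite ler_wpM2r ?subr_ge0// (le_trans (hN _))//.
  by apply: gM; exact: sub.
move=> u v uab vab uv.
apply: (le_trans (normc_le _)); rewrite mulrDl; apply: lerD; apply: key => //.
- exact: Re_continuous.
- exact: ReB.
- exact: Re_divR.
- exact: abs_Re_le.
- exact: Im_continuous.
- exact: ImB.
- exact: Im_divR.
- exact: abs_Im_le.
Qed.

End deriv.

Section sobolev_fun.
Context {R : realType} (a b : R) (p : \bar R).
Notation mu := (@lebesgue_measure R).
Notation D := (deriv_fun a b).
Implicit Types f g h : R -> R[i].

Definition ae_deriv f g : Prop :=
  {ae mu, forall t, t \in `[a, b] -> is_deriv a b f t (g t)}.

(* For k = k'.+1, the last clause is f^(k) \in L_p: the derivative of f^(k')
   exists almost everywhere (automatic by absolute continuity) and is almost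
   everywhere equal to an L_p function. *)
Definition is_sobolev (k : nat) f : Prop :=
  match k with
  | 0 => in_Lp a b p f
  | k'.+1 => [/\ is_Cn a b k' f, abs_continuous a b (iter k' D f) &
               exists2 g, in_Lp a b p g & ae_deriv (iter k' D f) g]
  end.

(* The i-th derivative of f in W_p^k, i <= k.  For 0 < i = k it is only defined
   almost everywhere, and a representative in L_p is chosen. *)
Definition sderiv (k i : nat) f : R -> R[i] :=
  match i with
  | 0 => f
  | j.+1 => if (i < k)%N then iter i D f
            else xget (cst 0) [set g | in_Lp a b p g /\ ae_deriv (iter j D f) g]
  end.

(* When f and g represent the same element of W_p^k: for k = 0 elements are
   classes up to almost everywhere equality, otherwise functions on [a, b]. *)
Definition sob_eq (k : nat) f g : Prop :=
  match k with
  | 0 => {ae mu, forall t, t \in `[a, b] -> f t = g t}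
  | _ => {in `[a, b], f =1 g}
  end.

Hypothesis ab : a < b.
Hypothesis p1 : (1 <= p)%E.

Lemma is_Cn_cont k f : is_Cn a b k f -> {within `[a, b], continuous (iter k D f)}.
Proof. by case. Qed.

Lemma is_CnS k f : is_Cn a b k.+1 f <-> is_deriv_fun a b f (D f) /\ is_Cn a b k (D f).
Proof.
split=> [[fd fc]|[fd [Dd Dc]]].
  split; first by move=> t tab; apply: deriv_funP => //; exact: (fd 0%N).
  split; last by rewrite -iterSr.
  by move=> i t ik tab; rewrite -iterSr; exact: fd.
split; last by rewrite iterSr.
move=> [|i] t ik tab; first by exists (D f t); exact: fd.
by rewrite iterSr; exact: Dd.
Qed.

Lemma sobolevSS k f : is_sobolev k.+2 f <->
  is_deriv_fun a b f (D f) /\ is_sobolev k.+1 (D f).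
Proof.
rewrite /is_sobolev iterSr; split=> [[/is_CnS[? ?] ? ?]|[? [? ? ?]]].
  by split; last split.
by split; [exact/is_CnS| |].
Qed.

Lemma eq_iter_deriv f g i : {in `[a, b], f =1 g} ->
  {in `[a, b], iter i D f =1 iter i D g}.
Proof.
by move=> fg; elim: i => //= i ih; apply: eq_deriv_fun.
Qed.

Lemma eq_in_Lp f g : {in `[a, b], f =1 g} -> in_Lp a b p f -> in_Lp a b p g.
Proof.
move=> fg [fr fi fN]; split.
- apply: eq_measurable_fun fr => t; rewrite inE => tab.
  by rewrite fg.
- apply: eq_measurable_fun fi => t; rewrite inE => tab.
  by rewrite fg.
- rewrite /Lp_norm (_ : _ \_ _ = (fun t => normc (f t) : R) \_ `[a, b])//.
  apply/funext => t; rewrite /patch; case: ifPn => //.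
  by rewrite inE => tab; rewrite fg.
Qed.

Lemma eq_ae_deriv f f' g : {in `[a, b], f =1 f'} -> ae_deriv f g -> ae_deriv f' g.
Proof. by move=> fg; apply: aeS => t h tab; exact: eq_is_deriv (h tab). Qed.

Lemma eq_sobolev k f g : {in `[a, b], f =1 g} -> is_sobolev k f -> is_sobolev k g.
Proof.
move=> fg; elim: k f g fg => [|[|k] ih] f g fg; first exact: eq_in_Lp.
  move=> [[_ fc] fAC [h hL fh]]; split.
  - by split; [by []|exact: (eq_cont fg fc)].
  - exact: eq_AC fAC.
  - by exists h => //; exact: eq_ae_deriv fh.
move=> /sobolevSS[fd fs]; apply/sobolevSS; split.
  move=> t tab; rewrite -(eq_deriv_fun fg tab).
  by apply: (eq_is_deriv tab fg); exact: fd.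
by apply: ih fs; exact: eq_deriv_fun.
Qed.

Lemma ae_deriv_lin c f g f' g' : ae_deriv f f' -> ae_deriv g g' ->
  ae_deriv (c \*: f \+ g) (c \*: f' \+ g').
Proof.
by apply: aeS2 => t hf hg tab; exact: (is_deriv_lin (hf tab) (hg tab)).
Qed.

Lemma is_deriv_fun_lin c f g f' g' : is_deriv_fun a b f f' ->
  is_deriv_fun a b g g' -> is_deriv_fun a b (c \*: f \+ g) (c \*: f' \+ g').
Proof.
by move=> hf hg t tab; exact: (is_deriv_lin (hf t tab) (hg t tab)).
Qed.

Lemma is_deriv_fun_eq f g : is_deriv_fun a b f g -> {in `[a, b], g =1 D f}.
Proof. by move=> fg t tab; rewrite (deriv_funE ab tab (fg t tab)). Qed.

Lemma sobolev_lin k c f g : is_sobolev k f -> is_sobolev k g ->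
  is_sobolev k (c \*: f \+ g).
Proof.
elim: k f g => [|[|k] ih] f g.
- by move=> fL gL; apply: in_LpD => //; exact: in_LpZ.
- move=> [[_ fc] fAC [f' f'L ff']] [[_ gc] gAC [g' g'L gg']].
  have AC : abs_continuous a b (c \*: f \+ g) by exact: AC_lin.
  split; [|exact: AC|].
    by split; [by []|exact: (AC_continuous AC)].
  exists (c \*: f' \+ g'); last exact (ae_deriv_lin c ff' gg').
  by apply: in_LpD => //; exact: in_LpZ.
- move=> /sobolevSS[fd fs] /sobolevSS[gd gs]; apply/sobolevSS.
  have h := is_deriv_fun_lin fd gd (c := c); have e := is_deriv_fun_eq h.
  split; first by move=> t tab; rewrite -e//; exact: h.
  by apply: (eq_sobolev e); exact: ih.
Qed.

Lemma sobolev0 k : is_sobolev k (0 : R -> R[i]).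
Proof.
have c0 : {within `[a, b], continuous (0 : R -> R[i])} by exact: cont_cst.
have d0 : is_deriv_fun a b (0 : R -> R[i]) (0 : R -> R[i]).
  move=> t tab; rewrite /is_deriv.
  have FF : Filter (within `[a, b] (dnbhs t)) by exact: within_filter.
  apply: eq_fun_cvg (@cvg_cst R[i] 0 R _ FF) => s.
  by rewrite /= subrr mul0r.
elim: k => [|[|k] ih]; first exact: cont_Lp.
  split; [by split|exact: (C1_AC ab d0)|].
  by exists 0; [exact: cont_Lp|apply: aeW => t; exact: d0].
apply/sobolevSS; have e := is_deriv_fun_eq d0.
split; first by move=> t tab; rewrite -e//; exact: d0.
exact: (eq_sobolev e).
Qed.

Lemma sobolevS_cont k f : is_sobolev k.+1 f -> {within `[a, b], continuous f}.
Proof.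
case: k => [[[]]//|k] /sobolevSS[fd _]; exact: is_deriv_fun_cont fd.
Qed.

Lemma sobolevW k f : is_sobolev k.+1 f -> is_sobolev k f.
Proof.
elim: k f => [|[|k] ih] f.
- by move=> /sobolevS_cont; exact: cont_Lp.
- move=> /sobolevSS[fd fs]; split.
  + by split => //; exact: is_deriv_fun_cont fd.
  + exact: (C1_AC ab fd (sobolevS_cont fs)).
  + by exists (D f); [exact: ih|apply: aeW => t; exact: fd].
- by move=> /sobolevSS[fd fs]; apply/sobolevSS; split => //; exact: ih.
Qed.

Lemma sobolev_leq i k f : (i <= k)%N -> is_sobolev k f -> is_sobolev i f.
Proof.
move=> /subnK <-; elim: (k - i)%N => // j ih; rewrite addSn => /sobolevW.
exact: ih.
Qed.

Lemma sobolevM k f g : is_sobolev k f -> is_sobolev k.+1 g -> is_sobolev k (f \* g).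
Proof.
elim: k f g => [|[|k] ih] f g fs gs.
- have gc := sobolevS_cont gs; have [M _ gM] := cont_bounded ab gc.
  exact: (in_LpM p1 fs (cont_cmeas gc) gM).
- have [[_ fc] fAC [f' f'L ff']] := fs.
  have [_ gAC _] := sobolevW gs.
  have gc := sobolevS_cont gs; have [M _ gM] := cont_bounded ab gc.
  have /sobolevSS[gd g's] := gs.
  have g'c := sobolevS_cont g's.
  have AC : abs_continuous a b (f \* g) by exact: AC_M.
  split; [|exact: AC|].
    by split; [by []|exact: (AC_continuous AC)].
  exists ((f' \* g) \+ (f \* D g)).
    apply: in_LpD => //; first exact: (in_LpM p1 f'L (cont_cmeas gc) gM).
    exact: (cont_Lp ab p1 (contM fc g'c)).
  apply: aeS ff' => t ff' tab.
  by apply: is_derivM; [exact: ff'|exact: gd].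
- have /sobolevSS[fd f's] := fs; have /sobolevSS[gd g's] := gs.
  have h : is_deriv_fun a b (f \* g) ((D f \* g) \+ (f \* D g)).
    by move=> t tab; apply: is_derivM; [exact: fd|exact: gd].
  apply/sobolevSS; have e := is_deriv_fun_eq h.
  split; first by move=> t tab; rewrite -e//; exact: h.
  apply: (eq_sobolev e).
  have e1 : {in `[a, b], 1 \*: (D f \* g) \+ (f \* D g) =1
                         (D f \* g) \+ (f \* D g)}.
    by move=> t _; rewrite /= scale1r.
  apply: (eq_sobolev e1).
  exact: (sobolev_lin 1 (ih _ _ f's (sobolevW gs)) (ih _ _ (sobolevW fs) g's)).
Qed.

Lemma sobolev_iter k i f : is_sobolev (k.+1 + i) f -> is_sobolev k.+1 (iter i D f).
Proof.
elim: i f => [|i ih] f; first by rewrite addn0.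
by rewrite addnS addSn iterSr => /sobolevSS[_ ?]; exact: ih.
Qed.

Lemma sderivP i f : is_sobolev i.+1 f ->
  in_Lp a b p (sderiv i.+1 i.+1 f) /\ ae_deriv (iter i D f) (sderiv i.+1 i.+1 f).
Proof.
move=> [_ _ [g gL fg]]; rewrite /sderiv ltnn.
by case: xgetP => [h _ //|/(_ g)]; case; split.
Qed.

Lemma sobolev_sderiv k i f : is_sobolev (k + i) f ->
  is_sobolev k (sderiv (k + i) i f).
Proof.
case: k => [|k]; last first.
  move=> /sobolev_iter; rewrite /sderiv; case: i => // i.
  by rewrite -[X in (X < _)%N]add0n ltn_add2r.
by case: i => // i; rewrite add0n => /sderivP[].
Qed.

Lemma sderiv_Lp k i f : (i <= k)%N -> is_sobolev k f -> in_Lp a b p (sderiv k i f).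
Proof.
move=> /subnK <- /sobolev_sderiv; exact: (@sobolev_leq 0).
Qed.

Lemma sob_eq_ae k f g : sob_eq k f g ->
  {ae mu, forall t, t \in `[a, b] -> f t = g t}.
Proof. by case: k => // k fg; exact: aeW. Qed.

Lemma sob_eqS k j f g : sob_eq k.+1 f g -> sob_eq j f g.
Proof. by case: j => // /(@sob_eq_ae k.+1). Qed.

Lemma sob_eq_refl k f : sob_eq k f f.
Proof. by case: k => //; exact: aeW. Qed.

Lemma sob_eq_sym k f g : sob_eq k f g -> sob_eq k g f.
Proof.
case: k => [|k] /=; first by apply: aeS => t e /e.
by move=> e t /e.
Qed.

Lemma sob_eq_op (op : R[i] -> R[i] -> R[i]) k f g f' g' :
  sob_eq k f f' -> sob_eq k g g' ->
  sob_eq k (fun t => op (f t) (g t)) (fun t => op (f' t) (g' t)).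
Proof.
case: k => [|k] /=; first by apply: aeS2 => t e e' tab; rewrite e ?e'.
by move=> e e' t tab; rewrite e ?e'.
Qed.

Lemma sob_eq_trans k f g h : sob_eq k f g -> sob_eq k g h -> sob_eq k f h.
Proof.
case: k => [|k] /=; first by apply: aeS2 => t e e' tab; rewrite e ?e'.
by move=> e e' t tab; rewrite e ?e'.
Qed.

Lemma sob_eq_sum k (I : Type) (s : seq I) (f g : I -> R -> R[i]) :
  (forall i, sob_eq k (f i) (g i)) ->
  sob_eq k (fun t => \sum_(i <- s) f i t) (fun t => \sum_(i <- s) g i t).
Proof.
move=> fg; elim: s => [|i s ih].
  under eq_fun do rewrite big_nil.
  by under [X in sob_eq _ _ X]eq_fun do rewrite big_nil; exact: sob_eq_refl.
under eq_fun do rewrite big_cons.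
under [X in sob_eq _ _ X]eq_fun do rewrite big_cons.
exact: (sob_eq_op +%R (fg i) ih).
Qed.

Lemma sob_eqB0 k f g : sob_eq k (f - g) (cst 0) <-> sob_eq k f g.
Proof.
split=> e.
  have := sob_eq_op +%R e (sob_eq_refl k g).
  congr (sob_eq k _ _); apply/funext => t; last by rewrite /= add0r.
  exact: subrK.
have := sob_eq_op (fun x y => x - y) e (sob_eq_refl k g).
by congr (sob_eq k _ _); apply/funext => t; rewrite /= subrr.
Qed.

Lemma sob_eq_Lp_norm k f g : cmeas a b f -> cmeas a b g -> sob_eq k f g ->
  Lp_norm a b p f = Lp_norm a b p g.
Proof. by move=> mf mg /sob_eq_ae; exact: eq_ae_Lp_norm. Qed.

Lemma cont_ae0 f : {within `[a, b], continuous f} ->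
  {ae mu, forall t, t \in `[a, b] -> f t = 0} -> {in `[a, b], f =1 cst 0}.
Proof.
move=> fc f0 t tab; apply/eqP/negP => ft0.
have ft : 0 < normc (f t).
  rewrite lt_neqAle normc_ge0 andbT eq_sym.
  by apply/eqP => /eq0_normc ft; apply: ft0; rewrite ft.
have nfc := within_comp (@normc_continuous R) fc.
have /subspace_continuousP /(_ t tab) := nfc.
have FF : Filter (within `[a, b] (nbhs t)) by exact: within_filter.
move=> /cvgrPdist_lt /(_ _ ft); rewrite near_withinE => -[e /= e0 he].
have fn0 s : `|t - s| < e -> s \in `[a, b] -> f s <> 0.
  move=> ts sab fs; have /= := he s ts sab.
  rewrite /from_subspace/= fs normc0 subr0 ger0_norm ?ltxx//.
  exact: normc_ge0.
pose c := Num.max a (t - e); pose d := Num.min b (t + e).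
move: (tab); rewrite in_itv/= => /andP[at_ tb].
have cd : c < d.
  have tle : t < t + e by rewrite ltrDl.
  rewrite lt_min !gt_max -andbA; apply/and4P; split=> //.
  - by rewrite ltrBlDr (le_lt_trans tb)// ltrDl.
  - exact: le_lt_trans tle.
  - by rewrite ltrBlDr (lt_trans tle)// ltrDl.
have [N [mN N0 subN]] := f0.
have : (mu `]c, d[%classic <= mu N)%E.
  have mI : measurable (`]c, d[%classic : set (measurableTypeR R)).
    exact: measurable_itv.
  apply: (@le_measure _ _ _ mu _ _ (mem_set mI) (mem_set mN)).
  move=> s /=; rewrite in_itv/= gt_max lt_min => /andP[/andP[? ?] /andP[? ?]].
  apply: subN => /= h; apply: (fn0 s); last first.
  - by apply: h; rewrite in_itv/=; apply/andP; split; lra.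
  - by rewrite in_itv/=; apply/andP; split; lra.
  - by rewrite ltr_norml; apply/andP; split; lra.
rewrite N0 [X in (X <= _)%E](@lebesgue_measure_itv R `]c, d[)/=.
rewrite lte_fin cd leNgt => /negP; apply.
by rewrite -EFinB lte_fin subr_gt0.
Qed.

Lemma sderiv_lin k i c f g h : (i <= k)%N ->
  is_sobolev k f -> is_sobolev k g -> is_sobolev k h ->
  sob_eq k h (c \*: f \+ g) ->
  sob_eq (k - i) (sderiv k i h) (c \*: sderiv k i f \+ sderiv k i g).
Proof.
case: i => [|i]; first by rewrite subn0.
case: k => // k ik fs gs hs e.
have iterE j : (j <= k)%N ->
    {in `[a, b], iter j D h =1 c \*: iter j D f \+ iter j D g}.
  elim: j => // j ih jk t tab.
  have fd := (proj1 (let: And3 x _ _ := fs in x)) j t jk tab.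
  have gd := (proj1 (let: And3 x _ _ := gs in x)) j t jk tab.
  have h1 := @is_deriv_lin _ _ _ c _ _ _ _ _ (deriv_funP ab tab fd) (deriv_funP ab tab gd).
  rewrite -[RHS](deriv_funE ab tab h1) /=.
  by apply: eq_deriv_fun => //; apply: ih; exact: ltnW.
move: ik; rewrite leq_eqVlt => /predU1P[ik|ik].
  case: ik => ik; subst k; rewrite subnn /sob_eq.
  have [_ f1] := sderivP fs; have [_ g1] := sderivP gs; have [_ h1] := sderivP hs.
  have := ae_deriv_lin c f1 g1; apply: aeS2 h1 => t h1 l1 tab.
  apply: (is_deriv_unique ab tab (h1 tab)).
  apply: eq_is_deriv (l1 tab) => // s sab; rewrite iterE//.
rewrite /sderiv ik; have := iterE i.+1 ik.
by move: ik; rewrite -subn_gt0; case: (k.+1 - i.+1)%N.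
Qed.

Lemma sderiv0 k i h : (i <= k)%N -> is_sobolev k h -> sob_eq k h (cst 0) ->
  sob_eq (k - i) (sderiv k i h) (cst 0).
Proof.
move=> ik hs h0.
have h1 : sob_eq k h (-1 \*: h \+ h).
  have -> : -1 \*: h \+ h = cst 0 :> (R -> R[i]).
    by apply/funext => t /=; rewrite scaleN1r addNr.
  exact: h0.
have := sderiv_lin ik hs hs hs h1.
have -> // : -1 \*: sderiv k i h \+ sderiv k i h = cst 0 :> (R -> R[i]).
by apply/funext => t /=; rewrite scaleN1r addNr.
Qed.

Lemma sobolev_sum k (I : Type) (s : seq I) (f : I -> R -> R[i]) :
  (forall i, is_sobolev k (f i)) -> is_sobolev k (fun t => \sum_(i <- s) f i t).
Proof.
move=> fs; elim: s => [|i s ih].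
  by under eq_fun do rewrite big_nil; exact: sobolev0.
under eq_fun do rewrite big_cons.
have := sobolev_lin 1 (fs i) ih; congr (is_sobolev k _).
by apply/funext => t /=; rewrite scale1r.
Qed.

End sobolev_fun.

(* The quotient module V / S. *)
Section quotmod.
Local Open Scope quotient_scope.
Variables (K : nzRingType) (V : lmodType K).
Variables (S : {pred V}) (HS : submod_closed S).

Definition submod_zmodClosed : zmodClosed V :=
  HB.pack_for (zmodClosed V) S
    (GRing.isZmodClosed.Build V S (GRing.submod_closedB HS)).

Definition quotmod : Type := Quotient.quot submod_zmodClosed.

HB.instance Definition _ := EqQuotient.copy quotmod (Quotient.quot submod_zmodClosed).
HB.instance Definition _ := GRing.Zmodule.copy quotmod (Quotient.quot submod_zmodClosed).

Definition to_quotmod (x : V) : quotmod := \pi_(Quotient.quot submod_zmodClosed) x.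

Lemma to_quotmod_eq (x y : V) : to_quotmod x = to_quotmod y <-> x - y \in S.
Proof.
rewrite -[S]/(submod_zmodClosed : {pred V}) Quotient.idealrBE.
by split=> [/eqP|/eqP].
Qed.

Lemma to_quotmodD (x y : V) : to_quotmod (x + y) = to_quotmod x + to_quotmod y.
Proof. exact: (raddfD (\pi_(Quotient.quot submod_zmodClosed))). Qed.

Lemma reprqK (x : quotmod) : to_quotmod (repr x) = x.
Proof. exact: reprK. Qed.

Definition scaleq (c : K) (x : quotmod) : quotmod := to_quotmod (c *: repr x).

Lemma to_quotmodZ (c : K) (x : V) : to_quotmod (c *: x) = scaleq c (to_quotmod x).
Proof.
apply/to_quotmod_eq; rewrite -scalerBr -[_ *: _]addr0.
apply: HS.2; last exact: HS.1.
by apply/to_quotmod_eq; rewrite reprqK.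
Qed.

Lemma scaleqA c d x : scaleq c (scaleq d x) = scaleq (c * d) x.
Proof. by rewrite -[x]reprqK -!to_quotmodZ scalerA. Qed.

Lemma scale1q : left_id 1 scaleq.
Proof. by move=> x; rewrite -[x]reprqK -!to_quotmodZ scale1r. Qed.

Lemma scaleqDr : right_distributive scaleq +%R.
Proof.
move=> c x y; rewrite -[x]reprqK -[y]reprqK -to_quotmodD -!to_quotmodZ.
by rewrite scalerDr to_quotmodD.
Qed.

Lemma scaleqDl x : {morph scaleq^~ x : c d / c + d}.
Proof.
by move=> c d; rewrite -[x]reprqK -!to_quotmodZ scalerDl to_quotmodD.
Qed.

HB.instance Definition _ := GRing.Zmodule_isLmodule.Build K quotmod
  scaleqA scale1q scaleqDr scaleqDl.

Lemma to_quotmod_linear : linear to_quotmod.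
Proof. by move=> c x y; rewrite to_quotmodD to_quotmodZ. Qed.

HB.instance Definition _ := GRing.isLinear.Build K V quotmod *:%R to_quotmod
  to_quotmod_linear.

End quotmod.

Section fredholm.
Variables (K : numFieldType).

Definition has_lin_dim (V : lmodType K) (U : set V) (d : nat) : Prop :=
  exists e : 'I_d -> V, (forall i, U (e i)) /\
    forall v, U v -> exists! c : {ffun 'I_d -> K}, v = \sum_i c i *: e i.

Definition findim (V : lmodType K) (U : set V) : Prop := exists d, has_lin_dim U d.

(* 0 by convention when U is not finite-dimensional. *)
Definition lin_dim (V : lmodType K) (U : set V) : nat := xget 0%N [set d | has_lin_dim U d].

Section range.
Variables (V W : lmodType K) (T : {linear V -> W}).

Definition range_pred : {pred W} := fun w => `[< range T w >].

Lemma range_submod_closed : submod_closed range_pred.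
Proof.
split; first by apply/asboolP; exists 0 => //; rewrite linear0.
move=> c _ _ /asboolP[x _ <-] /asboolP[y _ <-]; apply/asboolP.
by exists (c *: x + y) => //; rewrite linearP.
Qed.

(* W / T(V) *)
Definition lin_coker : lmodType K := quotmod range_submod_closed.

Definition lin_ker : set V := [set x | T x = 0].

End range.

Variables (V W : normedModType K) (T : {linear V -> W}).

(* Completeness of V and W plays no role in the definition and is not required. *)
Definition is_fredholm : Prop :=
  [/\ exists M : K, forall x, `|T x| <= M * `|x|,
      findim (lin_ker T) & findim [set: lin_coker T]].

Definition fredholm_index : int := (lin_dim (lin_ker T))%:Z - (lin_dim [set: lin_coker T])%:Z.

End fredholm.

Section pair_map.
Variables (K : numFieldType) (V W1 W2 : normedModType K).
Variables (L : {linear V -> W1}) (B : {linear V -> W2}).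

Definition pair_map (y : V) : (W1 * W2)%type := (L y, B y).

Lemma pair_map_linear : linear pair_map.
Proof. by move=> c x y; rewrite /pair_map !linearP. Qed.

HB.instance Definition _ := GRing.isLinear.Build K V (W1 * W2)%type *:%R
  pair_map pair_map_linear.

End pair_map.

Section colsp.
Variables (K : numFieldType) (V : normedModType K) (m : nat).

(* Columns of m elements of V, normed by the sum of the norms of the entries. *)
Definition colsp : Type := {ffun 'I_m -> V}.
HB.instance Definition _ := GRing.Lmodule.copy colsp {ffun 'I_m -> V}.

Definition norm_colsp (y : colsp) : K := \sum_(i < m) `|(y : {ffun 'I_m -> V}) i|.

Lemma norm_colspD x y : norm_colsp (x + y) <= norm_colsp x + norm_colsp y.
Proof.
by rewrite -big_split/=; apply: ler_sum => i _; rewrite ffunE ler_normD.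
Qed.

Lemma norm_colspZ c x : norm_colsp (c *: x) = `|c| * norm_colsp x.
Proof.
by rewrite mulr_sumr; apply: eq_bigr => i _; rewrite ffunE normrZ.
Qed.

Lemma norm_colsp0 x : norm_colsp x = 0 -> x = 0.
Proof.
move=> /eqP; rewrite psumr_eq0// => /allP h; apply/ffunP => i; rewrite ffunE.
by have := h i (mem_index_enum _) => /= /eqP /normr0_eq0.
Qed.

HB.instance Definition _ := Lmodule_isNormed.Build K colsp
  norm_colspD norm_colspZ norm_colsp0.

Definition colsp_ffun (y : colsp) : {ffun 'I_m -> V} := y.
Coercion colsp_ffun : colsp >-> finfun_of.

End colsp.

Section sobolev_space.
Context {R : realType} (a b : R) (ab : a < b) (p : \bar R) (p1 : (1 <= p)%E).
Notation mu := (@lebesgue_measure R).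

(* The hypotheses on a, b, p only serve to infer the module structure. *)
Definition sobolev_pred of a < b & (1 <= p)%E := fun k : nat =>
  (fun f => `[< is_sobolev a b p k f >]) : {pred R -> R[i]}.

Variable k : nat.

Lemma sobolev_predP f : is_sobolev a b p k f -> f \in sobolev_pred ab p1 k.
Proof. by move=> fs; exact/asboolP. Qed.

Lemma sobolev_submod_closed : submod_closed (sobolev_pred ab p1 k).
Proof.
split; first by apply/asboolP; exact: sobolev0.
move=> c f g /asboolP fs /asboolP gs; apply/asboolP.
exact: (sobolev_lin ab p1 c fs gs).
Qed.

HB.instance Definition _ := GRing.isSubmodClosed.Build R[i] (R -> R[i])
  (sobolev_pred ab p1 k) sobolev_submod_closed.

Record sobfun := SobFun {
  sobfun_val :> R -> R[i];
  sobfunP : sobfun_val \in sobolev_pred ab p1 k }.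

HB.instance Definition _ := [isSub for sobfun_val].
HB.instance Definition _ := [Choice of sobfun by <:].
HB.instance Definition _ := [SubChoice_isSubLmodule of sobfun by <:].

Definition null_pred : {pred sobfun} := fun f => `[< sob_eq a b k f (cst 0) >].

Lemma is_sobolev_sobfun (f : sobfun) : is_sobolev a b p k f.
Proof. exact/asboolP/sobfunP. Qed.

Lemma null_submod_closed : submod_closed null_pred.
Proof.
split.
  by apply/asboolP; rewrite /sob_eq; case: k => [|k']; [exact: aeW|].
move=> c f g /asboolP + /asboolP +; rewrite /null_pred.
move=> f0 g0; apply/asboolP.
have := sob_eq_op (fun x y => c *: x + y) f0 g0.
by congr (sob_eq a b k _ _); apply/funext => t; rewrite /= scaler0 addr0.
Qed.

(* W_p^k([a, b]; C) *)
Definition sobolev := quotmod null_submod_closed.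

HB.instance Definition _ := GRing.Lmodule.on sobolev.

Definition sobolev_norm (y : sobolev) : R :=
  \sum_(i < k.+1) fine (Lp_norm a b p (sderiv a b p k i (repr y))).


Lemma sobolev_eqP (f g : sobfun) : to_quotmod null_submod_closed f =
  to_quotmod null_submod_closed g <-> sob_eq a b k f g.
Proof. rewrite to_quotmod_eq -sob_eqB0; split=> [/asboolP//|h].
exact/asboolP. Qed.

Lemma repr_linE c (x y : sobolev) :
  sob_eq a b k (repr (c *: x + y)) (c \*: (repr x : R -> R[i]) \+ repr y).
Proof.
have /sobolev_eqP : to_quotmod null_submod_closed (repr (c *: x + y)) =
    to_quotmod null_submod_closed (c *: repr x + repr y).
  rewrite reprqK to_quotmodD to_quotmodZ !reprqK.
  reflexivity.
by [].
Qed.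

Lemma repr0E : sob_eq a b k (repr (0 : sobolev)) (cst 0).
Proof.
have /sobolev_eqP : to_quotmod null_submod_closed (repr (0 : sobolev)) =
    to_quotmod null_submod_closed 0.
  by rewrite linear0 reprqK.
by [].
Qed.

Let Lpn i (y : sobolev) := Lp_norm a b p (sderiv a b p k i (repr y)).

Lemma sderiv_repr_Lp i (y : sobolev) : (i <= k)%N ->
  in_Lp a b p (sderiv a b p k i (repr y)).
Proof. by move=> ik; apply: (sderiv_Lp ab p1 ik); exact: is_sobolev_sobfun. Qed.

Lemma Lpn_fin i y : (i <= k)%N -> Lpn i y \is a fin_num.
Proof.
move=> ik; have [_ _ h] := sderiv_repr_Lp y ik.
by rewrite ge0_fin_numE// Lnorm_ge0.
Qed.

Lemma in_Lp_cmeas f : in_Lp a b p f -> cmeas a b f.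
Proof. by case. Qed.

Lemma LpnE i c (x y : sobolev) : (i <= k)%N -> Lpn i (c *: x + y) =
  Lp_norm a b p (c \*: sderiv a b p k i (repr x) \+ sderiv a b p k i (repr y)).
Proof.
move=> ik; apply: (sob_eq_Lp_norm (k := (k - i)%N) p1).
- exact/in_Lp_cmeas/sderiv_repr_Lp.
- apply: in_Lp_cmeas; apply: (in_LpD p1); last exact: sderiv_repr_Lp.
  by apply: (in_LpZ p1); exact: sderiv_repr_Lp.
- apply: (sderiv_lin ab ik); try exact: is_sobolev_sobfun.
  exact: repr_linE.
Qed.

Lemma sobolev_normD x y : sobolev_norm (x + y) <= sobolev_norm x + sobolev_norm y.
Proof.
rewrite -big_split/=; apply: ler_sum => i _; have ik : (i <= k)%N by rewrite -ltnS.
rewrite -(fineD (Lpn_fin x ik) (Lpn_fin y ik)); apply: fine_le.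
- exact: (Lpn_fin _ ik).
- by rewrite fin_numD (Lpn_fin x ik) (Lpn_fin y ik).
rewrite -[x]scale1r [leLHS](LpnE 1 _ _ ik) scale1r.
have -> : 1 \*: sderiv a b p k i (repr x) = sderiv a b p k i (repr x).
  by apply/funext => t /=; rewrite scale1r.
by apply: Lp_normD => //; apply: in_Lp_cmeas; exact: sderiv_repr_Lp.
Qed.

Lemma sobolev_normZ c x : sobolev_norm (c *: x) = normc c * sobolev_norm x.
Proof.
rewrite mulr_sumr; apply: eq_bigr => i _; have ik : (i <= k)%N by rewrite -ltnS.
rewrite -(fineM (erefl : (normc c)%:E \is a fin_num) (Lpn_fin x ik)).
congr fine; rewrite -(Lp_normZ p1 c (sderiv_repr_Lp x ik)).
rewrite -[c *: x]addr0 [LHS](LpnE c x 0 ik).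
apply: (sob_eq_Lp_norm (k := (k - i)%N) p1).
- apply: in_Lp_cmeas; apply: (in_LpD p1); last exact: sderiv_repr_Lp.
  by apply: (in_LpZ p1); exact: sderiv_repr_Lp.
- by apply: in_Lp_cmeas; apply: (in_LpZ p1); exact: sderiv_repr_Lp.
have := sderiv0 ab ik (is_sobolev_sobfun _) repr0E.
move=> /(sob_eq_op (fun x y => x + y)
  (sob_eq_refl a b (k - i) (c \*: sderiv a b p k i (repr x)))).
by congr (sob_eq _ _ _ _ _); apply/funext => t; rewrite /= addr0.
Qed.

Lemma sobolev_norm_eq0 x : sobolev_norm x = 0 -> x = 0.
Proof.
move=> /eqP; rewrite psumr_eq0; last by move=> i _; rewrite fine_ge0// Lnorm_ge0.
move=> /allP /(_ ord0 (mem_index_enum _)) /eqP h.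
have : Lpn 0 x = 0%E by rewrite -[LHS]fineK ?Lpn_fin// -[RHS]/(0%:E); congr EFin.
move=> /(Lp_norm_eq0 p1 (in_Lp_cmeas (sderiv_repr_Lp x (leq0n k)))) /= x0.
rewrite -[x]reprqK -(linear0 (to_quotmod null_submod_closed)).
apply/sobolev_eqP; move: (is_sobolev_sobfun (repr x)) x0.
case: k (repr x) => [|k'] f fs x0; first exact: x0.
by apply: (cont_ae0 ab) => //; exact: sobolevS_cont fs.
Qed.

Let norm_C (y : sobolev) : R[i] := (sobolev_norm y)%:C.

Let norm_C_D x y : norm_C (x + y) <= norm_C x + norm_C y.
Proof. by rewrite -rmorphD lecR sobolev_normD. Qed.

Let norm_C_Z c x : norm_C (c *: x) = `|c| * norm_C x.
Proof. by rewrite normc_def -normc_sqrtE -rmorphM /norm_C sobolev_normZ. Qed.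

Let norm_C_eq0 x : norm_C x = 0 -> x = 0.
Proof. by move=> /complexI /sobolev_norm_eq0. Qed.

HB.instance Definition _ := Lmodule_isNormed.Build R[i] sobolev
  norm_C_D norm_C_Z norm_C_eq0.

End sobolev_space.

Section diffop.
Context {R : realType} (a b : R) (ab : a < b) (p : \bar R) (p1 : (1 <= p)%E).
Variables (n m r : nat).
Notation W := (sobolev ab p1).
Variable A : 'I_r -> 'M[W n]_m.
Implicit Types y : colsp (W (n + r)) m.

(* (L y)_i, where A j is the coefficient of y^(j). *)
Definition diffop_fun y (i : 'I_m) : R -> R[i] := fun t =>
  sderiv a b p (n + r) r (repr (y i)) t +
  \sum_(j < r) \sum_(q < m)
    repr (A j i q) t * sderiv a b p (n + r) j (repr (y q)) t.

Lemma diffop_sobolev y i : is_sobolev a b p n (diffop_fun y i).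
Proof.
have ys q := is_sobolev_sobfun (repr (y q)).
have -> : diffop_fun y i = 1 \*: sderiv a b p (n + r) r (repr (y i)) \+
  (fun t => \sum_(j < r) \sum_(q < m)
    repr (A j i q) t * sderiv a b p (n + r) j (repr (y q)) t).
  by apply/funext => t; rewrite /= scale1r.
apply: (sobolev_lin ab p1); first exact: sobolev_sderiv.
apply: (sobolev_sum ab p1) => j; apply: (sobolev_sum ab p1) => q.
apply: (sobolevM ab p1); first exact: is_sobolev_sobfun.
have jnr : (j <= n + r)%N by rewrite (leq_trans (ltnW (ltn_ord j)))// leq_addl.
apply: (@sobolev_leq _ _ _ _ ab p1 _ (n + r - j)).
  by rewrite -addn1 -addnBA ?leq_add2l ?subn_gt0// ltnW.
have := @sobolev_sderiv _ _ _ p ab (n + r - j) j (repr (y q)).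
by rewrite (subnK jnr); apply; exact: ys.
Qed.

Definition diffop y : colsp (W n) m := [ffun i =>
  to_quotmod (null_submod_closed ab p1 n)
    (SobFun (sobolev_predP ab p1 (diffop_sobolev y i)))].

Lemma diffop_linear : linear diffop.
Proof.
move=> c x y; apply/ffunP => i; rewrite !ffunE.
rewrite -linearP; apply/sobolev_eqP => /=.
pose S j q (z : colsp (W (n + r)) m) := sderiv a b p (n + r) j (repr (z q)).
have S_lin j q : (j <= n + r)%N -> sob_eq a b (n + r - j) (S j q (c *: x + y))
    (c \*: S j q x \+ S j q y).
  move=> jnr; apply: (sderiv_lin ab jnr); try exact: is_sobolev_sobfun.
  by rewrite !ffunE; exact: repr_linE.
have top : sob_eq a b n (S r i (c *: x + y)) (c \*: S r i x \+ S r i y).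
  by have := S_lin r i (leq_addl n r); rewrite addnK.
have low j q : (j < r)%N -> sob_eq a b n (S j q (c *: x + y))
    (c \*: S j q x \+ S j q y).
  move=> jr; have := S_lin j q (leq_trans (ltnW jr) (leq_addl n r)).
  rewrite -addnBA ?(ltnW jr)//; move: jr; rewrite -subn_gt0.
  by case: (r - j)%N => // d _; rewrite addnS; exact: sob_eqS.
have := sob_eq_op +%R top (sob_eq_sum (index_enum 'I_r) (fun j : 'I_r =>
  sob_eq_sum (index_enum 'I_m) (fun q => sob_eq_op *%R
    (sob_eq_refl a b n (repr (A j i q))) (low j q (ltn_ord j))))).
congr (sob_eq a b n _ _); apply/funext => t; rewrite /= /diffop_fun.
change (c * S r i x t + S r i y t + \sum_(j < r) \sum_(q < m)
  repr (A j i q) t * (c * S j q x t + S j q y t) =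
  c * (S r i x t + \sum_(j < r) \sum_(q < m) repr (A j i q) t * S j q x t) +
  (S r i y t + \sum_(j < r) \sum_(q < m) repr (A j i q) t * S j q y t)).
rewrite mulrDr addrACA; congr (_ + _).
rewrite mulr_sumr -big_split/=; apply: eq_bigr => j _.
rewrite mulr_sumr -big_split/=; apply: eq_bigr => q _.
by rewrite mulrDr mulrCA.
Qed.

HB.instance Definition _ := GRing.isLinear.Build R[i] (colsp (W (n + r)) m)
  (colsp (W n) m) *:%R diffop diffop_linear.

End diffop.

(* Main.v *)
Require Import Defs.
From HB Require Import structures.
From mathcomp Require Import all_boot all_order all_algebra complex.
From mathcomp Require Import all_classical all_reals all_analysis.
From mathcomp Require Import ring lra.
From mathcomp Require Import measurable_realfun ess_sup_inf.
Set Implicit Arguments. Unset Strict Implicit. Unset Printing Implicit Defensive.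
Import Order.TTheory GRing.Theory Num.Theory Normc.
Import numFieldNormedType.Exports.
Local Open Scope classical_set_scope.
Local Open Scope complex_scope.
Local Open Scope ring_scope.

(* Let [ev y] be the vector of the initial values [y_i^(j) (a)], [j < r].  The
   Cauchy problem [L y = f], [ev y = c] has exactly one solution in
   [(W_p^(n+r))^m]: it is equivalent to a linear Volterra system with [L_1]
   coefficients for [(y, y', ..., y^(r-1))], solved by a Picard series whose
   terms are at most [C phi^k / k!], [phi] being the primitive of the size of
   the coefficients; the regularity of [y] then follows from the equation, one
   derivative at a time.  Hence [(L, ev)] is bijective onto
   [(W_p^n)^m * C^(rm)], and replacing [ev] by [B] gives an operator of index
   [rm - l], by linear algebra in finite dimension: its kernel and cokernel are
   those of [B] restricted to the [rm]-dimensional space [ker L]. *)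

(** * Linear algebra *)

(** When [n = 0] the coefficients are only in [L_p], so the equation holds almost everywhere and its
    solutions are merely absolutely continuous together with their derivatives of order below [r].
    Passing to the integral form and back rests on two facts: a primitive of an [L_1] function has
    that function as derivative almost everywhere, and an absolutely continuous function whose
    derivative vanishes almost everywhere is constant. The Volterra part uses integrability alone,
    so the inclusion of [L_p] in [L_1] treats all exponents at once. The same lack of regularity
    shapes the boundedness of [L]: for finite [p], [W_p^0] is not closed under products. In
    [A_j y^(j)] with [j < r], however, the second factor has at least one order more than the first,
    and the product of [W_p^n] and [W_p^(n+1)] is continuous into [W_p^n] because the norm of
    [W_p^1] controls the supremum. The rank of [B] on [ker L] is unknown, but it lowers the
    dimensions of kernel and cokernel by the same amount and disappears from the index. *)

Section lin_dim.
Variables (K : numFieldType) (V : lmodType K).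
Implicit Types (U : set V) (d : nat).

(** If [d < d'], the coordinates of the [e' j] with respect to [e] form a matrix with more rows than
    columns, and a nonzero vector of its left kernel gives [0] a second family of coordinates.
    Independence is expressed only by uniqueness of coordinates, hence the use of [U 0]. *)
Lemma has_lin_dim_le U d d' : U 0 -> has_lin_dim U d -> has_lin_dim U d' ->
  (d' <= d)%N.
Proof.
move=> U0 [e [_ eP]] [e' [e'U e'P]]; rewrite leqNgt; apply/negP => dd'.
have /choice[P PP] j : exists c : {ffun 'I_d -> K}, e' j = \sum_i c i *: e i.
  by have [c [cE _]] := eP _ (e'U j); exists c.
pose M : 'M[K]_(d', d) := \matrix_(j, i) P j i.
have : kermx M != 0.
  rewrite -mxrank_eq0 mxrank_ker subn_eq0 -ltnNge.
  by rewrite (leq_ltn_trans _ dd')// rank_leq_col.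
move=> /rowV0Pn[c /sub_kermxP cM c0].
have [c1 [_ c1U]] := e'P _ U0.
have c1E : c1 = 0 by apply: c1U; rewrite big1// => i _; rewrite ffunE scale0r.
have : c1 = [ffun j => c ord0 j].
  apply: c1U; under eq_bigr do rewrite ffunE PP scaler_sumr.
  rewrite exchange_big/= big1// => i _.
  under eq_bigr do rewrite scalerA.
  rewrite -scaler_suml [X in X *: _](_ : _ = (c *m M) ord0 i).
    by rewrite cM mxE scale0r.
  by rewrite mxE; apply: eq_bigr => j _; rewrite mxE.
rewrite c1E => c0E; move/eqP: c0; apply; apply/rowP => j.
by have /ffunP/(_ j) := c0E; rewrite !ffunE mxE.
Qed.

Lemma lin_dimE U d : U 0 -> has_lin_dim U d -> lin_dim U = d.
Proof.
move=> U0 Ud; rewrite /lin_dim; case: xgetP => [d' _ Ud'|/(_ d)//].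
by apply/eqP; rewrite eqn_leq !(@has_lin_dim_le U).
Qed.

End lin_dim.

(** * Changing the finite-dimensional side conditions of a bijective problem *)

Section finite_rank_extension.
Variables (K : numFieldType) (V W : normedModType K) (d l : nat).
Variables (L : {linear V -> W}) (B : {linear V -> 'cV[K]_l}).
Variable ev : {linear V -> 'rV[K]_d}.
Hypothesis LevP : forall f c, exists! x, L x = f /\ ev x = c.

Let sol f c := sval (cid (LevP f c)).

Let solP f c : L (sol f c) = f /\ ev (sol f c) = c.
Proof. by rewrite /sol; case: cid => x []. Qed.

Let solU f c x : L x = f -> ev x = c -> sol f c = x.
Proof. by move=> Lx ex; rewrite /sol; case: cid => y /= [_]; exact. Qed.

(** The matrix of [B] on [ker L], in the basis that [ev] carries to the canonical one; it acts on
    rows of coordinates from the right. *)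
Let Q : 'M[K]_(d, l) := \matrix_i (B (sol 0 (delta_mx 0 i)))^T.

Let sol0_sum n (c : 'I_n -> K) (N : 'I_n -> 'rV[K]_d) :
  sol 0 (\sum_i c i *: N i) = \sum_i c i *: sol 0 (N i).
Proof.
apply: solU; rewrite linear_sum/=.
  by rewrite big1// => i _; rewrite linearZ/= (solP _ _).1 scaler0.
by apply: eq_bigr => i _; rewrite linearZ/= (solP _ _).2.
Qed.

Let B_sol0 c : B (sol 0 c) = (c *m Q)^T.
Proof.
rewrite {1}[c]row_sum_delta sol0_sum linear_sum/=.
apply/colP => i; rewrite summxE !mxE; apply: eq_bigr => j _.
by rewrite linearZ/= !mxE.
Qed.

(** [sol 0] identifies the row vectors with [ker L], and [B_sol0] turns the kernel of [B] there into
    the left kernel of [Q]. *)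
Lemma ker_pair_map_dim : has_lin_dim (lin_ker (pair_map L B)) (d - \rank Q).
Proof.
rewrite -mxrank_ker; pose N := row_base (kermx Q).
have NQ i : row i N *m Q = 0.
  apply/sub_kermxP; apply: submx_trans (row_sub _ _) _.
  by rewrite eq_row_base.
exists (fun i => sol 0 (row i N)); split.
  move=> i; rewrite /lin_ker/= /pair_map (solP _ _).1 B_sol0 NQ.
  by rewrite trmx0.
move=> v; rewrite /lin_ker/= /pair_map => -[Lv Bv].
have vE : v = sol 0 (ev v) by rewrite (@solU _ _ v).
have evN : (ev v <= N)%MS.
  rewrite eq_row_base; apply/sub_kermxP; apply: trmx_inj.
  by rewrite -B_sol0 -vE Bv trmx0.
have [x xE] := submxP evN.
have sumE (c : {ffun 'I_(\rank (kermx Q)) -> K}) :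
    \sum_i c i *: sol 0 (row i N) = sol 0 ((\row_i c i) *m N).
  rewrite -sol0_sum mulmx_sum_row; congr (sol 0 _).
  by apply: eq_bigr => i _; rewrite mxE.
exists [ffun i => x ord0 i]; split.
  rewrite sumE vE; congr (sol 0 _); rewrite xE; congr (_ *m _).
  by apply/rowP => i; rewrite !mxE ffunE.
move=> c; rewrite sumE => vc; apply/ffunP => i; rewrite ffunE.
have : x = \row_i c i.
  apply: (row_free_inj (row_base_free (kermx Q))).
  by rewrite -[RHS](solP 0 _).2 -/N -vc -xE.
by move=> ->; rewrite mxE.
Qed.

(** Modulo the range, [(f, v)] equals [(0, v - B (sol f 0))], and [(0, u)] lies in the range exactly
    when [u^T] is in the row space of [Q]. A complement of that row space therefore represents the
    cokernel. *)
Lemma coker_pair_map_dim :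
  has_lin_dim [set: lin_coker (pair_map L B)] (l - \rank Q).
Proof.
rewrite -mxrank_compl; pose P := row_base (Q^C)%MS.
pose RT := range_submod_closed (pair_map L B).
have inR x y : to_quotmod RT x = to_quotmod RT y <->
    exists v, pair_map L B v = x - y.
  rewrite to_quotmod_eq; split; first by move=> /asboolP[v _ vE]; exists v.
  by move=> [v vE]; apply/asboolP; exists v.
pose e i : (W * 'cV[K]_l)%type := (0, (row i P)^T).
have sumE (c : {ffun 'I_(\rank (Q^C)%MS) -> K}) :
    \sum_i c i *: to_quotmod RT (e i) =
    to_quotmod RT (0, ((\row_i c i) *m P)^T).
  under eq_bigr do rewrite -linearZ.
  rewrite -linear_sum; congr (to_quotmod RT _).
  rewrite [LHS]surjective_pairing (raddf_sum fst) (raddf_sum snd).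
  rewrite big1; last by move=> i _; rewrite /= scaler0.
  congr pair; rewrite mulmx_sum_row raddf_sum; apply: eq_bigr => i _.
  by rewrite /= linearZ/= !mxE.
exists (fun i => to_quotmod RT (e i)); split => // w _.
case wE : (repr w) => [f v].
pose u := (v - B (sol f 0))^T.
have : (u <= Q + Q^C)%MS by apply: submx_full; exact: addsmx_compl_full.
move=> /sub_addsmxP[[c x]] /= uE.
have /submxP[y yE] : (x *m (Q^C)%MS <= P)%MS by rewrite eq_row_base submxMl.
exists [ffun i => y ord0 i]; split.
  rewrite sumE -[w]reprqK wE; apply/inR.
  exists (sol f 0 + sol 0 c); rewrite /pair_map !linearD/= B_sol0.
  rewrite (solP _ _).1 (solP _ _).1 addr0.
  congr pair; rewrite /=; first by rewrite subr0.
  rewrite (_ : \row_i _ = y); last by apply/rowP => i; rewrite mxE ffunE.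
  rewrite -yE.
  have -> : c *m Q = u - x *m (Q^C)%MS by rewrite uE addrK.
  by rewrite linearB/= trmxK addrA [B _ + _]addrC subrK.
move=> c'; rewrite sumE -[w]reprqK wE => /inR[v' []].
rewrite subr0 => Lv' Bv'; apply/ffunP => i; rewrite ffunE.
set z := \row_i c' i in Bv'.
(* [x0] lies in [ker L], so [B x0] contributes only a vector of the row space of [Q]; two families
   of coordinates then differ by an element of [Q :&: Q^C], which is zero. *)
pose x0 := v' - sol f 0.
have x0E : x0 = sol 0 (ev x0) by rewrite (@solU _ _ x0)// linearB/= Lv' (solP _ _).1 subrr.
have Bx0 : (ev x0 *m Q)^T = v - (z *m P)^T - B (sol f 0).
  by rewrite -B_sol0 -x0E linearB Bv'.
have {}Bx0 : ev x0 *m Q = u - z *m P.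
  by apply: trmx_inj; rewrite Bx0 linearB/= trmxK addrAC.
have zP : (y - z) *m P = (ev x0 - c) *m Q.
  rewrite !mulmxBl Bx0 -yE (_ : x *m (Q^C)%MS = u - c *m Q); first exact: addrAC.
  by rewrite uE addrC addKr.
have : ((y - z) *m P <= Q :&: Q^C)%MS.
  rewrite sub_capmx {1}zP submxMl/=.
  by apply: submx_trans (submxMl _ _) _; rewrite eq_row_base.
rewrite capmx_compl submx0 mulmx_free_eq0 ?row_base_free//.
by rewrite subr_eq0 => /eqP ->; rewrite mxE.
Qed.

Lemma pair_map_fredholm :
  (exists M : K, forall x, `|pair_map L B x| <= M * `|x|) ->
  is_fredholm (pair_map L B) /\ fredholm_index (pair_map L B) = d%:Z - l%:Z.
Proof.
move=> bT; split.
  by split=> //; [exists (d - \rank Q)%N; exact: ker_pair_map_dim|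
    exists (l - \rank Q)%N; exact: coker_pair_map_dim].
rewrite /fredholm_index (lin_dimE _ ker_pair_map_dim); last first.
  by rewrite /lin_ker/= linear0.
rewrite (lin_dimE _ coker_pair_map_dim)//.
rewrite -!subzn ?rank_leq_row ?rank_leq_col//.
by rewrite opprB addrA subrK.
Qed.

End finite_rank_extension.

(** * Primitives of complex functions *)

Section complex_reals.
Context {R : realType}.
Implicit Types (z w : R[i]).

Lemma normc_RIle z (e : R) :
  `|complex.Re z| <= e -> `|complex.Im z| <= e -> normc z <= 2 * e.
Proof. by move=> h1 h2; rewrite (le_trans (normc_le z))//; lra. Qed.

Lemma normcR (x : R) : normc x%:C = `|x|.
Proof. by rewrite normc_sqrtE/= expr0n addr0 sqrtr_sqr. Qed.

Lemma ReD z w : complex.Re (z + w) = complex.Re z + complex.Re w.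
Proof. by case: z w => ? ? [? ?]. Qed.

Lemma ImD z w : complex.Im (z + w) = complex.Im z + complex.Im w.
Proof. by case: z w => ? ? [? ?]. Qed.

Lemma complex_ext z w :
  complex.Re z = complex.Re w -> complex.Im z = complex.Im w -> z = w.
Proof. by case: z w => ? ? [? ?] /= -> ->. Qed.

Lemma normc_distC z w : normc (z - w) = normc (w - z).
Proof. by rewrite -normcN opprB. Qed.

End complex_reals.

(** * Absolute continuity of the integral *)

Section small.
Context {R : realType}.
Notation mu := (@lebesgue_measure R).

Lemma integrable_itvS (a b u v : R) (f : R -> R) :
  a <= u -> v <= b -> mu.-integrable `[a, b] (EFin \o f) ->
  mu.-integrable `[u, v] (EFin \o f).
Proof.
move=> au vb; apply: integrableS => //.
by apply: subset_itv; rewrite bnd_simp.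
Qed.

Lemma integrable_sub (D E : set (measurableTypeR R)) (f : R -> R) :
  measurable E -> measurable D -> D `<=` E ->
  mu.-integrable E (EFin \o f) -> mu.-integrable D (EFin \o f).
Proof. exact: integrableS. Qed.

(** By truncation: [h] is within [e / 2] in the mean of the bounded function [hn N], whose integral
    over a set of small measure is small. *)
Lemma integral_small (D : set (measurableTypeR R)) (h : R -> R) (e : R) :
  measurable D -> mu.-integrable D (EFin \o h) ->
  (forall t, D t -> 0 <= h t) -> 0 < e ->
  exists2 d : R, 0 < d & forall A : set (measurableTypeR R), measurable A -> A `<=` D ->
    (mu A < d%:E)%E -> (\int[mu]_(x in A) (h x)%:E < e%:E)%E.
Proof.
move=> mD ih h0 e0.
pose hn (n : nat) x := Num.min (h x) n%:R.
have mh : measurable_fun D h by apply/measurable_EFinP; exact: measurable_int ih.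
have mhn n : measurable_fun D (hn n).
  by apply: measurable_minr => //; exact: measurable_cst.
have hn0 n x : D x -> 0 <= hn n x by move=> Dx; rewrite le_min h0 ?ler0n.
have hnh n x : hn n x <= h x by rewrite ge_min lexx.
have e20 : 0 < e / 2 by rewrite divr_gt0.
have [] := @dominated_convergence _ _ R mu D mD (fun n => EFin \o hn n) (EFin \o h)
  (EFin \o h) _ _ _ ih.
- by move=> n; apply/measurable_EFinP; exact: mhn.
- by apply/measurable_EFinP; exact: mh.
- apply: nearW => x Dx; apply/cvg_EFin; first by apply: nearW.
  apply: cvg_near_cst; near=> n; rewrite /= /hn.
  by apply/min_idPl; near: n; exact: nbhs_infty_ger.
- apply: nearW => x n Dx; rewrite /= lee_fin ger0_norm ?hn0//.
move=> _ + _ => /fine_cvgP[_ /cvgrPdist_lt /(_ _ e20)][N _ /(_ N (leqnn N))] /=.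
rewrite sub0r normrN => hN.
(* On [A] the function is at most [|hn N - h| + N]; the [+ 1] covers [N = 0]. *)
exists (e / 2 / (N%:R + 1)); first by rewrite divr_gt0// ltr_wpDl.
move=> A mA AD muA.
have mNh : measurable_fun D (fun x => `|(hn N x)%:E - (h x)%:E|%E).
  apply: measurableT_comp => //; apply/measurable_EFinP.
  exact: measurable_funB.
have iNh : (\int[mu]_(x in D) `|(hn N x)%:E - (h x)%:E| < (e / 2)%:E)%E.
  rewrite -[ltLHS]fineK.
    by rewrite lte_fin (le_lt_trans _ hN)// ler_norm.
  rewrite ge0_fin_numE ?integral_ge0//.
  have /integrableP[_] := ih; apply: le_lt_trans.
  apply: ge0_le_integral => //.
    by apply: measurableT_comp => //; exact/measurable_EFinP.
  move=> x Dx; rewrite lee_fin ler0_norm ?subr_le0// opprB ger0_norm ?h0//.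
  by rewrite gerBl hn0.
apply: (@le_lt_trans _ _ (\int[mu]_(x in A) (`|(hn N x)%:E - (h x)%:E| + N%:R%:E))%E).
  apply: ge0_le_integral => //.
  - by move=> x /AD Dx; rewrite lee_fin h0.
  - by apply/measurable_EFinP; exact: measurable_funS mh.
  - by apply: emeasurable_funD => //; exact: measurable_funS mNh.
  move=> x Ax; rewrite lee_fin ler0_norm ?subr_le0// opprB /hn.
  by rewrite minEle; case: ifP => hx; lra.
rewrite ge0_integralD//; last exact: measurable_funS mNh.
rewrite integral_cst//= [e]splitr EFinD.
apply: lte_leD => //; first by rewrite fin_numM// ge0_fin_numE// (lt_trans muA)// ltry.
  apply: le_lt_trans iNh; exact: ge0_subset_integral.
apply: (@le_trans _ _ (N%:R%:E * (e / 2 / (N%:R + 1))%:E)%E).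
  by rewrite lee_wpmul2l ?lee_fin// ltW.
rewrite -EFinM lee_fin mulrCA ger_pMr// ler_pdivrMr ?mul1r ?lerDl// ltr_wpDl//.
Unshelve. all: by end_near. Qed.

End small.

(** * Epsilon-delta forms of derivatives and continuity *)

Section derivative_epsilon.
Context {R : realType} (a b : R).
Implicit Types (f g : R -> R[i]) (t s : R).

(** Without the quotient the point [s = t] is no exception, and such estimates can be added over
    adjacent intervals. *)
Lemma is_derivP f t l : is_deriv a b f t l <->
  forall e, 0 < e -> exists2 d, 0 < d & forall s, s \in `[a, b] ->
    `|s - t| < d -> normc (f s - f t - (s - t)%:C * l) <= e * `|s - t|.
Proof.
have FF : Filter (within `[a, b] (dnbhs t)) by exact: within_filter.
have quot s : s != t -> normc (f s - f t - (s - t)%:C * l) =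
    normc ((f s - f t) / (s - t)%:C - l) * `|s - t|.
  move=> st; rewrite -normcR -normcM mulrBl [l * _]mulrC divfK//.
  by rewrite (inj_eq (@complexI R) _ 0) subr_eq0.
split.
  move=> /(@cvgrPdist_lt R[i] R[i] R _ FF) h e e0.
  have [|d d0 hd] := h e%:C; first by rewrite ltcR.
  exists d => // s sab; have [->|st] := eqVneq s t.
    by rewrite !subrr mul0r subr0 normc0 normr0 mulr0.
  move=> std; rewrite quot// ler_wpM2r// ltW//.
  have := hd s; rewrite /= distrC => /(_ std st sab).
  by rewrite normc_def -normc_sqrtE ltcR normc_distC.
move=> h; apply/(@cvgrPdist_lt R[i] R[i] R _ FF) => e e0.
have eR : e = (complex.Re e)%:C by rewrite RRe_real// gtr0_real.
have e0' : 0 < complex.Re e by rewrite -(ltcR 0) -eR.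
have [|d d0 hd] := h (complex.Re e / 2); first by rewrite divr_gt0.
rewrite near_withinE; exists d => //= s std st sab.
rewrite normc_def eR ltcR -normc_sqrtE normc_distC.
have sd : `|s - t| < d by rewrite distrC.
have := hd s sab sd.
rewrite quot// ler_pM2r ?normr_gt0 ?subr_eq0// => /le_lt_trans; apply.
by rewrite ltr_pdivrMr// mulr_natr mulr2n ltrDl.
Qed.

Lemma within_contP f : {within `[a, b], continuous f} <->
  forall t, t \in `[a, b] -> forall e, 0 < e -> exists2 d, 0 < d &
    forall s, s \in `[a, b] -> `|s - t| < d -> normc (f s - f t) < e.
Proof.
split.
  move=> /subspace_continuousP fc t tab e e0.
  have FF : Filter (within `[a, b] (nbhs t)) by exact: within_filter.
  have /(@cvgrPdist_lt R[i] R[i] R _ FF) h := fc t tab.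
  have [|d d0 hd] := h e%:C; first by rewrite ltcR.
  exists d => // s sab; rewrite distrC => std.
  by have := hd s std sab; rewrite normc_def -normc_sqrtE ltcR normc_distC.
move=> h; apply/subspace_continuousP => t tab.
have FF : Filter (within `[a, b] (nbhs t)) by exact: within_filter.
apply/(@cvgrPdist_lt R[i] R[i] R _ FF) => e e0.
have eR : e = (complex.Re e)%:C by rewrite RRe_real// gtr0_real.
have e0' : 0 < complex.Re e by rewrite -(ltcR 0) -eR.
have [d d0 hd] := h t tab _ e0'.
rewrite near_withinE; exists d => //= s std sab.
by rewrite normc_def eR ltcR -normc_sqrtE normc_distC; apply: hd => //; rewrite distrC.
Qed.

Lemma derive_realP (G : R -> R) t l : derivable G t 1 -> derive1 G t = l ->
  forall e, 0 < e -> exists2 d, 0 < d & forall s,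
    `|s - t| < d -> `|G s - G t - (s - t) * l| <= e * `|s - t|.
Proof.
move=> dG Gl e e0.
have : h^-1 *: (G (h + t) - G t) @[h --> 0^'] --> l.
  move: dG; rewrite -Gl /derive1 /derivable.
  by under eq_fun do rewrite /GRing.scale/= mulr1.
move=> /cvgrPdist_lt /(_ _ e0)[d /= d0 hd]; exists d => // s std.
have [->|st] := eqVneq s t; first by rewrite !subrr mul0r subr0 normr0 mulr0.
have st0 : s - t != 0 by rewrite subr_eq0.
have := hd (s - t); rewrite /= sub0r normrN => /(_ std st0).
rewrite subrK => /ltW; rewrite -(ler_pM2r (_ : 0 < `|s - t|)) ?normr_gt0//.
rewrite -normrM mulrBl /GRing.scale/= mulrAC mulVf// mul1r => h.
by rewrite distrC mulrC in h; rewrite [_ * l]mulrC mulrC.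
Qed.

End derivative_epsilon.

Section primitive.
Context {R : realType} (a b : R).
Hypothesis ab : a < b.
Notation mu := (@lebesgue_measure R).
Implicit Types (f g : R -> R[i]) (t s : R).

Let mab : measurable (`[a, b]%classic : set (measurableTypeR R)).
Proof. exact: measurable_itv. Qed.

Lemma normc_integrable f : in_Lp a b 1 f ->
  mu.-integrable `[a, b] (EFin \o (fun t => normc (f t))).
Proof.
move=> [fr fi]; rewrite /Lp_norm Lnorm1 => fN.
apply/integrable_mkcond => //; apply/integrableP; split.
  rewrite restrict_EFin; apply/measurable_EFinP.
  by apply: measurable_normc; split.
by rewrite restrict_EFin.
Qed.

Lemma in_L1P f : in_Lp a b 1 f <-> cmeas a b f /\
  mu.-integrable `[a, b] (EFin \o (fun t => normc (f t))).
Proof.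
split=> [fL|[[fr fi] fN]].
  by split; [case: fL|exact: normc_integrable].
have /integrableP[_] := (integrable_mkcond _ mab).1 fN.
by rewrite restrict_EFin => fN'; split => //; rewrite /Lp_norm Lnorm1.
Qed.

Lemma Re_integrable f : in_Lp a b 1 f ->
  mu.-integrable `[a, b] (EFin \o (fun t => complex.Re (f t))).
Proof.
move=> fL; apply: le_integrable (normc_integrable fL) => //.
  by apply/measurable_EFinP; case: fL.
by move=> t _; rewrite /= lee_fin [leRHS]ger0_norm ?normc_ge0// abs_Re_le.
Qed.

Lemma Im_integrable f : in_Lp a b 1 f ->
  mu.-integrable `[a, b] (EFin \o (fun t => complex.Im (f t))).
Proof.
move=> fL; apply: le_integrable (normc_integrable fL) => //.
  by apply/measurable_EFinP; case: fL.
by move=> t _; rewrite /= lee_fin [leRHS]ger0_norm ?normc_ge0// abs_Im_le.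
Qed.

Definition cint (D : set (measurableTypeR R)) f : R[i] :=
  (\int[mu]_(x in D) complex.Re (f x)) +i* (\int[mu]_(x in D) complex.Im (f x)).

Definition prim f t := cint `[a, t] f.

(** The factor 2 comes from bounding the real and imaginary parts separately; it is carried through
    the estimates below. *)
Lemma normc_cint (D : set (measurableTypeR R)) f :
  measurable D -> D `<=` `[a, b] -> in_Lp a b 1 f ->
  normc (cint D f) <= 2 * \int[mu]_(x in D) normc (f x).
Proof.
move=> mD Dab fL.
have iN := integrable_sub mab mD Dab (normc_integrable fL).
have iR := integrable_sub mab mD Dab (Re_integrable fL).
have iI := integrable_sub mab mD Dab (Im_integrable fL).
apply: normc_RIle => /=; (apply: le_trans; [exact: le_normr_Rintegral|]).
  apply: le_Rintegral => //; first exact: integrable_norm iR.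
  by move=> x _; exact: abs_Re_le.
apply: le_Rintegral => //; first exact: integrable_norm iI.
by move=> x _; exact: abs_Im_le.
Qed.

Lemma cint_lin (D : set (measurableTypeR R)) c f g : measurable D -> D `<=` `[a, b] ->
  in_Lp a b 1 f -> in_Lp a b 1 g ->
  cint D (c \*: f \+ g) = c * cint D f + cint D g.
Proof.
move=> mD Dab fL gL.
have iR := integrable_sub mab mD Dab (Re_integrable fL).
have iI := integrable_sub mab mD Dab (Im_integrable fL).
have iRg := integrable_sub mab mD Dab (Re_integrable gL).
have iIg := integrable_sub mab mD Dab (Im_integrable gL).
have cL := in_LpZ (lexx 1%E) c fL.
have iRc := integrable_sub mab mD Dab (Re_integrable cL).
have iIc := integrable_sub mab mD Dab (Im_integrable cL).
have sc k (h : R -> R) : mu.-integrable D (EFin \o h) ->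
    mu.-integrable D (EFin \o (fun x => k * h x)).
  by move=> hi; exact: (integrableZl mD k hi).
rewrite /cint; apply: complex_ext.
  rewrite ReD /=; under eq_Rintegral do rewrite ReD.
  rewrite RintegralD//; congr (_ + _).
  rewrite [LHS](_ : _ = \int[mu]_(x in D) (complex.Re c * complex.Re (f x) -
      complex.Im c * complex.Im (f x))); last first.
    by apply: eq_Rintegral => x _ /=; case: (c) (f x) => ? ? [].
  rewrite RintegralB ?RintegralZl//; try exact: sc.
  by case: (c).
rewrite ImD /=; under eq_Rintegral do rewrite ImD.
rewrite RintegralD//; congr (_ + _).
rewrite [LHS](_ : _ = \int[mu]_(x in D) (complex.Re c * complex.Im (f x) +
    complex.Im c * complex.Re (f x))); last first.
  by apply: eq_Rintegral => x _ /=; case: (c) (f x) => ? ? [].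
rewrite RintegralD ?RintegralZl//; try exact: sc.
by case: (c).
Qed.

Lemma cst_Lp p c : (1 <= p)%E -> in_Lp a b p (cst c).
Proof.
by move=> p1; apply: (bounded_Lp p1 (cmeas_cst a b c)) => t _; exact: lexx.
Qed.

Lemma prim_a f : prim f a = 0.
Proof. by rewrite /prim set_itv1 /cint !Rintegral_set1. Qed.

Lemma prim_lin c f g t : t <= b -> in_Lp a b 1 f -> in_Lp a b 1 g ->
  prim (c \*: f \+ g) t = c * prim f t + prim g t.
Proof.
by move=> tb; apply: cint_lin => //; apply: subset_itv; rewrite bnd_simp.
Qed.

Lemma primB f u v : in_Lp a b 1 f -> a <= u -> u <= v -> v <= b ->
  prim f v - prim f u = cint `]u, v] f.
Proof.
move=> fL au uv vb; apply: complex_ext.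
  rewrite ReB /= Rintegral_itvB ?bnd_simp//.
  exact: integrable_itvS (Re_integrable fL).
rewrite ImB /= Rintegral_itvB ?bnd_simp//.
exact: integrable_itvS (Im_integrable fL).
Qed.

Lemma normc_primB f u v : in_Lp a b 1 f -> a <= u -> u <= v -> v <= b ->
  normc (prim f v - prim f u) <= 2 * \int[mu]_(x in `]u, v]) normc (f x).
Proof.
move=> fL au uv vb; rewrite primB//; apply: normc_cint => //.
by apply: subset_itv; rewrite bnd_simp// ltW.
Qed.

Lemma normc_prim f t : in_Lp a b 1 f -> t \in `[a, b] ->
  normc (prim f t) <= 2 * \int[mu]_(x in `[a, t]) normc (f x).
Proof.
move=> fL; rewrite in_itv/= => /andP[at_ tb]; apply: normc_cint => //.
by apply: subset_itv; rewrite bnd_simp.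
Qed.

(** The increments over disjoint intervals add up to at most twice the integral of the modulus over
    their union, which [integral_small] controls by the total length. *)
Lemma prim_AC f : in_Lp a b 1 f -> abs_continuous a b (prim f).
Proof.
move=> fL e e0; have e20 : 0 < e / 2 by rewrite divr_gt0.
have iN := normc_integrable fL.
have [d d0 hd] := integral_small (measurable_itv _) iN (fun t _ => normc_ge0 (f t)) e20.
exists d => // n u v uv tuv suv.
have iuv i : mu.-integrable `]u i, v i[ (EFin \o (fun t => normc (f t))).
  have [? [? ?]] := uv i.
  apply: integrableS iN => //; apply: subset_itv; rewrite bnd_simp//.
apply: (@le_lt_trans _ _ (\sum_i 2 * \int[mu]_(x in `]u i, v i[) normc (f x))).
  apply: ler_sum => i _; have [? [? ?]] := uv i.
  rewrite Rintegral_itv_bndo_bndc//; exact: normc_primB.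
rewrite -mulr_sumr -ltr_pdivlMl// [ltRHS]mulrC -lte_fin.
set U := \big[setU/set0]_i `]u i, v i[%classic.
have mU : measurable U by apply: bigsetU_measurable => i _; exact: measurable_itv.
have UE x : U x -> exists i, `]u i, v i[%classic x.
  by rewrite /U -bigcup_seq => -[i _ ?]; exists i.
have Uab : U `<=` `[a, b].
  move=> x Ux; have [i xi] := UE x Ux; have [? [? ?]] := uv i.
  move: xi; rewrite /= !in_itv/= => /andP[? ?]; apply/andP; split; lra.
have mN : measurable_fun U (EFin \o (fun t => normc (f t))).
  by apply: measurable_funS (measurable_int _ iN).
have tuv' : trivIset [set` index_enum 'I_n] (fun i => `]u i, v i[%classic).
  by move=> i j _ _; exact: tuv.
rewrite -sumEFin.
under eq_bigr => i _ do rewrite fineK ?(integrable_fin_num _ (iuv i))//.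
have := @ge0_integral_bigsetU _ _ _ mu _ (fun i => `]u i, v i[%classic) _
  (index_enum 'I_n) (fun i => measurable_itv _) (index_enum_uniq _) tuv' mN _.
rewrite -/U => <-; last by move=> x _; rewrite lee_fin normc_ge0.
apply: hd => //.
rewrite /U measure_bigsetU_ord//=.
rewrite (eq_bigr (fun i => (v i - u i)%:E)).
  by rewrite sumEFin lte_fin.
move=> i _; have [? [? ?]] := uv i.
rewrite [LHS](@lebesgue_measure_itv R `]u i, v i[)/= lte_fin.
case: ltP => // vu; rewrite EFinB.
have -> : u i = v i by lra.
by rewrite subee.
Qed.

Lemma prim_cont f : in_Lp a b 1 f -> {within `[a, b], continuous (prim f)}.
Proof. by move=> /prim_AC/AC_continuous. Qed.

(** The remainder of the first order expansion at [t] is the integral of [f - f t], small near [t]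
    by continuity. The derivative thus exists at every point, one-sided at [a] and [b]. *)
Lemma prim_deriv f : {within `[a, b], continuous f} -> is_deriv_fun a b (prim f) f.
Proof.
move=> fc t tab; have fL := cont_Lp ab (lexx 1%E) fc.
have [at_ tb] : a <= t /\ t <= b by move: tab; rewrite in_itv/= => /andP[].
apply/is_derivP => e e0.
have e20 : 0 < e / 2 by rewrite divr_gt0.
have [d d0 hd] := (within_contP a b f).1 fc t tab _ e20; exists d => // s sab std.
have [as_ sb] : a <= s /\ s <= b by move: sab; rewrite in_itv/= => /andP[].
pose h := -1 \*: cst (f t) \+ f.
have cL : in_Lp a b 1 (cst (f t)).
  exact: cst_Lp.
have hL : in_Lp a b 1 h by apply: in_LpD => //; exact: in_LpZ.
have cE u v : a <= u -> u <= v -> v <= b -> cint `]u, v] (cst (f t)) = (v - u)%:C * f t.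
  move=> au uv vb; rewrite /cint !Rintegral_cst//.
  rewrite [X in fine X](@lebesgue_measure_itv R `]u, v])/= lte_fin.
  have -> : fine (if u < v then (v%:E - u%:E)%E else 0%E) = v - u.
    by case: ltP => //= vu; lra.
  by case: (f t) => x y; apply: complex_ext => /=; ring.
(* Stated for ordered endpoints so that it serves on both sides of [t]. *)
have key u v : u \in `[a, b] -> v \in `[a, b] -> u <= v ->
    (forall x, x \in `]u, v] -> normc (f x - f t) <= e / 2) ->
    normc (prim f v - prim f u - (v - u)%:C * f t) <= e * (v - u).
  rewrite !in_itv/= => /andP[au ub] /andP[av vb] uv hx.
  have Dab : `]u, v] `<=` `[a, b] by apply: subset_itv; rewrite bnd_simp// ltW.
  rewrite primB// -cE// (_ : _ - _ = cint `]u, v] h); last first.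
    by rewrite cint_lin// mulN1r addrC.
  apply: le_trans (normc_cint _ Dab hL) _ => //.
  rewrite (_ : e * (v - u) = 2 * (e / 2 * (v - u))); last by field.
  rewrite ler_pM2l//.
  apply: (@le_trans _ _ (\int[mu]_(x in `]u, v]) (e / 2))).
    apply: le_Rintegral => //.
    - exact: integrableS (normc_integrable hL).
    - apply: integrable_sub Dab _ => //.
      exact: (Re_integrable (cst_Lp (e / 2)%:C (lexx 1%E))).
    - by move=> x /hx; rewrite /h/= scaleN1r addrC.
  rewrite Rintegral_cst//.
  rewrite [X in fine X](@lebesgue_measure_itv R `]u, v])/= lte_fin.
  case: ltP => //= vu; have -> : v = u by lra.
  by rewrite subrr.
have [ts|/ltW st] := leP t s.
  rewrite ger0_norm ?subr_ge0//; apply: key => // x; rewrite in_itv/= => /andP[tx xs].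
  apply/ltW/hd; first by rewrite in_itv/=; apply/andP; split; lra.
  by move: std; rewrite !ger0_norm; lra.
rewrite ler0_norm ?subr_le0// opprB -normcN.
rewrite (_ : - (prim f s - prim f t - (s - t)%:C * f t) =
    prim f t - prim f s - (t - s)%:C * f t); last first.
  by rewrite !rmorphB; ring.
apply: key => // x; rewrite in_itv/= => /andP[sx xt].
apply/ltW/hd; first by rewrite in_itv/=; apply/andP; split; lra.
by move: std; rewrite !ler0_norm; lra.
Qed.

Lemma ae_itv_oo (P : R -> Prop) :
  {ae mu, forall t, t \in `]a, b[ -> P t} -> {ae mu, forall t, t \in `[a, b] -> P t}.
Proof.
have na c : {ae mu, forall t, t != c}.
  exists [set c]; split => //; first exact: lebesgue_measure_set1.
  by move=> t /= /negP; rewrite negbK => /eqP.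
move=> hP; apply: (aeS2 _ hP (aeS2 (fun t => @conj (t != a) (t != b)) (na a) (na b))).
move=> t Pt [ta tb]; rewrite in_itv/= => /andP[at_ tb'].
by apply: Pt; rewrite in_itv/= lt_neqAle eq_sym ta at_ lt_neqAle tb tb'.
Qed.

(** Lebesgue's differentiation theorem, applied to [h] extended by zero to an integrable function on
    the line; on [[a, b]] the primitive does not change. *)
Lemma real_prim_ae (h : R -> R) : mu.-integrable `[a, b] (EFin \o h) ->
  {ae mu, forall t, t \in `]a, b[ -> forall e, 0 < e -> exists2 d, 0 < d &
    forall s, s \in `[a, b] -> `|s - t| < d ->
    `|\int[mu]_(x in `[a, s]) h x - \int[mu]_(x in `[a, t]) h x - (s - t) * h t|
      <= e * `|s - t|}.
Proof.
move=> ih; pose g := h \_ `[a, b].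
have ig : mu.-integrable setT (EFin \o g).
  by have := (integrable_mkcond _ mab).1 ih; rewrite restrict_EFin.
have igy y : mu.-integrable `[a, y] (EFin \o g) by exact: integrableS ig.
have locg : locally_integrable [set: R] g by apply: integrable_locally.
have gE s : s \in `[a, b] -> \int[mu]_(x in `[a, s]) g x = \int[mu]_(x in `[a, s]) h x.
  rewrite in_itv/= => /andP[? ?]; apply: eq_Rintegral => x.
  rewrite inE/= in_itv/= => /andP[? ?].
  by rewrite /g patchE mem_set//= in_itv/=; apply/andP; split; lra.
have := @FTC1 R g (BLeft a) igy locg; apply: aeS => t h1 tab e e0.
have tab' : t \in `[a, b] by exact: subset_itv_oo_cc.
have [|dg gt] := h1.
  by rewrite /= lte_fin; move: tab; rewrite in_itv/= => /andP[].
have [d d0 hd] := derive_realP dg gt e0; exists d => // s sab /hd.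
by rewrite !gE// /g patchE mem_set.
Qed.

Lemma prim_ae_deriv f : in_Lp a b 1 f -> ae_deriv a b (prim f) f.
Proof.
move=> fL; apply: ae_itv_oo.
have := real_prim_ae (Im_integrable fL); have := real_prim_ae (Re_integrable fL).
apply: aeS2 => t hR hI tab; apply/is_derivP => e e0.
have e20 : 0 < e / 2 by rewrite divr_gt0.
have [d d0 hd] := hR tab _ e20; have [d' d'0 hd'] := hI tab _ e20.
exists (Num.min d d'); first by rewrite lt_min d0.
move=> s sab; rewrite lt_min => /andP[s1 s2].
rewrite (_ : e * _ = 2 * (e / 2 * `|s - t|)); last by field.
apply: normc_RIle.
  have := hd s sab s1; congr (`|_| <= _); rewrite !ReB /prim /cint /=.
  by case: (f t) => ? ? /=; rewrite mul0r subr0.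
have := hd' s sab s2; congr (`|_| <= _); rewrite !ImB /prim /cint /=.
by case: (f t) => ? ? /=; rewrite mul0r addr0.
Qed.

End primitive.

(** * Absolutely continuous functions *)

Section absolutely_continuous.
Context {R : realType}.
Notation mu := (@lebesgue_measure R).

(** The supremum of the points reached is itself passed, starting from a point just below it, unless
    it is [b]. The step only compares points on either side of [t], because that is all that a
    derivative at the single point [t] controls. *)
Lemma interval_induction (S : R -> Prop) (a b : R) : a <= b -> S a ->
  (forall t, t \in `[a, b] -> exists2 d, 0 < d & forall x y, a <= x -> x <= t ->
    t <= y -> y <= b -> t - d < x -> y < t + d -> S x -> S y) ->
  S b.
Proof.
move=> ab Sa step; pose A := [set x : R | (a <= x <= b) /\ S x].
have Aa : A a by rewrite /A/= lexx ab.
have supA : has_sup A by split; [exists a|exists b => x [/andP[]]].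
have T_in : sup A \in `[a, b].
  rewrite in_itv/=; apply/andP; split; first exact: (ub_le_sup supA.2).
  by apply: sup_le_ub; [exists a|move=> x [/andP[]]].
have [d d0 hd] := step _ T_in.
have [x [/andP[ax xb] Sx] Tx] := sup_adherent d0 supA.
have xT : x <= sup A by apply: (ub_le_sup supA.2); split => //; rewrite ax.
move: (T_in); rewrite in_itv/= => /andP[aT Tb].
have [bT|Tb'] := leP b (sup A).
  apply: (hd x) => //.
  by rewrite (le_lt_trans bT)// ltrDl.
pose y := Num.min b (sup A + d / 2).
have Ty : sup A < y by rewrite lt_min Tb' ltrDl divr_gt0.
have Sy : S y.
  apply: (hd x) => //; first exact: ltW.
    by rewrite ge_min lexx.
  rewrite gt_min; apply/orP; right.
  by rewrite ltrD2l ltr_pdivrMr// mulr_natr mulr2n ltrDl.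
have : y <= sup A.
  apply: (ub_le_sup supA.2); split => //.
  by rewrite (le_trans aT (ltW Ty)) ge_min lexx.
by rewrite leNgt Ty.
Qed.

(* Covering argument: around a point where [h' = 0] the increment of [h] is at
   most [e] times that of [t]; the other points form a null set, covered by an
   open set [U] of small measure, over which [h] varies by at most [e]. *)
Lemma AC_cst (a b : R) (h : R -> R[i]) : a < b ->
  abs_continuous a b h -> ae_deriv a b h (cst 0) ->
  {in `[a, b], forall t, h t = h a}.
Proof.
move=> ab hAC hd t tab.
suff key (e : R) : 0 < e -> normc (h t - h a) <= e * (t - a) + e.
  have [at_ tb] : a <= t /\ t <= b by move: tab; rewrite in_itv/= => /andP[].
  apply/eqP; rewrite -subr_eq0; apply/eqP/eq0_normc/eqP.
  rewrite eq_le normc_ge0 andbT leNgt; apply/negP => h0.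
  have ta1 : 0 < t - a + 1 by lra.
  (* With this [e] the right-hand side of [key] is half of the left-hand side. *)
  have := key (normc (h t - h a) / (t - a + 1) / 2).
  rewrite !divr_gt0// => /(_ isT).
  have -> : normc (h t - h a) / (t - a + 1) / 2 * (t - a) +
      normc (h t - h a) / (t - a + 1) / 2 = normc (h t - h a) / 2.
    by field; rewrite gt_eqF.
  lra.
move=> e0; have [d d0 dP] := hAC _ e0.
have [N [mN N0 subN]] := hd.
have [|U [oU NU muU]] := lebesgue_regularity_outer mN _ d0.
  by rewrite [ltLHS]N0.
have mU : measurable (U : set (measurableTypeR R)) by exact: open_measurable.
have {}muU : (mu U < d%:E)%E.
  apply: le_lt_trans muU.
  have mUN : measurable (U `\` N : set (measurableTypeR R)) by exact: measurableD.
  have : (mu ((U `\` N) `|` N) <= mu (U `\` N) + mu N)%E by exact: measureU2.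
  rewrite N0 adde0; apply: le_trans.
  by rewrite setDKU.
(* In [S x], finitely many disjoint intervals inside [U] and to the left of [x] account for the part
   of the increment that [e * (x - a)] misses. *)
pose S x := exists n (u v : nat -> R),
  [/\ forall i, (i < n)%N -> [/\ a <= u i, u i <= v i, v i <= x &
        forall y, u i < y -> y < v i -> U y],
      forall i j, (i < n)%N -> (j < n)%N -> i != j -> v i <= u j \/ v j <= u i &
      normc (h x - h a) <= e * (x - a) + \sum_(i < n) normc (h (v i) - h (u i))].
have Sgood x y : x <= y -> normc (h y - h x) <= e * (y - x) -> S x -> S y.
  move=> xy hxy [n [u [v [uv dis le]]]]; exists n, u, v; split=> //.
    by move=> i /uv[? ? vx ?]; split=> //; exact: le_trans xy.
  have -> : h y - h a = (h y - h x) + (h x - h a) by rewrite subrKA.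
  apply: (le_trans (le_normcD _ _)); lra.
have Sbad x y : a <= x -> x <= y -> (forall z, x < z -> z < y -> U z) -> S x -> S y.
  move=> ax xy Uxy [n [u [v [uv dis le]]]].
  (* All earlier intervals end before [x], so the appended one is disjoint from them. *)
  exists n.+1, (fun i => if i == n then x else u i), (fun i => if i == n then y else v i).
  split.
  - move=> i; rewrite ltnS (leq_eqVlt i); case: eqP => [_ _|_ /= /uv[? ? vx ?]] //.
    by split => //; exact: le_trans xy.
  - move=> i j; rewrite (ltnS i) (ltnS j) (leq_eqVlt i) (leq_eqVlt j).
    case: eqP => [->|_] /=; case: eqP => [->|_] //=; rewrite ?eqxx//.
    + by move=> _ /uv[]; right.
    + by move=> /uv[]; left.
    + by move=> ? ? ?; exact: dis.
  - rewrite big_ord_recr/= eqxx.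
    under eq_bigr => i _ do rewrite (ltn_eqF (ltn_ord i)).
    have -> : h y - h a = (h y - h x) + (h x - h a) by rewrite subrKA.
    have exy : e * (x - a) <= e * (y - a) by rewrite ler_pM2l// lerD2r.
    apply: (le_trans (le_normcD _ _)); lra.
have [at_ tb] : a <= t /\ t <= b by move: tab; rewrite in_itv/= => /andP[].
have : S t.
  apply: (@interval_induction S a t) => //.
    exists 0%N, (fun=> a), (fun=> a); split=> //.
    by rewrite !subrr normc0 big_ord0 mulr0 addr0.
  move=> s sat.
  have sab : s \in `[a, b].
    by move: sat; rewrite !in_itv/= => /andP[-> /le_trans]; exact.
  have [sN|sN] := pselect (N s).
    have /nbhs_ballP[r /= r0 hr] := open_nbhs_nbhs (conj oU (NU _ sN)).
    exists r => // x y ax xs sy yt sx yr; apply: Sbad => //; first exact: le_trans sy.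
    move=> z xz zy; apply: hr; rewrite -ball_normE/= ltr_norml.
    by apply/andP; split; lra.
  have : is_deriv a b h s 0.
    by apply: contrapT => hs; apply: sN; apply: subN => /= /(_ sab).
  move=> /is_derivP /(_ _ e0)[r r0 hr]; exists r => // x y ax xs sy yt sx yr Sx.
  have /Sgood : x <= s by [].
  have xab : x \in `[a, b] by rewrite in_itv/=; apply/andP; split; lra.
  have yab : y \in `[a, b] by rewrite in_itv/=; apply/andP; split; lra.
  move=> /(_ _ Sx) Ss; apply: (Sgood s) => //.
    have := hr y yab; rewrite mulr0 subr0 ger0_norm ?subr_ge0//; apply; lra.
  apply: Ss; rewrite normc_distC.
  have := hr x xab; rewrite mulr0 subr0 ler0_norm ?subr_le0// opprB; apply; lra.
move=> [n [u [v [uv dis le]]]]; apply: (le_trans le); rewrite lerD2l ltW//.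
apply: (dP n (fun i => u i) (fun i => v i)).
- by move=> i; have [? ? vt _] := uv i (ltn_ord i); repeat split=> //; exact: le_trans tb.
- move=> i j _ _ [z [/= ]]; rewrite !in_itv/= => /andP[? ?] /andP[? ?].
  apply/eqP; case: eqVneq => // ij.
  by have [] := dis i j (ltn_ord i) (ltn_ord j) ij; lra.
rewrite -lte_fin; apply: le_lt_trans muU.
have tuv : trivIset setT (fun i : 'I_n => `]u i, v i[%classic : set (measurableTypeR R)).
  move=> i j _ _ [z [/= ]]; rewrite !in_itv/= => /andP[? ?] /andP[? ?].
  apply/eqP; case: eqVneq => // ij.
  by have [] := dis i j (ltn_ord i) (ltn_ord j) ij; lra.
have mI : measurable (\big[setU/set0]_(i < n) `]u i, v i[%classic : set (measurableTypeR R)).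
  by apply: bigsetU_measurable => i _; exact: measurable_itv.
apply: (@le_trans _ _ (mu (\big[setU/set0]_(i < n) `]u i, v i[%classic))).
  rewrite measure_bigsetU_ord//= -sumEFin; apply: lee_sum => i _.
  rewrite [leRHS](@lebesgue_measure_itv R `]u i, v i[)/= lte_fin.
  have [_ ? _ _] := uv i (ltn_ord i).
  case: ltP => [_|vu]; first by rewrite EFinB.
  by rewrite lee_fin subr_le0.
apply: le_measure; rewrite ?inE// => z.
rewrite -bigcup_seq => -[i _ /=]; rewrite in_itv/= => /andP[uz zv].
by have [_ _ _] := uv i (ltn_ord i); exact.
Qed.

(** The difference [f - prim a g] is absolutely continuous with derivative zero almost everywhere,
    so [AC_cst] applies. *)
Lemma AC_prim (a b : R) (f g : R -> R[i]) : a < b -> abs_continuous a b f ->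
  in_Lp a b 1 g -> ae_deriv a b f g -> {in `[a, b], forall t, f t = f a + prim a g t}.
Proof.
move=> ab fAC gL fg t tab.
have hAC : abs_continuous a b (-1 \*: prim a g \+ f) by exact: AC_lin (prim_AC gL) fAC.
have := AC_cst ab hAC _ tab; rewrite /= prim_a scaler0 add0r => <-.
  by rewrite scaleN1r addrAC addNr add0r.
have := ae_deriv_lin (-1) (prim_ae_deriv gL) fg; apply: aeS => s hs sab.
by have := hs sab; rewrite /= scaleN1r addNr.
Qed.

End absolutely_continuous.

(** * Linear Volterra systems *)

Section real_series.
Context {R : realType}.
Implicit Types u v : R^nat.

Lemma cvg0_le (x : R) u : (forall n, x <= u n) -> u @ \oo --> 0 -> x <= 0.
Proof.
move=> xu u0; rewrite -(cvg_lim (@Rhausdorff R) u0).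
by apply: limr_ge; [apply: cvgP u0|apply: nearW].
Qed.

Lemma series_tail u v : (forall k, `|u k| <= v k) -> cvgn (series v) ->
  forall n, `|limn (series u) - series u n| <= limn (series v) - series v n.
Proof.
move=> uv cv n.
have v0 k : 0 <= v k by exact: le_trans (uv k).
have cu : cvgn (series u).
  by apply: normed_cvg; apply: series_le_cvg cv => // k; rewrite normr_ge0.
have cun : (fun m => `|series u m - series u n|) @ \oo -->
    `|limn (series u) - series u n|.
  by apply: cvg_norm; apply: cvgB => //; exact: cvg_cst.
rewrite -(cvg_lim (@Rhausdorff R) cun); apply: limr_le; first exact: cvgP cun.
have vlim m : series v m <= limn (series v).
  by apply: nondecreasing_cvgn_le cv m; exact: nondecreasing_series.
near=> m; have nm : (n <= m)%N by near: m; exists n.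
rewrite sub_series_geq//; apply: (le_trans (ler_norm_sum _ _ _)).
apply: (@le_trans _ _ (series v m - series v n)).
  by rewrite sub_series_geq//; exact: ler_sum.
by rewrite lerD2r.
Unshelve. all: by end_near. Qed.

End real_series.

Section volterra.
Context {R : realType} (a b : R) (ab : a < b) (I : finType).
Notation mu := (@lebesgue_measure R).
Variable M : I -> I -> R -> R[i].
Hypothesis ML : forall i j, in_Lp a b 1 (M i j).

Definition row_fun (z : I -> R -> R[i]) i : R -> R[i] :=
  fun t => \sum_j M i j t * z j t.

Lemma cont_lin (c : R[i]) (f g : R -> R[i]) : {within `[a, b], continuous f} ->
  {within `[a, b], continuous g} -> 
  {within `[a, b], continuous (fun t => c * f t + g t : R[i])}.
Proof.
by move=> cf cg; exact: (contD (contM (@cont_cst _ a b c) cf) cg).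
Qed.

Lemma normc_sum (J : Type) (s : seq J) (F : J -> R[i]) :
  normc (\sum_(j <- s) F j) <= \sum_(j <- s) normc (F j).
Proof.
elim: s => [|j s ih]; first by rewrite !big_nil normc0.
by rewrite !big_cons (le_trans (le_normcD _ _))// lerD2l.
Qed.

Lemma row_L1 z i : (forall j, {within `[a, b], continuous (z j)}) ->
  in_Lp a b 1 (row_fun z i).
Proof.
move=> zc; apply: (@sobolev_sum _ a b 1 ab (lexx 1%E) 0) => j.
have [C _ zC] := cont_bounded ab (zc j).
exact: (in_LpM (lexx 1%E) (ML i j) (cont_cmeas (zc j)) zC).
Qed.

Lemma normc_L1 f : in_Lp a b 1 f -> in_Lp a b 1 (fun t => (normc (f t))%:C).
Proof.
move=> fL; have iN := normc_integrable fL; apply/in_L1P; split.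
  split; last exact: measurable_cst.
  by apply/measurable_EFinP; exact: measurable_int iN.
by apply: eq_integrable iN => // x _;
  rewrite -[RHS]/((normc (normc (f x))%:C)%:E) normcR ger0_norm// normc_ge0.
Qed.

(** Summing over both indices dominates all rows by a single function; the 2 is the factor of
    [normc_prim]. *)
Let alpha t : R := \sum_i \sum_j 2 * normc (M i j t).
(** The complex-valued copy gives [phi] access to the results on complex primitives. *)
Let alphaC t : R[i] := (alpha t)%:C.

Let alpha0 t : 0 <= alpha t.
Proof. by do 2 (apply: sumr_ge0 => ? _); rewrite mulr_ge0// normc_ge0. Qed.

Let alphaL : in_Lp a b 1 alphaC.
Proof.
have -> : alphaC = fun t => \sum_i \sum_j (2%:C *: (normc (M i j t))%:C).
  apply/funext => t; rewrite /alphaC /alpha rmorph_sum/=; apply: eq_bigr => i _.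
  by rewrite rmorph_sum/=; apply: eq_bigr => j _; rewrite rmorphM.
apply: (@sobolev_sum _ a b 1 ab (lexx 1%E) 0) => i.
apply: (@sobolev_sum _ a b 1 ab (lexx 1%E) 0) => j.
by apply: (in_LpZ (lexx 1%E)); exact: normc_L1.
Qed.

Let phi t : R := \int[mu]_(x in `[a, t]) alpha x.

Let phiE t : prim a alphaC t = (phi t)%:C.
Proof. by apply: complex_ext => //=; rewrite Rintegral_cst ?mul0r. Qed.

Let phi0 t : 0 <= phi t.
Proof. exact: Rintegral_ge0. Qed.

Let pow_L1 k : in_Lp a b 1 (fun t => alphaC t * prim a alphaC t ^+ k).
Proof.
have phi_cont : {within `[a, b], continuous (prim a alphaC)} by exact: prim_cont.
have pc : {within `[a, b], continuous (fun t => prim a alphaC t ^+ k)}.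
  elim: k => [|k ih].
    rewrite (_ : (fun t => _) = cst 1); first exact: cont_cst.
    by apply/funext => t; rewrite expr0.
  rewrite (_ : (fun t => _) = prim a alphaC \* (fun t => prim a alphaC t ^+ k)).
    exact: contM.
  by apply/funext => t; rewrite exprS.
have [C _ hC] := cont_bounded ab pc.
exact: (in_LpM (lexx 1%E) alphaL (cont_cmeas pc) hC).
Qed.

Let pow_integrable k t : t \in `[a, b] ->
  mu.-integrable `[a, t] (EFin \o (fun x => alpha x * phi x ^+ k)).
Proof.
rewrite in_itv/= => /andP[at_ tb].
have := integrable_itvS (lexx a) tb (Re_integrable (pow_L1 k)).
apply: eq_integrable => // x _.
by rewrite /= phiE -rmorphXn /= mul0r subr0.
Qed.

(** Since [phi] is only absolutely continuous, the power rule is proved almost everywhere, by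
    induction through the product rule, and then integrated with [AC_prim]. *)
Let phi_pow k t : t \in `[a, b] ->
  \int[mu]_(x in `[a, t]) (alpha x * phi x ^+ k) = phi t ^+ k.+1 / k.+1%:R.
Proof.
move=> tab; pose F k := fun t => prim a alphaC t ^+ k.+1.
pose F' k := fun t => (k.+1%:R : R[i]) * (alphaC t * prim a alphaC t ^+ k).
have [FAC FF'] : abs_continuous a b (F k) /\ ae_deriv a b (F k) (F' k).
  elim: k => [|k [ihAC ihd]].
    split; first by apply: eq_AC (prim_AC alphaL) => x _; rewrite /F expr1.
    have := prim_ae_deriv alphaL; apply: aeS => x h xab.
    rewrite /F' expr0 mulr1 mul1r.
    by apply: eq_is_deriv (h xab) => // y _; rewrite /F expr1.
  have -> : F k.+1 = F k \* prim a alphaC by apply/funext => x; rewrite /F/= exprSr.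
  split; first exact: AC_M (prim_AC alphaL).
  have := prim_ae_deriv alphaL; apply: aeS2 ihd => x hF h xab.
  rewrite (_ : F' k.+1 x = F' k x * prim a alphaC x + F k x * alphaC x).
    by apply: is_derivM; [exact: hF|exact: h].
  rewrite /F' /F -[k.+2%:R]natr1 exprS.
  by ring.
have F'L : in_Lp a b 1 (F' k) by exact: (in_LpZ (lexx 1%E)).
have := AC_prim ab FAC F'L FF' tab; rewrite {1}/F phiE /F prim_a expr0n add0r.
have -> : prim a (F' k) t = k.+1%:R * prim a (fun t => alphaC t * prim a alphaC t ^+ k) t.
  have := @prim_lin _ a b k.+1%:R _ _ t _ (pow_L1 k) (cst_Lp a b 0 (lexx 1%E)).
  have -> : prim a (cst 0) t = 0 by apply: complex_ext => /=; rewrite Rintegral_cst ?mul0r.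
  rewrite addr0 => <-; last by move: tab; rewrite in_itv/= => /andP[].
  by congr (prim a _ t); apply/funext => x /=; rewrite addr0.
have -> : prim a (fun t => alphaC t * prim a alphaC t ^+ k) t =
    (\int[mu]_(x in `[a, t]) (alpha x * phi x ^+ k))%:C.
  have pE x : alphaC x * prim a alphaC x ^+ k = (alpha x * phi x ^+ k)%:C.
    by rewrite phiE -rmorphXn -rmorphM.
  rewrite (_ : (fun t0 => _) = fun t0 => (alpha t0 * phi t0 ^+ k)%:C); last exact/funext.
  by apply: complex_ext => //=; rewrite Rintegral_cst ?mul0r.
rewrite -rmorphXn -(rmorph_nat (real_complex R)) -rmorphM => /complexI ->.
by rewrite mulrAC mulfV ?mul1r// pnatr_eq0.
Qed.

Let phi_le t : t \in `[a, b] -> phi t <= phi b.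
Proof.
rewrite in_itv/= => /andP[at_ tb].
have := Rintegral_itvB (a := BLeft a) (b := BRight b) (x := t) (Re_integrable alphaL).
rewrite !bnd_simp => /(_ at_ tb) h.
by rewrite -subr_ge0 [leRHS]h; apply: Rintegral_ge0 => x _; exact: alpha0.
Qed.

(** [exp_coeff x k] is [x^k / k!]. By [phi_pow], each application of the Volterra operator raises
    [k] by one and keeps [C], so the iterates decay factorially however large the coefficients
    are. *)
Lemma row_bound (C : R) k z i : 0 <= C ->
  (forall j, {within `[a, b], continuous (z j)}) ->
  (forall j t, t \in `[a, b] -> normc (z j t) <= C * exp_coeff (phi t) k) ->
  forall t, t \in `[a, b] ->
  normc (prim a (row_fun z i) t) <= C * exp_coeff (phi t) k.+1.
Proof.
move=> C0 zc zC t tab.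
have [at_ tb] : a <= t /\ t <= b by move: tab; rewrite in_itv/= => /andP[].
have rL := row_L1 i zc; apply: (le_trans (normc_prim rL tab)).
have iN := integrable_itvS (lexx a) tb (normc_integrable rL).
have iP := pow_integrable k tab.
have mt : measurable (`[a, t]%classic : set (measurableTypeR R)) by [].
(* The division by 2 compensates for the factor already contained in [alpha]. *)
apply: (@le_trans _ _ (2 * \int[mu]_(x in `[a, t])
    ((C / k`!%:R / 2) * (alpha x * phi x ^+ k)))).
  rewrite ler_pM2l//; apply: le_Rintegral => //; first exact: (integrableZl mt _ iP).
  move=> x; rewrite /= in_itv/= => /andP[ax xt].
  have xab : x \in `[a, b] by rewrite in_itv/= ax (le_trans xt).
  apply: (le_trans (normc_sum _ _)).
  apply: (@le_trans _ _ (\sum_j normc (M i j x) * (C * exp_coeff (phi x) k))).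
    by apply: ler_sum => j _; rewrite normcM ler_wpM2l ?normc_ge0 ?zC.
  rewrite -mulr_suml.
  rewrite (_ : _ / 2 * _ = (alpha x / 2) * (C * exp_coeff (phi x) k)).
    rewrite ler_wpM2r//; first by apply: mulr_ge0 => //; exact: exp_coeff_ge0.
    rewrite ler_pdivlMr// mulr_suml.
    apply: (@le_trans _ _ (\sum_j 2 * normc (M i j x))).
      by apply: ler_sum => j _; rewrite mulrC.
    rewrite /alpha [leRHS](bigD1 i)//= lerDl sumr_ge0// => i' _.
    by rewrite sumr_ge0// => j _; rewrite mulr_ge0// normc_ge0.
  by rewrite /exp_coeff/=; field; rewrite pnatr_eq0 -lt0n fact_gt0.
rewrite RintegralZl// phi_pow// /exp_coeff/= factS natrM.
rewrite le_eqVlt; apply/orP; left; apply/eqP; field.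
by rewrite pnatr_eq0 -lt0n fact_gt0/= addrC natr1 pnatr_eq0.
Qed.

(** A solution equals its image under every power of the operator, hence is bounded by
    [C' phi^k / k!] for all [k]. *)
Lemma volterra_unique w : (forall j, {within `[a, b], continuous (w j)}) ->
  (forall i t, t \in `[a, b] -> w i t = prim a (row_fun w i) t) ->
  forall i t, t \in `[a, b] -> w i t = 0.
Proof.
move=> wc wE.
have /choice[C CP] j : exists C, 0 <= C /\ forall t, t \in `[a, b] -> normc (w j t) <= C.
  by have [C ? ?] := cont_bounded ab (wc j); exists C.
pose C' := \sum_j C j.
have C'0 : 0 <= C' by apply: sumr_ge0 => j _; case: (CP j).
have wC k : forall j t, t \in `[a, b] -> normc (w j t) <= C' * exp_coeff (phi t) k.
  elim: k => [|k ih] j t tab.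
    rewrite /exp_coeff/= expr0 fact0 divr1 mulr1.
    rewrite (le_trans ((CP j).2 t tab))// /C' (bigD1 j)//= lerDl.
    by apply: sumr_ge0 => h _; case: (CP h).
  by rewrite wE//; exact: row_bound ih _ tab.
move=> i t tab; apply/eq0_normc/eqP; rewrite eq_le normc_ge0 andbT.
apply: (cvg0_le (fun k => wC k i t tab)).
by rewrite -[X in _ --> X](mulr0 C'); apply: cvgMr; exact: cvg_exp_coeff.
Qed.

Lemma unif_cont (S : nat -> R -> R[i]) (z : R -> R[i]) (tau : R^nat) :
  (forall n, {within `[a, b], continuous (S n)}) ->
  (forall n t, t \in `[a, b] -> normc (z t - S n t) <= tau n) ->
  tau @ \oo --> 0 -> {within `[a, b], continuous z}.
Proof.
move=> Sc zS tau0; apply/within_contP => t tab e e0.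
have e40 : 0 < e / 4 by rewrite divr_gt0.
have /cvgrPdist_lt /(_ _ e40)[N _ /(_ N (leqnn N))] := tau0.
rewrite /= sub0r normrN => /(le_lt_trans (ler_norm _)) tN.
have [d d0 hd] := (within_contP a b (S N)).1 (Sc N) t tab _ e40.
exists d => // s sab std.
have -> : z s - z t = (z s - S N s) + ((S N s - S N t) - (z t - S N t)) by ring.
have := zS N s sab; have := zS N t tab; have := hd s sab std.
have := le_normcD (z s - S N s) ((S N s - S N t) - (z t - S N t)).
have := le_normcD (S N s - S N t) (- (z t - S N t)); rewrite normcN.
lra.
Qed.

Variable G : I -> R -> R[i].
Hypothesis Gc : forall i, {within `[a, b], continuous (G i)}.

(** These are the terms of the Picard series; its partial sums are the [S n] of
    [volterra_exists]. *)
Let pic k := iter k (fun z i => prim a (row_fun z i)) G.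

Let pic_cont k i : {within `[a, b], continuous (pic k i)}.
Proof.
elim: k i => [|k ih] i; first exact: Gc.
exact: prim_cont (row_L1 i ih).
Qed.

Lemma volterra_exists : exists2 z : I -> R -> R[i],
  (forall i, {within `[a, b], continuous (z i)}) &
  forall i t, t \in `[a, b] -> z i t = G i t + prim a (row_fun z i) t.
Proof.
have /choice[C CP] j : exists C, 0 <= C /\ forall t, t \in `[a, b] -> normc (G j t) <= C.
  by have [C ? ?] := cont_bounded ab (@Gc j); exists C.
pose C' := \sum_j C j.
have C'0 : 0 <= C' by apply: sumr_ge0 => j _; case: (CP j).
have picC k : forall j t, t \in `[a, b] -> normc (pic k j t) <= C' * exp_coeff (phi t) k.
  elim: k => [|k ih] j t tab.
    rewrite /exp_coeff/= expr0 fact0 divr1 mulr1.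
    rewrite (le_trans ((CP j).2 t tab))// /C' (bigD1 j)//= lerDl.
    by apply: sumr_ge0 => h _; case: (CP h).
  exact: (@row_bound C' k (pic k) j C'0 (@pic_cont k) ih t tab).
pose v k := C' * exp_coeff (phi b) k.
have picv k j t : t \in `[a, b] -> normc (pic k j t) <= v k.
  move=> tab; rewrite (le_trans (picC k j t tab))// ler_wpM2l// /exp_coeff/=.
  by rewrite ler_wpM2r ?invr_ge0// lerXn2r ?nnegrE ?phi0// phi_le.
have cv : cvgn (series v).
  have -> : v = C' *: exp_coeff (phi b) by [].
  by apply: is_cvg_seriesZ; exact: is_cvg_series_exp_coeff.
(* Twice the tail of the majorant, since the real and imaginary series are each compared with
   [v]. *)
pose tau n := 2 * (limn (series v) - series v n).
have tau0 : tau @ \oo --> 0.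
  rewrite -[X in _ --> X](mulr0 2); apply: cvgMr.
  by rewrite -(subrr (limn (series v))); apply: cvgB => //; exact: cvg_cst.
have taun0 n : 0 <= tau n.
  rewrite mulr_ge0// subr_ge0; apply: nondecreasing_cvgn_le cv n.
  apply: nondecreasing_series => k _ _; rewrite mulr_ge0// exp_coeff_ge0//.
pose S n i t : R[i] := \sum_(0 <= k < n) pic k i t.
pose z i t : R[i] := limn (series (fun k => complex.Re (pic k i t))) +i*
                     limn (series (fun k => complex.Im (pic k i t))).
have zS n i t : t \in `[a, b] -> normc (z i t - S n i t) <= tau n.
  move=> tab; apply: normc_RIle.
    have -> : complex.Re (z i t - S n i t) =
        limn (series (fun k => complex.Re (pic k i t))) -
        series (fun k => complex.Re (pic k i t)) n.
      by rewrite ReB/= /S (raddf_sum (@complex.Re R)).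
    by apply: series_tail => // k; rewrite (le_trans (abs_Re_le _))// picv.
  have -> : complex.Im (z i t - S n i t) =
      limn (series (fun k => complex.Im (pic k i t))) -
      series (fun k => complex.Im (pic k i t)) n.
    by rewrite ImB/= /S (raddf_sum (@complex.Im R)).
  by apply: series_tail => // k; rewrite (le_trans (abs_Im_le _))// picv.
have Sc n i : {within `[a, b], continuous (S n i)}.
  elim: n => [|n ih].
    rewrite (_ : S 0%N i = cst 0); first exact: cont_cst.
    by apply/funext => t; rewrite /S big_geq.
  rewrite (_ : S n.+1 i = S n i \+ pic n i); last first.
    by apply/funext => t; rewrite /S big_nat_recr.
  exact: (contD ih (@pic_cont n i)).
have zc i : {within `[a, b], continuous (z i)}.
  exact: (unif_cont (fun n => Sc n i) (fun n => zS n i) tau0).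
have SE n i t : t \in `[a, b] -> S n.+1 i t = G i t + prim a (row_fun (S n) i) t.
  move=> tab; have tb : t <= b by move: tab; rewrite in_itv/= => /andP[].
  elim: n => [|n ih].
    rewrite /S big_nat1 [row_fun _ _](_ : _ = cst 0).
      rewrite (_ : prim _ _ _ = 0) ?addr0//.
      by apply: complex_ext => /=; rewrite Rintegral_cst ?mul0r.
    by apply/funext => x; rewrite /row_fun big1// => j _; rewrite big_geq// mulr0.
  rewrite {1}/S big_nat_recr//= -/(S n.+1 i t) ih -addrA; congr (_ + _).
  rewrite -[prim a (row_fun (S n) i) t]mul1r.
  rewrite -(prim_lin _ tb (row_L1 i (Sc n)) (row_L1 i (@pic_cont n))).
  congr (prim a _ t); apply/funext => x; rewrite /= scale1r /row_fun -big_split/=.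
  by apply: eq_bigr => j _; rewrite /S big_nat_recr//= mulrDr.
exists z => // i t tab.
have tb : t <= b by move: tab; rewrite in_itv/= => /andP[].
apply/eqP; rewrite -subr_eq0; apply/eqP/eq0_normc/eqP.
rewrite eq_le normc_ge0 andbT.
(* The defect of [z] is measured against the exact relation [SE]: replacing [z] by [S n.+1] outside
   the integral costs [tau n.+1], and by [S n] inside it costs [phi b * tau n], by [row_bound] with
   [k = 0]. *)
apply: (@cvg0_le _ _ (fun n => tau n.+1 + phi b * tau n)).
  move=> n; pose w j : R -> R[i] := fun x => -1 * z j x + S n j x.
  have wc j : {within `[a, b], continuous (w j)}.
    exact: (@cont_lin (-1) (z j) (S n j) (@zc j) (@Sc n j)).
  have -> : z i t - (G i t + prim a (row_fun z i) t) =
      (z i t - S n.+1 i t) + prim a (row_fun w i) t.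
    have -> : row_fun w i = -1 \*: row_fun z i \+ row_fun (S n) i.
      apply/funext => x.
      change (\sum_j M i j x * (-1 * z j x + S n j x) =
        -1 * (\sum_j M i j x * z j x) + \sum_j M i j x * S n j x).
      by rewrite mulr_sumr -big_split; apply: eq_bigr => j _ /=; ring.
    rewrite (prim_lin _ tb (row_L1 i zc) (row_L1 i (Sc n))) SE//; ring.
  apply: (le_trans (le_normcD _ _)); apply: lerD; first exact: zS.
  have := @row_bound (tau n) 0 w i (taun0 n) wc _ t tab.
  rewrite /exp_coeff/= expr1 divr1 => h.
  apply: (@le_trans _ _ (tau n * phi t)); last first.
    by rewrite mulrC ler_wpM2r// phi_le.
  apply: h => j s sab; rewrite expr0 divr1 mulr1 /w mulN1r addrC normc_distC.
  exact: zS.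
rewrite -[X in _ --> X](addr0 0) -[X in _ --> _ + X](mulr0 (phi b)).
apply: cvgD; last exact: cvgMr.
by rewrite (cvg_shiftS tau).
Qed.

End volterra.

(** * Calculus in Sobolev spaces and the Cauchy problem *)

Section Lp_L1.
Context {R : realType} (a b : R) (ab : a < b) (p : \bar R) (p1 : (1 <= p)%E).
Notation mu := (@lebesgue_measure R).
Implicit Types f g : R -> R[i].


Lemma Lp_norm_fin q f : in_Lp a b q f -> Lp_norm a b q f \is a fin_num.
Proof. by move=> [_ _ h]; rewrite ge0_fin_numE// Lnorm_ge0. Qed.

(** For [1 < p < +oo] this is Hoelder's inequality against the function 1, whose norm in the
    conjugate exponent is the constant; for [p = +oo] the essential bound is integrated directly. *)
Lemma in_Lp_L1 : exists2 C : R, 0 <= C & forall f, in_Lp a b p f ->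
  in_Lp a b 1 f /\ fine (Lp_norm a b 1 f) <= C * fine (Lp_norm a b p f).
Proof.
suff [C C0 hC] : exists2 C : R, 0 <= C & forall f, in_Lp a b p f ->
    (Lp_norm a b 1 f <= C%:E * Lp_norm a b p f)%E.
  exists C => // f fL; have fN := Lp_norm_fin fL; have [fr fi _] := fL.
  have h := hC f fL.
  have fL1 : in_Lp a b 1 f.
    split=> //; apply: le_lt_trans h _.
    by rewrite -(fineK fN) -EFinM ltry.
  split=> //; rewrite -lee_fin EFinM !fineK//.
  exact: Lp_norm_fin.
case: p p1 => [r| |//] r1; last first.
  have oneL := cst_Lp a b 1 (lexx 1%E).
  have oneF := Lp_norm_fin oneL.
  exists (fine (Lp_norm a b 1 (cst 1))); first by rewrite fine_ge0// Lnorm_ge0.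
  move=> f fL; have fN := Lp_norm_fin fL; have [fr fi _] := fL.
  have fM : cmeas a b f by [].
  set K := fine (Lp_norm a b +oo f).
  have K0 : 0 <= K by rewrite fine_ge0// Lnorm_ge0.
  have oneM : cmeas a b (cst 1) by exact: cmeas_cst.
  have KL := in_LpZ (lexx 1%E) K%:C oneL.
  apply: (@le_trans _ _ (Lp_norm a b 1 (K%:C \*: cst 1))).
    apply: (le_Lp_norm (lexx 1%E) fM); first by case: KL.
    have : {ae mu, forall t, (((fun t => normc (f t) : R) \_ `[a, b]) t)%:E <= K%:E}%E.
      rewrite /K fineK// /Lp_norm unlock.
      (* The norm for [+oo] unfolds to the essential supremum only on a space of positive
         measure. *)
      have mT : (0 < mu setT)%E.
        apply: (@lt_le_trans _ _ (mu `[a, b])).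
          by rewrite [ltRHS](@lebesgue_measure_itv R `[a, b])/= lte_fin ab -EFinB lte_fin subr_gt0.
        by apply: le_measure; rewrite ?inE.
      rewrite mT; have := ess_sup_ge mu
        (abse \o (EFin \o (fun t => normc (f t) : R) \_ `[a, b])).
      apply: aeS => t.
      by rewrite /= ger0_norm// /patch; case: ifPn => // _; exact: normc_ge0.
    apply: aeS => t; rewrite lee_fin => + tab.
    rewrite patchE mem_set// => h; rewrite (le_trans h)//.
    by rewrite -[leRHS]/(normc (K%:C * 1)) mulr1 normcR ler_norm.
  by rewrite Lp_normZ// normcR ger0_norm// muleC /K !fineK.
have [->|r1'] := eqVneq r 1.
  by exists 1 => // f _; rewrite mul1e.
have {r1'} r1' : 1 < r by rewrite lt_neqAle eq_sym r1'.
have r0 : 0 < r by exact: lt_trans r1'.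
pose q := (1 - r^-1)^-1.
have q0 : 0 < q by rewrite invr_gt0 subr_gt0 invf_lt1.
have rq : r^-1 + q^-1 = 1 by rewrite /q invrK addrC subrK.
have q1 : (1 <= q%:E)%E.
  rewrite lee_fin -[leLHS]invr1 lef_pV2 ?posrE//; last by rewrite -(invrK (1 - _)) invr_gt0.
  by rewrite gerBl invr_ge0 ltW.
have oneL := cst_Lp a b 1 q1; have oneF := Lp_norm_fin oneL.
exists (fine (Lp_norm a b q%:E (cst 1))); first by rewrite fine_ge0// Lnorm_ge0.
move=> f fL; have [fr fi _] := fL.
pose F (h : R -> R[i]) := (fun t => normc (h t) : R) \_ `[a, b].
have mF h : cmeas a b h -> measurable_fun setT (F h) by move=> mh; exact: measurable_normc.
have := hoelder mu (mF _ (conj fr fi)) (mF _ (cmeas_cst a b 1)) r0 q0 rq.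
rewrite muleC -[X in (X * _)%E]/(Lp_norm a b q%:E (cst 1)) -(fineK oneF).
apply: le_trans; rewrite le_eqVlt; apply/orP; left; apply/eqP.
congr (Lnorm _ _ _); apply/funext => t /=; congr EFin.
by rewrite /F /patch; case: ifPn => _; rewrite ?mulr0// (normcR 1) normr1 mulr1.
Qed.

End Lp_L1.

(** * Products, primitives and derivatives in Sobolev spaces *)

Section sobolev_calculus.
Context {R : realType} (a b : R) (ab : a < b) (p : \bar R) (p1 : (1 <= p)%E).
Notation mu := (@lebesgue_measure R).
Notation D := (deriv_fun a b).
Implicit Types f g : R -> R[i].

Lemma Lp_L1 f : in_Lp a b p f -> in_Lp a b 1 f.
Proof. by have [C _ h] := in_Lp_L1 ab p1 => /h[]. Qed.

Lemma sobolev_Lp k f : is_sobolev a b p k f -> in_Lp a b p f.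
Proof. exact: (sobolev_leq ab p1 (leq0n k)). Qed.

(** From order one on, both factors are bounded, so no additional order of [g] is needed as in
    [sobolevM]. The regularity argument of [ivp_exists] multiplies two functions of equal order. *)
Lemma sobolevM_same k f g : is_sobolev a b p k.+1 f -> is_sobolev a b p k.+1 g ->
  is_sobolev a b p k.+1 (f \* g).
Proof.
case: k => [|k].
  move=> [[_ fc] fAC [f' f'L ff']] [[_ gc] gAC [g' g'L gg']].
  have AC : abs_continuous a b (f \* g) by exact: AC_M.
  have [M _ fM] := cont_bounded ab fc; have [N _ gN] := cont_bounded ab gc.
  split; [by split; [by []|exact: (AC_continuous AC)]|exact: AC|].
  exists ((f' \* g) \+ (g' \* f)).
    apply: in_LpD => //; first exact: (in_LpM p1 f'L (cont_cmeas gc) gN).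
    exact: (in_LpM p1 g'L (cont_cmeas fc) fM).
  apply: aeS2 ff' gg' => t hf hg tab.
  rewrite (_ : _ t = f' t * g t + f t * g' t); last by rewrite [f t * _]mulrC.
  by apply: is_derivM; [exact: hf|exact: hg].
move=> fs gs; have [fd f's] := (sobolevSS p ab _ _).1 fs.
have [gd g's] := (sobolevSS p ab _ _).1 gs.
have h : is_deriv_fun a b (f \* g) ((D f \* g) \+ (f \* D g)).
  by move=> t tab; apply: is_derivM; [exact: fd|exact: gd].
apply/(sobolevSS p ab); have e := is_deriv_fun_eq ab h.
split; first by move=> t tab; rewrite -e//; exact: h.
apply: (eq_sobolev ab e).
have e1 : {in `[a, b], 1 \*: (D f \* g) \+ (D g \* f) =1 (D f \* g) \+ (f \* D g)}.
  by move=> t _; rewrite /= scale1r [f t * _]mulrC.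
apply: (eq_sobolev ab e1).
by apply: (sobolev_lin ab p1); exact: (sobolevM ab p1).
Qed.

Lemma is_deriv_addl c f t l : is_deriv a b f t l ->
  is_deriv a b (fun s => c + f s : R[i]) t l.
Proof.
move=> /is_derivP h; apply/is_derivP => e /h[d d0 hd]; exists d => // s sab /(hd _ sab).
by rewrite (_ : c + f s - (c + f t) = f s - f t)//; ring.
Qed.

Lemma AC_addl c f : abs_continuous a b f ->
  abs_continuous a b (fun s => c + f s : R[i]).
Proof.
move=> fAC e /fAC[d d0 hd]; exists d => // n u v uv tuv /(hd n u v uv tuv).
congr (_ < e); apply: eq_bigr => i _; congr normc; ring.
Qed.

Lemma sobolev_prim k c f : is_sobolev a b p k f ->
  is_sobolev a b p k.+1 (fun t => c + prim a f t : R[i]).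
Proof.
move=> fs; have fL := Lp_L1 (sobolev_Lp fs); case: k fs => [|k] fs.
  have AC := AC_addl c (prim_AC fL).
  split; [by split; [by []|exact: (AC_continuous AC)]|exact: AC|].
  by exists f => //; apply: aeS (prim_ae_deriv fL) => t h /h; exact: is_deriv_addl.
have fc := sobolevS_cont ab fs.
have h : is_deriv_fun a b (fun t => c + prim a f t : R[i]) f.
  by move=> t tab; apply: is_deriv_addl; exact: prim_deriv.
apply/(sobolevSS p ab); have e := is_deriv_fun_eq ab h.
split; first by move=> t tab; rewrite -e//; exact: h.
exact: (eq_sobolev ab e).
Qed.

Lemma sderiv_lt k i f : (i < k)%N -> sderiv a b p k i f = iter i D f.
Proof. by case: i => // i ik; rewrite /sderiv ik. Qed.

(** Treats all orders alike, including the top one, where [sderiv] is a chosen representative. *)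
Lemma sderiv_ae k j f : (j < k)%N -> is_sobolev a b p k f ->
  ae_deriv a b (iter j D f) (sderiv a b p k j.+1 f).
Proof.
case: k => // k; rewrite ltnS leq_eqVlt => /predU1P[->|jk] fs.
  by have [] := sderivP fs.
rewrite sderiv_lt//; apply: aeW => t tab.
by apply: deriv_funP => //; case: fs => -[+ _] _ _; exact.
Qed.

Lemma sderiv_uniq k j f g : (j < k)%N -> is_sobolev a b p k f ->
  ae_deriv a b (iter j D f) g ->
  {ae mu, forall t, t \in `[a, b] -> sderiv a b p k j.+1 f t = g t}.
Proof.
move=> jk fs; apply: aeS2 (sderiv_ae jk fs) => t h1 h2 tab.
exact: (is_deriv_unique ab tab (h1 tab) (h2 tab)).
Qed.

Lemma iter_deriv_AC k j f : (j < k)%N -> is_sobolev a b p k f ->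
  abs_continuous a b (iter j D f).
Proof.
move=> jk fs; have : is_sobolev a b p (0.+1 + j) f by exact: (sobolev_leq ab p1 jk).
by move=> /sobolev_iter[].
Qed.

(** In positive order both functions are continuous, and agreement almost everywhere is agreement on
    [[a, b]]. *)
Lemma sob_eq_of_ae k f g : is_sobolev a b p k f -> is_sobolev a b p k g ->
  {ae mu, forall t, t \in `[a, b] -> f t = g t} -> sob_eq a b k f g.
Proof.
case: k => // k fs gs fg.
have hs := sobolev_lin ab p1 (-1) gs fs.
have h0 : {ae mu, forall t, t \in `[a, b] -> (-1 \*: g \+ f) t = 0}.
  by apply: aeS fg => t e tab; rewrite /= scaleN1r e// addNr.
have := cont_ae0 ab (sobolevS_cont ab hs) h0.
move=> h t tab; have := h t tab; rewrite /= scaleN1r addrC => /eqP.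
by rewrite subr_eq0 => /eqP.
Qed.

End sobolev_calculus.

(** * The Cauchy problem *)

Section initial_value_problem.
Context {R : realType} (a b : R) (ab : a < b) (p : \bar R) (p1 : (1 <= p)%E).
Variables (n m r' : nat).
Let r := r'.+1.
Notation mu := (@lebesgue_measure R).
Notation D := (deriv_fun a b).
Variable A : 'I_r -> 'I_m -> 'I_m -> R -> R[i].
Hypothesis As : forall j i q, is_sobolev a b p n (A j i q).

(* The first order system satisfied by the derivatives
   [z (j, i) = y_i^(j)], [j < r]. *)
Definition companion (k k' : 'I_r * 'I_m) : R -> R[i] :=
  if (k.1 < r')%N then cst ((k'.1 == k.1.+1 :> nat) && (k'.2 == k.2))%:R
  else -1 \*: A k'.1 k.2 k'.2.

Let companion_L1 k k' : in_Lp a b 1 (companion k k').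
Proof.
rewrite /companion; case: ifP => _; first exact: cst_Lp.
by apply: (in_LpZ (lexx 1%E)); apply: (Lp_L1 ab p1); exact: sobolev_Lp (As _ _ _).
Qed.

Let row_low (z : 'I_r * 'I_m -> R -> R[i]) (j j' : 'I_r) i :
  j' = j.+1 :> nat -> row_fun companion z (j, i) = z (j', i).
Proof.
move=> jj'; have jr : (j < r')%N by rewrite -ltnS -jj'.
apply/funext => t; rewrite /row_fun /companion /= jr.
rewrite (bigD1 (j', i))//= jj' !eqxx mul1r big1 ?addr0// => -[j1 i1] /=.
rewrite xpair_eqE -val_eqE/= jj' => /negbTE ->.
by rewrite mul0r.
Qed.

Let row_top (z : 'I_r * 'I_m -> R -> R[i]) i t :
  row_fun companion z (ord_max, i) t = - \sum_j \sum_q A j i q t * z (j, q) t.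
Proof.
rewrite /row_fun /companion /= ltnn pair_bigA -sumrN; apply: eq_bigr => -[j q] _ /=.
by rewrite scaleN1r mulNr.
Qed.

(** The derivatives of order below [r] are absolutely continuous and vanish at [a], so the almost
    everywhere equations integrate to the homogeneous Volterra system. *)
Lemma ivp_unique (y : 'I_m -> R -> R[i]) :
  (forall i, is_sobolev a b p (n + r) (y i)) ->
  (forall i (j : 'I_r), iter j D (y i) a = 0) ->
  (forall i, {ae mu, forall t, t \in `[a, b] ->
    sderiv a b p (n + r) r (y i) t +
    \sum_j \sum_q A j i q t * sderiv a b p (n + r) j (y q) t = 0}) ->
  forall i t, t \in `[a, b] -> y i t = 0.
Proof.
move=> ys y0 yE; pose z (k : 'I_r * 'I_m) := iter k.1 D (y k.2).
have rn (j : 'I_r) : (j < n + r)%N by rewrite (leq_trans (ltn_ord j))// leq_addl.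
have zAC k : abs_continuous a b (z k).
  by apply: (iter_deriv_AC ab p1 (rn k.1)); exact: ys.
have zc k : {within `[a, b], continuous (z k)} by exact: AC_continuous.
suff z0 k t : t \in `[a, b] -> z k t = 0.
  by move=> i t tab; exact: (z0 (ord0, i)).
apply: (volterra_unique ab companion_L1 zc) => {}k {}t tab.
have z0 : z k a = 0 by exact: y0.
rewrite -[RHS]add0r -z0; apply: (AC_prim ab (zAC k) _ _ tab).
  exact: (row_L1 ab companion_L1 k zc).
case: k z0 => j i _; have := sderiv_ae ab (rn j) (ys i).
(* Below the last row the system says that [y^(j+1)] is the derivative of [y^(j)]; the last row is
   the equation itself. *)
have [jr|rj] := ltnP j r'.
  pose j' : 'I_r := Ordinal (jr : (j.+1 < r)%N).
  have -> : row_fun companion z (j, i) = z (j', i) by exact: row_low.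
  by rewrite (@sderiv_lt _ a b p (n + r) j.+1 (y i) (rn j')).
have jE : j = ord_max by apply/val_inj/eqP; rewrite eqn_leq rj -ltnS ltn_ord.
apply: aeS2 (yE i) => t1 + h tab1 => /(_ tab1) yE1.
rewrite jE row_top; have := h tab1; rewrite {1 2}jE.
move/eqP : yE1; rewrite addr_eq0 => /eqP ->.
congr is_deriv; congr (- _); apply: eq_bigr => j1 _; apply: eq_bigr => q _.
by rewrite (@sderiv_lt _ a b p (n + r) j1 (y q) (rn j1)).
Qed.

(** The Volterra solution is a priori only a family of continuous functions: it remains to see that
    [z (j, i)] is the [j]-th derivative of [z (0, i)] and that the latter has order [n + r]. *)
Lemma ivp_exists (f : 'I_m -> R -> R[i]) (c : 'I_r -> 'I_m -> R[i]) :
  (forall i, is_sobolev a b p n (f i)) ->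
  exists y : 'I_m -> R -> R[i],
  [/\ forall i, is_sobolev a b p (n + r) (y i),
      forall i (j : 'I_r), iter j D (y i) a = c j i &
      forall i, {ae mu, forall t, t \in `[a, b] ->
        sderiv a b p (n + r) r (y i) t +
        \sum_j \sum_q A j i q t * sderiv a b p (n + r) j (y q) t = f i t}].
Proof.
move=> fs.
have aab : a \in `[a, b] by rewrite in_itv/= lexx ltW.
have fL i : in_Lp a b 1 (f i) by apply: (Lp_L1 ab p1); exact: sobolev_Lp (fs i).
pose zero : R -> R[i] := cst 0.
have zeroL : in_Lp a b 1 zero by exact: cst_Lp.
pose g (k : 'I_r * 'I_m) := if (k.1 < r')%N then zero else f k.2.
have gL k : in_Lp a b 1 (g k) by rewrite /g; case: ifP.
pose G (k : 'I_r * 'I_m) t : R[i] := c k.1 k.2 + prim a (g k) t.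
have Gc k : {within `[a, b], continuous (G k)}.
  exact: (contD (@cont_cst _ a b (c k.1 k.2)) (prim_cont (gL k))).
have [z zc zE] := volterra_exists ab companion_L1 Gc.
(* [h i] will be the [r]-th derivative of [y_i]; the regularity of [z] is read off from it. *)
pose h i t : R[i] := f i t - \sum_j \sum_q A j i q t * z (j, q) t.
have z_low (j j' : 'I_r) i t : j' = j.+1 :> nat -> t \in `[a, b] ->
    z (j, i) t = c j i + prim a (z (j', i)) t.
  move=> jj' tab; have tb : t <= b by move: tab; rewrite in_itv/= => /andP[].
  have jr : (j < r')%N by rewrite -ltnS -jj'.
  rewrite zE// (row_low z i jj') /G /g /= jr -addrA; congr (_ + _).
  have -> : prim a zero t = 0 by apply: complex_ext => /=; rewrite Rintegral_cst ?mul0r.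
  by rewrite add0r.
have z_top i t : t \in `[a, b] -> z (ord_max, i) t = c ord_max i + prim a (h i) t.
  move=> tab; have tb : t <= b by move: tab; rewrite in_itv/= => /andP[].
  rewrite zE// /G /g /= ltnn -addrA; congr (_ + _).
  rewrite addrC -[X in X + _]mul1r -(prim_lin 1 tb _ (fL i)); last first.
    exact: (row_L1 ab companion_L1 _ zc).
  congr (prim a _ t); apply/funext => x.
  by rewrite /= scale1r row_top addrC.
have za k : z k a = c k.1 k.2 by rewrite zE// /G !prim_a !addr0.
(* Each of the [r - j] integrations from [h] to [z (j, i)] gains one order; the induction descends
   from [j = r']. *)
have z_reg k : (forall i, is_sobolev a b p k (h i)) ->
    forall (j : 'I_r) i, is_sobolev a b p (k + (r - j)) (z (j, i)).
  move=> hs j i; move dE : (r' - j)%N => d; elim: d j dE => [|d ih] j dE.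
    have -> : j = ord_max.
      by apply/val_inj/eqP; rewrite eqn_leq -ltnS ltn_ord/= -subn_eq0 dE.
    rewrite /r subSnn addn1; have := sobolev_prim ab p1 (c ord_max i) (hs i).
    by apply: (eq_sobolev ab) => t tab; rewrite z_top.
  have jr : (j < r')%N by rewrite -subn_gt0 dE.
  pose j' : 'I_r := Ordinal (jr : (j.+1 < r)%N).
  have -> : (k + (r - j) = (k + (r - j')).+1)%N by rewrite /= subSS -addnS -subSn// ltnW.
  have := sobolev_prim ab p1 (c j i) (ih j' _); rewrite subnS dE => /(_ erefl).
  by apply: (eq_sobolev ab) => t tab; rewrite (z_low j j').
have hE i : h i = -1 \*: (fun t => \sum_j \sum_q A j i q t * z (j, q) t) \+ f i.
  by apply/funext => t; rewrite /= scaleN1r addrC.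
(* If [h] has order [k], every [z (j, i)] has order at least [k + 1] because [j < r], and so has [h]
   while [k < n]. The start only needs [z] to be bounded, to multiply functions of [L_p]. *)
have h_reg k : (k <= n)%N -> forall i, is_sobolev a b p k (h i).
  elim: k => [_|k ih kn] i; rewrite hE; apply: (sobolev_lin ab p1).
  - apply: (sobolev_sum ab p1) => j; apply: (sobolev_sum ab p1) => q.
    have [C _ zC] := cont_bounded ab (zc (j, q)).
    exact: (in_LpM p1 (sobolev_Lp ab p1 (As j i q)) (cont_cmeas (zc (j, q))) zC).
  - exact: (sobolev_Lp ab p1 (fs i)).
  - apply: (sobolev_sum ab p1) => j; apply: (sobolev_sum ab p1) => q.
    apply: (sobolevM_same ab p1); first exact: (sobolev_leq ab p1 kn (As j i q)).
    apply: (@sobolev_leq _ a b p ab p1 _ (k + (r - j))).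
      by rewrite -addn1 leq_add2l subn_gt0.
    by apply: z_reg => i'; apply: ih; exact: ltnW.
  - exact: (sobolev_leq ab p1 kn (fs i)).
have zD j i (jr : (j < r)%N) : {in `[a, b], iter j D (z (ord0, i)) =1 z (Ordinal jr, i)}.
  elim: j jr => [|j ih] jr; first by move=> t _; congr (z (_, _) t); exact: val_inj.
  have jr' : (j < r)%N by exact: ltnW.
  have zd : is_deriv_fun a b (z (Ordinal jr', i)) (z (Ordinal jr, i)).
    move=> t tab.
    have := @is_deriv_addl _ a b (c (Ordinal jr') i) _ _ _
      (prim_deriv ab (@zc (Ordinal jr, i)) tab).
    by apply: (eq_is_deriv tab) => s sab; rewrite -z_low.
  move=> t tab; rewrite (is_deriv_fun_eq ab zd tab).
  exact: (eq_deriv_fun (ih jr') tab).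
have rn (j : 'I_r) : (j < n + r)%N by rewrite (leq_trans (ltn_ord j))// leq_addl.
have ys i : is_sobolev a b p (n + r) (z (ord0, i)).
  by have := z_reg n (h_reg n (leqnn n)) ord0 i; rewrite subn0.
exists (fun i => z (ord0, i)); split=> //.
  move=> i j; rewrite (zD j i (ltn_ord j) a aab) za.
  by congr (c _ i); exact: val_inj.
move=> i.
(* At order [r] the derivative is only known almost everywhere, and [sderiv_uniq] compares it with
   the chosen representative. *)
have hd : ae_deriv a b (iter r' D (z (ord0, i))) (h i).
  have hL : in_Lp a b 1 (h i) by apply: (Lp_L1 ab p1); exact: (h_reg 0%N).
  apply: aeS (prim_ae_deriv hL) => t hp tab.
  have := @is_deriv_addl _ a b (c ord_max i) _ _ _ (hp tab).
  apply: (eq_is_deriv tab) => s sab.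
  rewrite -z_top// (zD r' i (ltnSn r') s sab).
  by congr (z (_, i) s); exact: val_inj.
apply: aeS (sderiv_uniq ab (rn ord_max) (ys i) hd) => t + tab => /(_ tab) ->.
rewrite /h -[RHS](subrK (\sum_j \sum_q A j i q t * z (j, q) t)); congr (_ + _).
apply: eq_bigr => j _; apply: eq_bigr => q _; congr (_ * _).
rewrite (@sderiv_lt _ a b p (n + r) j _ (rn j)) (zD j q (ltn_ord j) t tab).
by congr (z (_, q) t); exact: val_inj.
Qed.

End initial_value_problem.

(** * Sobolev norms of products *)

Section sobolev_norms.
Context {R : realType} (a b : R) (ab : a < b) (p : \bar R) (p1 : (1 <= p)%E).
Notation mu := (@lebesgue_measure R).
Notation D := (deriv_fun a b).
Notation is_sob := (is_sobolev a b p).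
Notation sd := (sderiv a b p).
Implicit Types f g : R -> R[i].

(** The norm of [sobolev] on functions instead of classes, so that products and derivatives can be
    estimated without choosing representatives. *)
Definition sob_norm k f : R := \sum_(i < k.+1) fine (Lp_norm a b p (sd k i f)).

Lemma fine_Lp_norm_ge0 q f : 0 <= fine (Lp_norm a b q f).
Proof. by rewrite fine_ge0// Lnorm_ge0. Qed.

Lemma sob_norm_ge0 k f : 0 <= sob_norm k f.
Proof. by apply: sumr_ge0 => i _; exact: fine_Lp_norm_ge0. Qed.

Let in_cmeas q f : in_Lp a b q f -> cmeas a b f.
Proof. by case. Qed.

Let sd_Lp k i f : (i < k.+1)%N -> is_sob k f -> in_Lp a b p (sd k i f).
Proof. by rewrite ltnS => ik; exact: sderiv_Lp. Qed.

Lemma sob_norm_eq k f g : is_sob k f -> is_sob k g -> sob_eq a b k f g ->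
  sob_norm k f = sob_norm k g.
Proof.
move=> fs gs fg; apply: eq_bigr => i _; congr fine.
have ik : (i <= k)%N by rewrite -ltnS.
have fg' : sob_eq a b k f (0 \*: g \+ g).
  by have -> // : 0 \*: g \+ g = g; apply/funext => t; rewrite /= scale0r add0r.
have := sderiv_lin ab ik gs gs fs fg'.
have -> : 0 \*: sd k i g \+ sd k i g = sd k i g.
  by apply/funext => t; rewrite /= scale0r add0r.
by apply: (sob_eq_Lp_norm p1); apply: in_cmeas; exact: sd_Lp.
Qed.

Lemma sob_normD k f g : is_sob k f -> is_sob k g ->
  sob_norm k (f \+ g) <= sob_norm k f + sob_norm k g.
Proof.
move=> fs gs; have E : 1 \*: f \+ g = f \+ g by apply/funext => t; rewrite /= scale1r.
have fgs : is_sob k (f \+ g) by rewrite -E; exact: (sobolev_lin ab p1).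
have fg : sob_eq a b k (f \+ g) (1 \*: f \+ g) by rewrite E; exact: sob_eq_refl.
rewrite /sob_norm -big_split/=; apply: ler_sum => i _.
have ik : (i <= k)%N by rewrite -ltnS.
have := sderiv_lin ab ik fs gs fgs fg.
have -> : 1 \*: sd k i f \+ sd k i g = sd k i f \+ sd k i g.
  by apply/funext => t; rewrite /= scale1r.
have fi := sd_Lp (ltn_ord i) fs; have gi := sd_Lp (ltn_ord i) gs.
move=> /(sob_eq_Lp_norm p1 (in_cmeas (sd_Lp (ltn_ord i) fgs))) ->; last first.
  exact: in_cmeas (in_LpD p1 fi gi).
move: (sd k i f) (sd k i g) fi gi => F G FL GL.
have FF := Lp_norm_fin FL; have GF := Lp_norm_fin GL.
rewrite -fineD//; apply: fine_le; first exact: Lp_norm_fin (in_LpD p1 FL GL).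
  by rewrite fin_numD FF GF.
exact: (Lp_normD p1 (in_cmeas FL) (in_cmeas GL)).
Qed.

Lemma sob_norm_sum k (I : Type) (s : seq I) (F : I -> R -> R[i]) :
  (forall i, is_sob k (F i)) ->
  sob_norm k (fun t => \sum_(i <- s) F i t) <= \sum_(i <- s) sob_norm k (F i).
Proof.
move=> Fs; elim: s => [|i s ih].
  rewrite big_nil; under [X in sob_norm _ X]eq_fun do rewrite big_nil.
  have s0 := sobolev0 ab p1 k.
  rewrite /sob_norm big1// => i _.
  have ik : (i <= k)%N by rewrite -ltnS.
  have := sderiv0 ab ik s0 (sob_eq_refl a b k _).
  move=> /(sob_eq_Lp_norm p1 (in_cmeas (sd_Lp (ltn_ord i) s0)) (cmeas_cst a b 0)) ->.
  rewrite /Lp_norm [EFin \o _](_ : _ = cst 0%E).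
    by rewrite Lnorm0// gt_eqF// (lt_le_trans _ p1).
  apply/funext => t; rewrite /comp /patch; case: ifP => // _; congr EFin.
  exact: normc0.
under [X in sob_norm _ X]eq_fun do rewrite big_cons.
rewrite big_cons; apply: (le_trans (sob_normD (Fs i) _)); last by rewrite lerD2l.
exact: (sobolev_sum ab p1).
Qed.

(** An equality of functions even at the top order [i = k > 0]: both sides then choose a
    representative from the same set. *)
Lemma sderiv_comp k j i f : (i <= k)%N -> sd k i (sd (k + j) j f) = sd (k + j) (i + j) f.
Proof.
case: i => [//|i ik].
have jk : (j < k + j)%N by rewrite -[ltnLHS]add0n ltn_add2r (leq_ltn_trans _ ik).
rewrite (@sderiv_lt _ a b p (k + j) j f jk) /sderiv addSn -[(i + j).+1]addSn ltn_add2r.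
by rewrite -!iterD.
Qed.

(** By [sderiv_comp] the left-hand sum consists of the last [k + 1] terms of the right-hand one. *)
Lemma sob_norm_sderiv k j f : sob_norm k (sd (k + j) j f) <= sob_norm (k + j) f.
Proof.
rewrite /sob_norm.
rewrite (eq_bigr (fun i : 'I_k.+1 => fine (Lp_norm a b p (sd (k + j) (i + j) f)))); last first.
  by move=> i _; rewrite sderiv_comp// -ltnS.
pose F i := fine (Lp_norm a b p (sd (k + j) i f)).
rewrite -(big_mkord xpredT (fun i => F (i + j)%N)) -(big_mkord xpredT F).
rewrite [leRHS](@big_cat_nat _ _ _ j)//=; last by rewrite leqW// leq_addl.
have := big_addn 0 (k + j).+1 j xpredT F; rewrite add0n -addSn addnK => ->.
rewrite lerDr.
by apply: sumr_ge0 => i _; exact: fine_Lp_norm_ge0.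
Qed.

(** The terms of order below [k] coincide. For [k > 0], the [k]-th derivative is a chosen
    representative on the left and a genuine iterate on the right, equal almost everywhere. *)
Lemma sob_norm_leS k f : is_sob k.+1 f -> sob_norm k f <= sob_norm k.+1 f.
Proof.
move=> fs; rewrite {2}/sob_norm big_ord_recr/= ler_wpDr ?fine_Lp_norm_ge0//.
apply: ler_sum => -[i /= ik] _; rewrite le_eqVlt; apply/orP; left; apply/eqP.
congr fine; case: i ik => [//|i]; rewrite ltnS => ik.
have fs' := sobolevW ab p1 fs.
apply: (eq_ae_Lp_norm p1); try by apply: in_cmeas; apply: sd_Lp => //; rewrite ltnS ltnW.
exact: (sderiv_uniq ab ik fs' (sderiv_ae ab (ltnW ik : (i < k.+1)%N) fs)).
Qed.

Lemma sob_norm_leq k k' f : (k <= k')%N -> is_sob k' f -> sob_norm k f <= sob_norm k' f.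
Proof.
move=> /subnK <-; elim: (k' - k)%N => // d ih; rewrite addSn => fs.
by apply: le_trans (sob_norm_leS fs); apply: ih; exact: (sobolevW ab p1).
Qed.

Lemma sobolev_sderiv1 k f : is_sob k.+1 f -> is_sob k (sd k.+1 1 f).
Proof. by rewrite -addn1; exact: sobolev_sderiv. Qed.

Lemma sob_norm0E f : sob_norm 0 f = fine (Lp_norm a b p f).
Proof. by rewrite /sob_norm big_ord1. Qed.

(** Peeling off the lowest term instead of the highest allows induction on [k] through the first
    derivative. *)
Lemma sob_normSE k f :
  sob_norm k.+1 f = fine (Lp_norm a b p f) + sob_norm k (sd k.+1 1 f).
Proof.
rewrite {1}/sob_norm big_ord_recl; congr (_ + _); apply: eq_bigr => i _.
congr (fine (Lp_norm a b p _)); have ik : (i <= k)%N by rewrite -ltnS.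
by have := @sderiv_comp k 1 i f ik; rewrite !addn1 lift0 => ->.
Qed.

Lemma integral_normc f : in_Lp a b 1 f ->
  \int[mu]_(x in `[a, b]) normc (f x) = fine (Lp_norm a b 1 f).
Proof.
move=> fL; congr fine; rewrite /Lp_norm Lnorm1 integral_mkcond.
apply: eq_integral => x _; rewrite restrict_EFin /=.
by rewrite ger0_norm// /patch; case: ifP => // _; exact: normc_ge0.
Qed.

Lemma sob1_sup : exists2 C : R, 0 <= C & forall g, is_sob 1 g ->
  forall t, t \in `[a, b] -> normc (g t) <= C * sob_norm 1 g.
Proof.
have [C C0 hC] := in_Lp_L1 ab p1.
(* [C / (b - a)] bounds the mean value of [normc g], and [4 * C] two values of the primitive of
   [g'], each of which costs [2 * C]. *)
exists (C / (b - a) + 4 * C).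
  by rewrite addr_ge0// ?mulr_ge0// invr_ge0 subr_ge0 ltW.
move=> g gs t tab; have gc := sobolevS_cont ab gs.
have [g'L gd] := sderivP gs; have [g'L1 g'C] := hC _ g'L.
have [gL1 gC] := hC _ (sobolev_Lp ab p1 gs).
have gAC : abs_continuous a b g by case: gs.
(* [normc g] is at most its mean value at the point [s] where it is minimal. *)
have [s sab smin] := EVT_min (ltW ab) (within_comp (@normc_continuous R) gc).
have primle u : u \in `[a, b] ->
    normc (prim a (sd 1 1 g) u) <= 2 * (C * fine (Lp_norm a b p (sd 1 1 g))).
  move=> uab; apply: (le_trans (normc_prim g'L1 uab)); rewrite ler_pM2l//.
  apply: le_trans g'C; rewrite -integral_normc//.
  move: uab; rewrite in_itv/= => /andP[au ub].
  rewrite -subr_ge0 Rintegral_itvB ?bnd_simp//; last exact: normc_integrable.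
  by apply: Rintegral_ge0 => x _; exact: normc_ge0.
have gmin : normc (g s) <= C / (b - a) * fine (Lp_norm a b p g).
  rewrite -[_ / _ * _]mulrAC ler_pdivlMr ?subr_gt0//.
  apply: le_trans gC; rewrite -integral_normc//.
  have -> : normc (g s) * (b - a) = \int[mu]_(x in `[a, b]) normc (g s).
    rewrite Rintegral_cst//; congr (_ * _).
    by rewrite [X in fine X](@lebesgue_measure_itv R `[a, b])/= lte_fin ab.
  apply: le_Rintegral => //.
  - exact: (normc_integrable (cst_Lp a b (g s) (lexx 1%E))).
  - exact: normc_integrable.
have gE u : u \in `[a, b] -> g u = g a + prim a (sd 1 1 g) u.
  by move=> uab; exact: (AC_prim ab gAC g'L1 gd uab).
have -> : g t = g s + (prim a (sd 1 1 g) t - prim a (sd 1 1 g) s).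
  by rewrite gE// [g s]gE//; ring.
rewrite sob_normSE sob_norm0E.
apply: (le_trans (le_normcD _ _)).
have := le_normcD (prim a (sd 1 1 g) t) (- prim a (sd 1 1 g) s); rewrite normcN.
have := primle t tab; have := primle s sab.
have := fine_Lp_norm_ge0 p (sd 1 1 g); have := fine_Lp_norm_ge0 p g.
set x := fine _; set x' := fine _ => x0 x'0.
have : 0 <= C / (b - a) * x' by rewrite !mulr_ge0// invr_ge0 subr_ge0 ltW.
have : 0 <= C * x by rewrite mulr_ge0.
move: gmin; rewrite -/x; lra.
Qed.

Lemma sob_norm_mul0 f : in_Lp a b p f -> exists2 C : R, 0 <= C & forall g, is_sob 1 g ->
  fine (Lp_norm a b p (f \* g)) <= C * sob_norm 1 g.
Proof.
move=> fL; have [C C0 hC] := sob1_sup.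
exists (fine (Lp_norm a b p f) * C); first by rewrite mulr_ge0// fine_Lp_norm_ge0.
move=> g gs; have gM := hC g gs; set M := C * sob_norm 1 g in gM.
have M0 : 0 <= M by rewrite mulr_ge0// sob_norm_ge0.
have gc := cont_cmeas (sobolevS_cont ab gs).
have fgL := in_LpM p1 fL gc gM; have MfL := in_LpZ p1 M%:C fL.
rewrite -mulrA -/M mulrC -[M]ger0_norm// -normcR.
rewrite -[normc _]/(fine (normc M%:C)%:E) -fineM//; last exact: Lp_norm_fin.
rewrite -Lp_normZ//; apply: fine_le; try exact: Lp_norm_fin.
apply: (le_Lp_norm p1); [exact: in_cmeas fgL|exact: in_cmeas MfL|].
apply: aeW => t tab; rewrite [leRHS]normcM [leLHS]normcM mulrC.
by rewrite ler_wpM2r ?normc_ge0// normcR ger0_norm// gM.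
Qed.

(** Induction on [k] by the Leibniz rule: in [f' g + f g'] each product again pairs a factor of
    order [k] with one of order [k + 1]. The constant may depend on [f], which will be a fixed
    coefficient. *)
Lemma sob_norm_mul k f : is_sob k f -> exists2 C : R, 0 <= C & forall g, is_sob k.+1 g ->
  sob_norm k (f \* g) <= C * sob_norm k.+1 g.
Proof.
elim: k f => [|k ih] f fs.
  have [C C0 hC] := sob_norm_mul0 fs; exists C => // g gs.
  by rewrite sob_norm0E; exact: hC.
have [C C0 hC] := sob_norm_mul0 (sobolev_Lp ab p1 fs).
have f's : is_sob k (sd k.+1 1 f).
  exact: sobolev_sderiv1.
have [C1 C10 hC1] := ih _ f's; have [C2 C20 hC2] := ih _ (sobolevW ab p1 fs).
(* One constant for each of the norms of [f g] in [L_p], of [f' g] and of [f g']. *)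
exists (C + (C1 + C2)); first by rewrite !addr_ge0.
move=> g gs; have gs1 := sobolevW ab p1 gs.
have g's : is_sob k.+1 (sd k.+2 1 g).
  exact: sobolev_sderiv1.
have fgs := sobolevM ab p1 fs gs.
have fg's : is_sob k (sd k.+1 1 (f \* g)).
  exact: sobolev_sderiv1.
have s1 : is_sob k (sd k.+1 1 f \* g) by exact: (sobolevM ab p1).
have s2 : is_sob k (f \* sd k.+2 1 g) by exact: (sobolevM ab p1 (sobolevW ab p1 fs)).
have s12 : is_sob k ((sd k.+1 1 f \* g) \+ (f \* sd k.+2 1 g)).
  by have := sobolev_lin ab p1 1 s1 s2; congr is_sobolev; apply/funext => t; rewrite /= scale1r.
have leib : sob_eq a b k (sd k.+1 1 (f \* g)) ((sd k.+1 1 f \* g) \+ (f \* sd k.+2 1 g)).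
  apply: (sob_eq_of_ae ab p1 fg's s12); apply: (sderiv_uniq ab (ltn0Sn k) fgs).
  have fd := sderiv_ae ab (ltn0Sn k) fs; have gd := sderiv_ae ab (ltn0Sn k.+1) gs.
  by apply: aeS2 fd gd => t fd gd tab; apply: is_derivM; [exact: fd|exact: gd].
rewrite sob_normSE (sob_norm_eq fg's s12 leib) mulrDl; apply: lerD.
  apply: (le_trans (hC g (sobolev_leq ab p1 (ltn0Sn k.+1) gs))).
  by rewrite ler_wpM2l// sob_norm_leq.
apply: (le_trans (sob_normD s1 s2)); rewrite mulrDl; apply: lerD.
  by apply: (le_trans (hC1 g gs1)); rewrite ler_wpM2l// sob_norm_leq.
apply: (le_trans (hC2 _ g's)); rewrite ler_wpM2l//.
by have := @sob_norm_sderiv k.+1 1 g; rewrite addn1.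
Qed.

End sobolev_norms.

(** * The operator (L, B) *)

Section diffop_theory.
Context {R : realType} (a b : R) (ab : a < b) (p : \bar R) (p1 : (1 <= p)%E).
Variables (n m r' : nat).
Let r := r'.+1.
Notation W := (sobolev ab p1).
Variable A : 'I_r -> 'M[W n]_m.
Notation D := (deriv_fun a b).
Implicit Types y : colsp (W (n + r)) m.

Lemma sob_eq_in k f g : {in `[a, b], f =1 g} -> sob_eq a b k f g.
Proof. by case: k => // fg; apply: aeW => t; exact: fg. Qed.

Lemma sob_eq_gt0 k f g : (0 < k)%N -> sob_eq a b k f g -> {in `[a, b], f =1 g}.
Proof. by case: k. Qed.

Let rn (j : 'I_r) : (j < n + r)%N.
Proof. by rewrite (leq_trans (ltn_ord j))// leq_addl. Qed.

Let aab : a \in `[a, b].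
Proof. by rewrite in_itv/= lexx ltW. Qed.

(** Since [j < n + r], these derivatives are genuine functions on [[a, b]], and their value at [a]
    does not depend on the representative of the class. *)
Definition initial_values y : 'rV[R[i]]_(r * m) :=
  mxvec (\matrix_(j < r, i < m) sderiv a b p (n + r) j (repr (y i)) a).

Lemma initial_values_linear : linear initial_values.
Proof.
move=> c x y; rewrite /initial_values -linearP; congr mxvec.
apply/matrixP => j i; rewrite !mxE !ffunE.
have := sderiv_lin ab (ltnW (rn j)) (is_sobolev_sobfun (repr (x i)))
  (is_sobolev_sobfun (repr (y i))) (is_sobolev_sobfun _) (repr_linE c (x i) (y i)).
by move=> /sob_eq_gt0; rewrite subn_gt0 => /(_ (rn j) a aab).
Qed.

HB.instance Definition _ := GRing.isLinear.Build R[i] (colsp (W (n + r)) m)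
  'rV[R[i]]_(r * m) *:%R initial_values initial_values_linear.

Let As j i q : is_sobolev a b p n (repr (A j i q)).
Proof. exact: is_sobolev_sobfun. Qed.

Let ys y i : is_sobolev a b p (n + r) (repr (y i)).
Proof. exact: is_sobolev_sobfun. Qed.

Lemma diffop_initial_values0 y : diffop A y = 0 -> initial_values y = 0 -> y = 0.
Proof.
move=> Ly0 /eqP; rewrite mxvec_eq0 => /eqP iv0; apply/ffunP => i; rewrite ffunE.
rewrite -[y i]reprqK -(linear0 (to_quotmod (null_submod_closed ab p1 (n + r)))).
apply/sobolev_eqP; apply: sob_eq_in => t tab.
apply: (ivp_unique ab p1 (A := fun j i q => repr (A j i q)) As
  (y := fun i => repr (y i)) (fun i => ys y i)) tab => {i t} i.
  move=> j; have /matrixP/(_ j i) := iv0.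
  by rewrite !mxE sderiv_lt ?rn.
have /ffunP/(_ i) := Ly0; rewrite !ffunE.
rewrite -(linear0 (to_quotmod (null_submod_closed ab p1 n))) => /sobolev_eqP.
exact: sob_eq_ae.
Qed.

Lemma diffop_initial_values f c :
  exists! y, diffop A y = f /\ initial_values y = c.
Proof.
have fs i : is_sobolev a b p n (repr (f i)) by exact: is_sobolev_sobfun.
have [z [zs za zL]] := ivp_exists ab p1 (A := fun j i q => repr (A j i q)) As
  (fun j i => vec_mx c j i) fs.
pose y : colsp (W (n + r)) m := [ffun i => to_quotmod (null_submod_closed ab p1 (n + r))
  (SobFun (sobolev_predP ab p1 (zs i)))].
have yz i : {in `[a, b], repr (y i) =1 z i}.
  apply: (@sob_eq_gt0 (n + r)); first by rewrite addnS.
  have /sobolev_eqP : to_quotmod (null_submod_closed ab p1 (n + r)) (repr (y i)) =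
      to_quotmod (null_submod_closed ab p1 (n + r)) (SobFun (sobolev_predP ab p1 (zs i))).
    by rewrite reprqK ffunE.
  by [].
have yzD j i : (j < r)%N -> {in `[a, b], sderiv a b p (n + r) j (repr (y i)) =1
    sderiv a b p (n + r) j (z i)}.
  move=> jr t tab; rewrite !(@sderiv_lt _ a b p (n + r) j _ (rn (Ordinal jr))).
  exact: (eq_iter_deriv j (yz i) tab).
have yP : diffop A y = f /\ initial_values y = c.
  split; last first.
    rewrite -[c]vec_mxK; congr mxvec; apply/matrixP => j i; rewrite mxE yzD//.
    by rewrite (@sderiv_lt _ a b p (n + r) j _ (rn j)) za.
  apply/ffunP => i; rewrite ffunE -[f i]reprqK; apply/sobolev_eqP.
  apply: (sob_eq_of_ae ab p1 (diffop_sobolev A y i) (fs i)).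
  (* For [n = 0] the [r]-th derivative is the top one, so those of [z i] and of the representative
     of its class can only be compared almost everywhere. *)
  have rd := sderiv_ae ab (rn ord_max) (zs i).
  have := sderiv_uniq ab (rn ord_max) (ys y i) (eq_ae_deriv _ rd).
  move=> /(_ (fun t tab => esym (eq_iter_deriv r' (yz i) tab))).
  apply: aeS2 (zL i) => t zt yt tab; rewrite /diffop_fun yt// -zt//.
  congr (_ + _); apply: eq_bigr => j _; apply: eq_bigr => q _.
  by congr (_ * _); exact: yzD.
exists y; split=> // x [Lx ix]; apply/eqP; rewrite -subr_eq0; apply/eqP.
by apply: diffop_initial_values0; rewrite linearB/= ?Lx ?ix ?yP.1 ?yP.2 subrr.
Qed.

Lemma sobolev_norm_class k f (fs : is_sobolev a b p k f) :
  sobolev_norm (to_quotmod (null_submod_closed ab p1 k) (SobFun (sobolev_predP ab p1 fs))) =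
  sob_norm a b p k f.
Proof.
apply: (sob_norm_eq ab p1 (is_sobolev_sobfun _) fs).
set x := to_quotmod _ _.
have /sobolev_eqP : to_quotmod (null_submod_closed ab p1 k) (repr x) =
    to_quotmod (null_submod_closed ab p1 k) (SobFun (sobolev_predP ab p1 fs)).
  by rewrite reprqK.
by [].
Qed.

(** The derivatives of order [j < r] have order at least [n + 1], which is what [sob_norm_mul]
    requires of the second factor. *)
Lemma diffop_bounded : exists M : R[i], forall y, `|diffop A y| <= M * `|y|.
Proof.
have /choice[C CP] (k : 'I_r * 'I_m * 'I_m) : exists C : R, 0 <= C /\
    forall g, is_sobolev a b p n.+1 g ->
    sob_norm a b p n ((repr (A k.1.1 k.1.2 k.2) : R -> R[i]) \* g) <=
      C * sob_norm a b p n.+1 g.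
  by have [C ? ?] := sob_norm_mul ab p1 (As k.1.1 k.1.2 k.2); exists C.
(* The 1 is for the leading term [y^(r)], the sums for the products with the coefficients in row
   [i]. *)
pose M i := 1 + \sum_j \sum_q C (j, i, q).
exists (\sum_i (M i)%:C) => y; rewrite -rmorph_sum.
pose S := \sum_i sobolev_norm (y i).
have -> : `|y| = S%:C by rewrite /S rmorph_sum.
have -> : `|diffop A y| = (\sum_i sobolev_norm (diffop A y i))%:C by rewrite rmorph_sum.
rewrite -rmorphM lecR mulr_suml; apply: ler_sum => i _.
have yS q : sob_norm a b p (n + r) (repr (y q)) <= S.
  rewrite /S (bigD1 q)//= lerDl; apply: sumr_ge0 => q' _; exact: sob_norm_ge0.
rewrite ffunE sobolev_norm_class.
have sj (j : 'I_r) q : is_sobolev a b p (n + r - j) (sderiv a b p (n + r) j (repr (y q))).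
  have := @sobolev_sderiv _ a b p ab (n + r - j) j (repr (y q)).
  by rewrite subnK ?(ltnW (rn j))//; apply; exact: ys.
have nj (j : 'I_r) : (n < n + r - j)%N.
  by rewrite -addnBA ?(ltnW (ltn_ord j))// -addn1 leq_add2l subn_gt0.
have sj1 (j : 'I_r) q : is_sobolev a b p n.+1 (sderiv a b p (n + r) j (repr (y q))).
  exact: (sobolev_leq ab p1 (nj j)).
have sA (j : 'I_r) q : is_sobolev a b p n (fun t =>
    repr (A j i q) t * sderiv a b p (n + r) j (repr (y q)) t).
  exact: (sobolevM ab p1 (As j i q)).
have sAj (j : 'I_r) : is_sobolev a b p n (fun t => \sum_q
    repr (A j i q) t * sderiv a b p (n + r) j (repr (y q)) t).
  exact: (sobolev_sum ab p1).
apply: (le_trans (sob_normD ab p1 (sobolev_sderiv ab (ys y i)) (sobolev_sum ab p1 _ sAj))).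
rewrite /M mulrDl mul1r; apply: lerD.
  exact: le_trans (sob_norm_sderiv _ _ _ _ _ _) (yS i).
apply: (le_trans (sob_norm_sum ab p1 _ sAj)); rewrite mulr_suml; apply: ler_sum => j _.
apply: (le_trans (sob_norm_sum ab p1 _ (sA j))); rewrite mulr_suml; apply: ler_sum => q _.
have [C0 hC] := CP (j, i, q).
apply: (le_trans (hC _ (sj1 j q))); rewrite ler_wpM2l//.
apply: (le_trans _ (yS q)); apply: (le_trans (sob_norm_leq ab p1 (nj j) (sj j q))).
have := sob_norm_sderiv a b p (n + r - j) j (repr (y q)).
by rewrite subnK// ltnW.
Qed.

End diffop_theory.

Lemma pair_map_bounded (K : numFieldType) (V W1 W2 : normedModType K)
    (L : {linear V -> W1}) (B : {linear V -> W2}) :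
  (exists M : K, forall x, `|L x| <= M * `|x|) -> continuous B ->
  exists M : K, forall x, `|pair_map L B x| <= M * `|x|.
Proof.
move=> [M hM] /linear_bounded_continuous/linear_boundedP.
move=> /pinfty_ex_gt0[N N0 hN]; exists (M + N) => x.
rewrite prod_normE /pair_map/= mulrDl.
have MN : 0 <= M * `|x| by exact: le_trans (hM x).
have NN : 0 <= N * `|x| by exact: le_trans (hN x).
(* [K] is only partially ordered, but the maximum is one of its two arguments in either case. *)
rewrite maxElt; case: ifP => _.
  by rewrite (le_trans (hN x))// lerDr.
by rewrite (le_trans (hM x))// lerDl.
Qed.

Theorem theorem1 (R : realType) (a b : R) (hab : a < b) (p : \bar R)
    (hp : (1 <= p)%E) (n m r l : nat)
    (hm : (0 < m)%N) (hr : (0 < r)%N) (hl : (0 < l)%N)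
    (A : 'I_r -> 'M[sobolev hab hp n]_m)
    (B : {linear colsp (sobolev hab hp (n + r)) m -> 'cV[R[i]]_l})
    (hB : continuous B) :
  is_fredholm (pair_map (diffop A) B) /\
  fredholm_index (pair_map (diffop A) B) = (r * m)%:Z - l%:Z.
Proof.
case: r hr A B hB => // r _ A B hB.
pose ev : {linear colsp (sobolev hab hp (n + r.+1)) m -> 'rV[R[i]]_(r.+1 * m)} :=
  @initial_values R a b hab p hp n m r.
apply: (@pair_map_fredholm _ _ _ _ _ (diffop A) B ev).
  exact: diffop_initial_values.
exact: pair_map_bounded (diffop_bounded A) hB.
Qed.
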